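(* (1) Let $S$ be a closed oriented really flat surface. Then there exist a flat surface $S^*$ that is very flat and a flat Galois covering $\psi: S^*\to S$. (2) Let $\alpha: S''\to S'$ be a flat covering between closed oriented flat surfaces. Then $S''$ is really flat if and only if $S'$ is really flat.
   Context: All surfaces are compact, connected and $C^\infty$; here they are also closed (without boundary) and oriented, and all flat coverings are orientation preserving. A flat surface is a surface with a flat metric having finitely many singularities of conical type (so each point $x$ has a cone angle $\theta(x)>0$, and $x$ is singular if $\theta(x)\neq 2\pi$). Let $\mathfrak{s}$ be the finite set of singular points of a flat surface $S$. For $y\in S-\mathfrak{s}$, parallel transport along loops gives the holonomy representation $hol:\pi_1(S-\mathfrak{s},y)\to\mathbb{T}=\{z\in\mathbb{C}:|z|=1\}$, where $\mathbb{T}$ is identified with the rotations of the unit circle in $T_yS$. Its image is the holonomy group of $S$. A closed orientable flat surface is very flat if its holonomy group is trivial, and it is really flat if its holonomy group is finite. For a branched covering $\psi:S^*\to S$, let $\mathfrak{b}\subset S$ denote its set of branch points. A map $\psi:S^*\to S$ between flat surfaces is a flat covering (flat map) if it is a (finite) branched covering and its restriction $S^*-\psi^{-1}(\mathfrak{b})\to S-\mathfrak{b}$ is a local isometry. It is Galois if the group of its deck transformations acts transitively on fibers. *)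

(* Defs.v *)
From HB Require Import structures.
From mathcomp Require Import all_boot all_order all_algebra.
From mathcomp Require Import complex.
From mathcomp Require Import all_classical all_reals all_analysis.

Set Implicit Arguments.
Unset Strict Implicit.
Unset Printing Implicit Defensive.

Import Order.TTheory GRing.Theory Num.Theory.
Import numFieldNormedType.Exports.

Local Open Scope classical_set_scope.
Local Open Scope ring_scope.
Local Open Scope complex_scope.

(* The ascription to numFieldType is what equips R[i] with its topology. *)
Notation plane R := (R[i] : numFieldType).

Definition polar (R : realType) (rho t : R) : plane R :=
  (rho * cos t) +i* (rho * sin t).

(* Only the restriction of [coord] to [dom] is meaningful. *)
Record chart (R : realType) (T : Type) := Chart {
  dom : set T;
  coord :> T -> plane R }.

(* c is a homeomorphism from the open set [dom c] onto an open subset of C. *)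
Definition is_chart (R : realType) (T : topologicalType) (c : chart R T) :=
  [/\ open (dom c),
      {in dom c &, injective c},
      (forall x, dom c x -> {for x, continuous c}) &
      (forall A : set T, open A -> A `<=` dom c -> open (c @` A))].

(* Near x, the change of coordinates from c to c' is z |-> a * z + b. *)
Definition transition (R : realType) (T : topologicalType)
    (c c' : chart R T) (x : T) (a b : plane R) :=
  \forall y \near x, c' y = a * c y + b.

(* The Euclidean cone of angle theta is { (rho, t) : rho >= 0 } with t taken
   modulo theta and all (0, t) identified; (rho, t) |-> polar rho t is a local
   orientation-preserving isometry away from the apex.  A cone chart at x is an
   isometry from [dom c] onto the open disc of radius r about the apex, the
   point (rho, t) of the cone being recorded in C as
   polar rho (2 * pi * t / theta).  The isometry condition says that, away from
   x, polar rho t is a local coordinate of the flat structure given by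
   [atlas]. *)
Definition cone_chart (R : realType) (T : topologicalType)
    (atlas : set (chart R T)) (regular : set T)
    (x : T) (theta r : R) (c : chart R T) :=
  [/\ is_chart c, dom c x /\ c x = 0,
      0 < r /\ c @` dom c = [set z : plane R | `|z| < r%:C],
      dom c `\ x `<=` regular &
      forall (y : T) (phi : chart R T) (rho t : R),
        dom c y -> atlas phi -> dom phi y -> 0 < rho ->
        c y = polar rho (2 * pi * t / theta) ->
        exists a b : plane R, `|a| = 1 /\
          \forall p \near ((rho, t) : R * R), forall y' : T,
            dom c y' -> c y' = polar p.1 (2 * pi * p.2 / theta) ->
            phi y' = a * polar p.1 p.2 + b].

(* Closed oriented flat surfaces.  The flat metric and the orientation off the
   singular set are given by an atlas of oriented isometric charts into the
   Euclidean plane C, whose changes of coordinates are locally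
   z |-> a * z + b with |a| = 1.  Every point, singular or not, has a
   neighbourhood isometric to a disc about the apex of the cone of angle
   [angle x]; this determines [angle x], and makes the space a surface. *)
Record flat_surface (R : realType) := FlatSurface {
  carrier :> topologicalType;
  angle : carrier -> R;
  atlas : set (chart R carrier);
  flat_nonempty : [set: carrier] !=set0;
  flat_hausdorff : hausdorff_space carrier;
  flat_compact : compact [set: carrier];
  flat_connected : connected [set: carrier];
  angle_gt0 : forall x, 0 < angle x;
  singular_finite : finite_set [set x | angle x <> 2 * pi];
  atlas_chart : forall c, atlas c -> is_chart c;
  atlas_cover :
    \bigcup_(c in atlas) dom c = [set x | angle x = 2 * pi];
  atlas_compatible : forall c c' x, atlas c -> atlas c' ->
    dom c x -> dom c' x ->
    exists a b : plane R, `|a| = 1 /\ transition c c' x a b;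
  conical : forall x, exists r c,
    cone_chart atlas [set y | angle y = 2 * pi] x (angle x) r c }.

Definition singular (R : realType) (S : flat_surface R) : set S :=
  [set x | angle x <> 2 * pi].

Definition regular (R : realType) (S : flat_surface R) : set S :=
  [set x | angle x = 2 * pi].

(* A loop of S - s based at y, parametrized by [0, 1]. *)
Definition regular_loop (R : realType) (S : flat_surface R)
    (y : S) (gamma : R -> S) :=
  [/\ {within `[0, 1], continuous gamma}, gamma 0 = y, gamma 1 = y &
      forall t, t \in `[0, 1] -> regular (gamma t)].

(* X t c is the coordinate expression, in the chart c at gamma t, of a tangent
   vector at gamma t; hence the change of coordinates z |-> a * z + b acts on it
   by its derivative a.  Flat charts trivialize parallel transport: the field is
   parallel iff its coordinates are locally constant. *)
Definition parallel_field (R : realType) (S : flat_surface R)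
    (gamma : R -> S) (X : R -> chart R S -> plane R) :=
  (forall t c c' a b, t \in `[0, 1] -> atlas c -> atlas c' ->
     dom c (gamma t) -> dom c' (gamma t) -> transition c c' (gamma t) a b ->
     X t c' = a * X t c) /\
  (forall t c, t \in `[0, 1] -> atlas c -> dom c (gamma t) ->
     \forall u \near t, u \in `[0, 1] -> X u c = X t c).

(* hol(gamma) = a : parallel transport along the loop gamma takes a unit vector
   v at y to a * v.  Rotations of a tangent plane commute with parallel
   transport, so a depends neither on the unit vector nor on the chart at y. *)
Definition hol (R : realType) (S : flat_surface R)
    (y : S) (gamma : R -> S) (a : plane R) :=
  exists X, parallel_field gamma X /\
    forall c, atlas c -> dom c y -> `|X 0 c| = 1 /\ X 1 c = a * X 0 c.

(* hol is invariant under homotopy in S - s, so its values on loops form the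
   image of the representation of pi_1(S - s, y). *)
Definition holonomy_group (R : realType) (S : flat_surface R) (y : S)
    : set (plane R) :=
  [set a | exists gamma, regular_loop y gamma /\ hol y gamma a].

Definition very_flat (R : realType) (S : flat_surface R) :=
  forall y : S, regular y -> holonomy_group y = [set 1].

Definition really_flat (R : realType) (S : flat_surface R) :=
  forall y : S, regular y -> finite_set (holonomy_group y).

(* In suitable topological charts at x and psi x, psi is z |-> z ^+ k. *)
Definition local_degree (R : realType) (T U : topologicalType)
    (psi : T -> U) (x : T) (k : nat) :=
  (0 < k)%N /\ exists (c : chart R T) (c' : chart R U),
    [/\ is_chart c /\ is_chart c', dom c x /\ c x = 0,
        dom c' (psi x) /\ c' (psi x) = 0 &
        forall y, dom c y -> dom c' (psi y) /\ c' (psi y) = c y ^+ k].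

Definition branched_covering (R : realType) (T U : topologicalType)
    (psi : T -> U) :=
  [/\ continuous psi, range psi = [set: U],
      (forall y, finite_set (psi @^-1` [set y])) &
      (forall x, exists k, local_degree R psi x k)].

Definition branch_points (R : realType) (T U : topologicalType)
    (psi : T -> U) : set U :=
  [set y | exists x k, [/\ psi x = y, local_degree R psi x k & (1 < k)%N]].

(* psi maps a conical disc about x isometrically, and preserving orientation,
   onto a conical disc about psi x of the same angle and radius. *)
Definition local_isometry_at (R : realType) (S S' : flat_surface R)
    (psi : S -> S') (x : S) :=
  angle (psi x) = angle x /\
  exists r c c',
    [/\ cone_chart (@atlas R S) (@regular R S) x (angle x) r c,
        cone_chart (@atlas R S') (@regular R S')
          (psi x) (angle (psi x)) r c' &
        forall y, dom c y -> dom c' (psi y) /\ c' (psi y) = c y].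

Definition flat_covering (R : realType) (S S' : flat_surface R)
    (psi : S -> S') :=
  branched_covering R psi /\
  forall x, ~ branch_points R psi (psi x) -> local_isometry_at psi x.

Definition deck_transformation (T U : topologicalType) (psi : T -> U)
    (h : T -> T) :=
  [/\ continuous h, psi \o h = psi &
      exists h' : T -> T, [/\ continuous h', cancel h h' & cancel h' h]].

Definition galois (T U : topologicalType) (psi : T -> U) :=
  forall x x' : T, psi x = psi x' ->
    exists h, deck_transformation psi h /\ h x = x'.

(* Main.v *)
Require Import Defs.
From HB Require Import structures.
From mathcomp Require Import all_boot all_order all_algebra.
From mathcomp Require Import complex.
From mathcomp Require Import all_classical all_reals all_analysis.
From mathcomp Require Import ring lra.
Set Implicit Arguments.
Unset Strict Implicit.
Unset Printing Implicit Defensive.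
Import Order.TTheory GRing.Theory Num.Theory.
Import numFieldNormedType.Exports.
Local Open Scope classical_set_scope.
Local Open Scope ring_scope.
Local Open Scope complex_scope.

(* Part (2): a surface is really flat iff one can single out, at every regular
   point, a family of isometric charts which is closed under translations,
   locally constant, and finite up to translation: transport one chart along
   paths; conversely the holonomy of a loop permutes this finite set.  Away from
   the branch points such families pull back and push forward along flat
   coverings, and they extend across isolated punctures.

   Part (1): given a family as above, the points of the cover over a regular
   point are the distinguished charts up to translation.  Over an arbitrary point
   x of angle theta, they are the multivalued distinguished branches on the
   punctured cone at x; going round x multiplies a branch by exp(i theta), so
   such a branch is determined by the k-th power of its rotation, k being the
   order of exp(i theta).  Each point of the cover comes with a preferred chart,
   hence all transition maps are translations; a minimal family yields a
   connected cover, on which the global rotations act as deck transformations. *)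

(** No homotopy or path lifting is used: each continuation applies the connectedness of an interval,
    a strip or the surface to a locally constant predicate. Families of charts replace the holonomy
    group because a condition imposed at each point can be pulled back, pushed forward and filled in
    at a puncture, whereas loops would have to be moved off the branch points.

    The minimal family consists of the charts reached by parallel transport from one chart.
    Minimality is used as an induction principle: a translation-invariant, locally constant
    predicate that holds for one distinguished chart holds for all. It yields the connectedness of
    the cover, and it makes the ratio of two distinguished branches at one point a symmetry
    everywhere.

    The order k exists because the finite set of branch rotations at x is stable under exp(i theta).
    It is also the local degree of the projection, and the angle upstairs is k theta, a multiple of
    2 pi. This can be 2 pi over a singular x (theta = pi, k = 2), so the atlas of the cover needs
    charts centred over singular points. Multivalued branches become single valued on the strip of
    polar coordinates (rho, t) with t real. *)

Lemma filter_finite {T : Type} {I : eqType} (F : set_system T) {FF : Filter F}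
    (D : set I) (f : I -> set T) :
  finite_set D -> (forall i, D i -> F (f i)) -> F [set t | forall i, D i -> f i t].
Proof.
move=> /finite_seqP[s ->]; elim: s => [|i s ih] h.
  by apply: filterS filterT => t _ i; rewrite /= in_nil.
have hi : F (f i) by apply: h; rewrite /= mem_head.
have hs : F [set t | forall i, [set` s] i -> f i t].
  by apply: ih => j js; apply: h; rewrite /= in_cons js orbT.
apply: filterS2 hi hs => t ti ts j /=; rewrite in_cons => /orP[/eqP -> //|].
exact: ts.
Qed.

#[global] Instance nbhs_plane_filter {R : realType} (z : plane R) :
  ProperFilter (nbhs z) := nbhs_pfilter z.

(** * The Euclidean plane and polar coordinates *)

Section Plane.
Context {R : realType}.
Implicit Types (z w : plane R) (rho s t : R).

Lemma normr_plane z : `|z| = (Num.sqrt (complex.Re z ^+ 2 + complex.Im z ^+ 2))%:C.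
Proof. exact: normc_def. Qed.

Lemma ltr_plane z (e : R) :
  (`|z| < e%:C) = (Num.sqrt (complex.Re z ^+ 2 + complex.Im z ^+ 2) < e).
Proof. by rewrite normr_plane ltcR. Qed.

Lemma nbhs_planeP z (P : set (plane R)) :
  nbhs z P <-> exists2 e : R, 0 < e & forall w, `|w - z| < e%:C -> P w.
Proof.
split.
  move=> /nbhs_ballP[e /= e0 eP]; exists (complex.Re e).
    by move: e0; rewrite ltcE => /andP[].
  move=> w wz; apply: eP; rewrite -ball_normE /= distrC.
  have -> : e = (complex.Re e)%:C; last by [].
  by move: e0; case: (e) => a b; rewrite ltcE /= => /andP[/eqP -> _].
move=> [e e0 eP]; apply/nbhs_ballP; exists (e%:C) => /=; first by rewrite ltcR.
by move=> w; rewrite -ball_normE /= distrC => /eP.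
Qed.

Lemma open_disc (r : R) : open [set z : plane R | `|z| < r%:C].
Proof.
rewrite openE => z /= hz; apply/nbhs_planeP.
have [s es] : exists s : R, `|z| = s%:C by eexists; exact: normr_plane.
move: hz; rewrite es ltcR => hz; exists (r - s); first by rewrite subr_gt0.
move=> w hw; rewrite /= -[w](subrK z); apply: (le_lt_trans (ler_normD _ _)).
by rewrite es -ltrBrDr -rmorphB.
Qed.

Lemma cvg_plane {T : Type} {F : set_system T} {FF : Filter F}
    (f : T -> plane R) z :
  (fun x => complex.Re (f x)) @ F --> complex.Re z ->
  (fun x => complex.Im (f x)) @ F --> complex.Im z ->
  f @ F --> z.
Proof.
move=> /cvgrPdist_lt hr /cvgrPdist_lt hi A /nbhs_planeP[e e0 eA].
have e2 : 0 < e / 2 by rewrite divr_gt0.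
change (\forall x \near F, A (f x)).
near=> x; apply: eA; rewrite ltr_plane !raddfB /=.
have hrx : `|complex.Re (f x) - complex.Re z| < e / 2 by rewrite distrC; near: x; exact: hr.
have hix : `|complex.Im (f x) - complex.Im z| < e / 2 by rewrite distrC; near: x; exact: hi.
have h a b : 0 <= a -> 0 <= b -> Num.sqrt (a ^+ 2 + b ^+ 2) <= a + b :> R.
  move=> a0 b0; rewrite -[leRHS]ger0_norm ?addr_ge0// -sqrtr_sqr ler_wsqrtr//.
  by rewrite sqrrD lerD2r lerDl mulrn_wge0 ?mulr_ge0.
rewrite -(real_normK (num_real (complex.Re _ - _))).
rewrite -(real_normK (num_real (complex.Im _ - _))).
by apply: le_lt_trans (h _ _ (normr_ge0 _) (normr_ge0 _)) _; lra.
Unshelve. all: by end_near. Qed.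

Lemma continuous_Re : continuous (@complex.Re R : plane R -> R).
Proof.
move=> z; apply/(@cvgrPdist_lt R R _ (nbhs z) _ _ _) => e e0.
apply/nbhs_planeP; exists e => // w.
rewrite ltr_plane => h; apply: le_lt_trans h.
rewrite distrC -raddfB -[leLHS]sqrtr_sqr ler_wsqrtr// lerDl.
exact: sqr_ge0.
Qed.

Lemma continuous_Im : continuous (@complex.Im R : plane R -> R).
Proof.
move=> z; apply/(@cvgrPdist_lt R R _ (nbhs z) _ _ _) => e e0.
apply/nbhs_planeP; exists e => // w.
rewrite ltr_plane => h; apply: le_lt_trans h.
rewrite distrC -raddfB -[leLHS]sqrtr_sqr ler_wsqrtr// lerDr.
exact: sqr_ge0.
Qed.

Lemma normr_polar rho t : 0 <= rho -> `|polar rho t| = rho%:C.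
Proof.
move=> r0; rewrite normr_plane /= !exprMn -mulrDr cos2Dsin2 mulr1 sqrtr_sqr.
by rewrite ger0_norm.
Qed.

Lemma polarM rho s rho' s' :
  polar rho s * polar rho' s' = polar (rho * rho') (s + s').
Proof.
apply/eqP; rewrite eq_complex /= cosD sinD.
by apply/andP; split; apply/eqP; ring.
Qed.

Lemma polar00 : polar 1 0 = 1 :> plane R.
Proof. by rewrite /polar cos0 sin0 mulr0 mulr1. Qed.

Lemma polar0 t : polar 0 t = 0 :> plane R.
Proof. by rewrite /polar !mul0r. Qed.

Lemma polar_realM rho t : polar rho t = rho%:C * polar 1 t.
Proof. by apply/eqP; rewrite eq_complex /= !mul0r !mul1r subr0 addr0 !eqxx. Qed.

Lemma polar_neq0 rho t : 0 < rho -> polar rho t != 0.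
Proof.
move=> r0; rewrite -normr_eq0 normr_polar ?ltW//.
by rewrite (inj_eq (@complexI R)) gt_eqF.
Qed.

Lemma polarX rho t n : polar rho t ^+ n = polar (rho ^+ n) (t *+ n).
Proof.
elim: n => [|n ih]; first by rewrite !expr0 mulr0n polar00.
by rewrite exprS ih polarM mulrS exprS.
Qed.

Lemma polarDpi rho t (j : int) : polar rho (t + 2 * pi * j%:~R) = polar rho t.
Proof.
have hn (x : R) (n : nat) : cos (x + 2 * pi * n%:R) = cos x /\
    sin (x + 2 * pi * n%:R) = sin x.
  have -> : x + 2 * pi * n%:R = x + (pi *+ 2) *+ n :> R.
    rewrite -[X in _ = _ + X]mulr_natr -[X in _ = _ + X * _]mulr_natr.
    by rewrite (mulrC 2).
  by split; [exact: (periodicn (@cosD2pi R))|exact: (periodicn (@sinD2pi R))].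
rewrite /polar; case: j => n.
  by have [-> ->] := hn t n.
have [h1 h2] := hn (t + 2 * pi * (Negz n)%:~R) n.+1.
rewrite -h1 -h2 NegzE.
have -> : t + 2 * pi * (- n.+1%:Z)%:~R + 2 * pi * n.+1%:R = t.
  by rewrite mulrNz; ring.
by [].
Qed.

(** Reduce [t] modulo 2 pi to [y] in [0, 2 pi). Cosine is injective on [0, pi], which settles
    [y <= pi]; otherwise the reflected angle 2 pi - y lies in that interval and would have to be
    0. *)
Lemma cos_eq1 t : cos t = 1 -> exists j : int, t = 2 * pi * j%:~R.
Proof.
move=> ht; have pi2 : 0 < 2 * pi :> R by rewrite mulr_gt0// pi_gt0.
pose j := Num.floor (t / (2 * pi)); exists j.
pose y := t - 2 * pi * j%:~R.
have y0 : 0 <= y < 2 * pi.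
  have h1 := ge_floor (t / (2 * pi)); have h2 := floorD1_gt (t / (2 * pi)).
  move: h1 h2; rewrite -/j ler_pdivlMr// ltr_pdivrMr// intrD => h1 h2.
  rewrite /y; apply/andP; split; first lra.
  by move: h2; rewrite mulrDl mul1r; lra.
have hy : cos y = 1.
  have : polar 1 (y + 2 * pi * j%:~R) = polar 1 y by exact: polarDpi.
  by rewrite /polar subrK !mul1r => -[<-].
suff : y = 0 by rewrite /y => /eqP; rewrite subr_eq0 => /eqP.
have hpi := pi_gt0 R.
case/andP: y0 => y0 y2pi; have [yp|yp] := lerP y pi.
  apply: cos_inj; rewrite ?in_itv /= ?y0 ?yp ?lexx ?(ltW hpi)//.
  by rewrite hy cos0.
have : 2 * pi - y = 0.
  apply: cos_inj; rewrite ?in_itv /= ?lexx ?(ltW hpi)//.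
    by apply/andP; split; lra.
  rewrite cos0.
  have : polar 1 (- y + 2 * pi * 1%:~R) = polar 1 (- y) by exact: polarDpi.
  by rewrite /polar !mul1r mulr1 addrC => -[-> _]; rewrite cosN.
by lra.
Qed.

Lemma polar_inj rho s rho' s' : 0 < rho -> 0 < rho' ->
  polar rho s = polar rho' s' ->
  rho = rho' /\ exists j : int, s' = s + 2 * pi * j%:~R.
Proof.
move=> r0 r0' h.
have e : rho = rho'.
  have : `|polar rho s| = `|polar rho' s'| by rewrite h.
  by rewrite !normr_polar ?ltW// => /complexI.
split=> //; move: h; rewrite -e => -[].
have rn : rho != 0 by rewrite gt_eqF.
move=> /(mulfI rn) hc /(mulfI rn) hs.
have : cos (s' - s) = 1 by rewrite cosB hc hs -!expr2 cos2Dsin2.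
by move=> /cos_eq1[j hj]; exists j; rewrite -hj addrC subrK.
Qed.

Lemma polar_surj z : exists rho t, 0 <= rho /\ z = polar rho t.
Proof.
have [->|z0] := eqVneq z 0; first by exists 0, 0; rewrite polar0.
pose rho := Num.sqrt (complex.Re z ^+ 2 + complex.Im z ^+ 2).
have r0 : 0 < rho.
  by rewrite -ltcR -normr_plane normr_gt0.
have rn : rho != 0 by rewrite gt_eqF.
have hr : rho ^+ 2 = complex.Re z ^+ 2 + complex.Im z ^+ 2.
  by rewrite sqr_sqrtr// addr_ge0// sqr_ge0.
pose c := complex.Re z / rho; pose d := complex.Im z / rho.
have cd : c ^+ 2 + d ^+ 2 = 1.
  by rewrite /c /d !exprMn -mulrDl -hr -exprMn divff// expr1n.
have c1 : -1 <= c <= 1.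
  rewrite -ler_norml -(@ler_pXn2r _ 2)// ?nnegrE// expr1n real_normK ?num_real//.
  by rewrite -cd lerDl sqr_ge0.
have hs : sin (acos c) = `|d|.
  by rewrite sin_acos// -cd addrC addKr sqrtr_sqr.
have hc : cos (acos c) = c by rewrite acosK// in_itv.
(* [acos] only returns angles in [0, pi], so the sign of the imaginary part selects the half
   plane. *)
exists rho, (if 0 <= d then acos c else - acos c); split; first exact: ltW.
apply/eqP; rewrite eq_complex /=; apply/andP; split; apply/eqP.
  have -> : cos (if 0 <= d then acos c else - acos c) = c.
    by case: ifP; rewrite ?cosN.
  by rewrite /c mulrCA mulfV// mulr1.
have -> : sin (if 0 <= d then acos c else - acos c) = d.
  case: ifPn => h; first by rewrite hs ger0_norm.
  by rewrite sinN hs ltr0_norm ?opprK// ltNge.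
by rewrite /d mulrCA mulfV// mulr1.
Qed.

Lemma continuous_polar : continuous (fun p : R * R => polar p.1 p.2).
Proof.
move=> [rho t]; apply: cvg_plane => /=; apply: cvgM; rewrite /=.
- exact: cvg_fst.
- apply: (cvg_comp _ _ (@cvg_snd _ _ _ _ _)); exact: continuous_cos.
- exact: cvg_fst.
- apply: (cvg_comp _ _ (@cvg_snd _ _ _ _ _)); exact: continuous_sin.
Qed.

Lemma polar_atan z : 0 < complex.Re z ->
  polar (Num.sqrt (complex.Re z ^+ 2 + complex.Im z ^+ 2)) (atan (complex.Im z / complex.Re z)) = z.
Proof.
move=> a0; set a := complex.Re z; set b := complex.Im z.
have an : a != 0 by rewrite gt_eqF.
set s := Num.sqrt _.
have s0 : 0 < s by rewrite sqrtr_gt0 ltr_pwDl ?exprn_gt0 ?sqr_ge0.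
have hc : cos (atan (b / a)) = a / s.
  rewrite cos_atan; have -> : 1 + (b / a) ^+ 2 = (s / a) ^+ 2.
    rewrite [in RHS]exprMn sqr_sqrtr ?addr_ge0 ?sqr_ge0//.
    by field.
  by rewrite sqrtr_sqr ger0_norm ?invf_div// divr_ge0 ?ltW.
have hs : sin (atan (b / a)) = b / s.
  have := atanK (b / a); rewrite /tan hc => /(canRL (divfK _)) ->.
    by field; rewrite an gt_eqF.
  by rewrite mulf_neq0 ?invr_eq0 ?gt_eqF.
rewrite /polar hc hs; apply/eqP; rewrite eq_complex /=.
by apply/andP; split; apply/eqP; rewrite mulrCA mulfV ?mulr1 ?gt_eqF.
Qed.

(** Rotating by [- t] brings the point to the positive real axis, where modulus and arctangent of
    the slope give a continuous local inverse [q] of the polar map. *)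
Lemma polar_open rho t (P : set (R * R)) : 0 < rho -> nbhs (rho, t) P ->
  \forall z \near (polar rho t : plane R), exists2 p, P p & z = polar p.1 p.2.
Proof.
move=> r0 hP.
pose rot z := z * polar 1 (- t) : plane R.
pose q z : R * R := (Num.sqrt (complex.Re (rot z) ^+ 2 + complex.Im (rot z) ^+ 2),
  t + atan (complex.Im (rot z) / complex.Re (rot z))).
have rot0 : rot (polar rho t) = polar rho 0 by rewrite /rot polarM mulr1 subrr.
have rotR0 : complex.Re (rot (polar rho t)) = rho by rewrite rot0 /= cos0 mulr1.
have rotI0 : complex.Im (rot (polar rho t)) = 0 by rewrite rot0 /= sin0 mulr0.
have cRe : complex.Re (rot z) @[z --> (polar rho t : plane R)] --> rho.
  have cv (z0 : plane R) : complex.Re (rot z) @[z --> z0] --> complex.Re (rot z0).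
    have h z : complex.Re (rot z) = complex.Re z * cos t + complex.Im z * sin t.
      by case: z => a b; rewrite /rot /polar /= cosN sinN !mul1r mulrN opprK.
    rewrite h (_ : (fun z => _) = fun z =>
      complex.Re z * cos t + complex.Im z * sin t); last exact/funext.
    have h1 := cvgM (@continuous_Re z0) (cvg_cst (cos t)).
    have h2 := cvgM (@continuous_Im z0) (cvg_cst (sin t)).
    exact: (cvgD (h1 _ _) (h2 _ _)).
  by have := cv (polar rho t); rewrite rotR0.
have cIm : complex.Im (rot z) @[z --> (polar rho t : plane R)] --> (0 : R).
  have cv (z0 : plane R) : complex.Im (rot z) @[z --> z0] --> complex.Im (rot z0).
    have h z : complex.Im (rot z) = complex.Im z * cos t - complex.Re z * sin t.
      by case: z => a b; rewrite /rot /polar /= cosN sinN !mul1r mulrN addrC.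
    rewrite h (_ : (fun z => _) = fun z =>
      complex.Im z * cos t - complex.Re z * sin t); last exact/funext.
    have h1 := cvgM (@continuous_Im z0) (cvg_cst (cos t)).
    have h2 := cvgM (@continuous_Re z0) (cvg_cst (sin t)).
    exact: (cvgB (h1 _ _) (h2 _ _)).
  by have := cv (polar rho t); rewrite rotI0.
have cq : q z @[z --> (polar rho t : plane R)] --> (rho, t).
  have h1 : Num.sqrt (complex.Re (rot z) ^+ 2 + complex.Im (rot z) ^+ 2)
      @[z --> (polar rho t : plane R)] --> rho.
    have -> : nbhs rho = nbhs (Num.sqrt (rho ^+ 2 + 0 ^+ 2)).
      by rewrite expr0n /= addr0 sqrtr_sqr gtr0_norm.
    apply: continuous_cvg; first exact: sqrt_continuous.
    exact: (cvgD (cvgM cRe cRe) (cvgM cIm cIm)).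
  have h2 : t + atan (complex.Im (rot z) / complex.Re (rot z))
      @[z --> (polar rho t : plane R)] --> t.
    have -> : nbhs t = nbhs (t + atan (0 / rho)) by rewrite mul0r atan0 addr0.
    apply: (cvgD (cvg_cst t)).
    apply: continuous_cvg; first exact: continuous_atan.
    by apply: (cvgM cIm); apply: cvgV cRe; rewrite gt_eqF.
  exact: cvg_pair h1 h2.
have hpos : \forall z \near (polar rho t : plane R), 0 < complex.Re (rot z).
  exact: (cvgr_gt _ cRe 0 r0).
have := cq _ hP => hq; near=> z; exists (q z); first by near: z.
have zp : 0 < complex.Re (rot z) by near: z.
rewrite /q /= -[LHS]mulr1 -polar00 -[X in polar _ X](addNr t) -(mul1r 1) -polarM.
rewrite mulrA -/(rot z) -{1}(polar_atan zp) polarM mulr1.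
by congr polar; rewrite addrC.
Unshelve. all: by end_near. Qed.

End Plane.

(** * Continuation of locally constant predicates *)

Lemma cvg_nbhs_pair {T : Type} {U V : topologicalType} {F : set_system T}
    {FF : Filter F} (f : T -> U) (g : T -> V) (a : U) (b : V) :
  f @ F --> a -> g @ F --> b -> (fun x => (f x, g x)) @ F --> (a, b).
Proof. by move=> h1 h2; exact: cvg_pair h1 h2. Qed.

(** The set where [A] holds is both open and closed relative to [D]. Continuation along paths,
    inside punctured cones and over the whole surface all reduce to this form. *)
Lemma locconst_connected {T : topologicalType} (D : set T) (A : T -> Prop) x y :
  connected D -> (forall u, D u -> \forall v \near u, D v -> (A v <-> A u)) ->
  D x -> D y -> A x -> A y.
Proof.
move=> cD h Dx Dy Ax.
have Dy' : (D `&` A) y; last by case: Dy'.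
suff -> : D `&` A = D by [].
apply: cD; first by exists x.
- exists (interior [set v | D v -> A v]); first exact: open_interior.
  apply/seteqP; split=> u /= -[Du].
    move=> Au; split=> //; rewrite /interior /=.
    by apply: filterS (h u Du) => v hv Dv; exact/(hv Dv).
  by move=> /nbhs_singleton /(_ Du).
- exists (~` interior [set v | D v -> ~ A v]).
    by apply: open_closedC; exact: open_interior.
  apply/seteqP; split=> u /= -[Du].
    by move=> Au; split=> // /nbhs_singleton /(_ Du).
  move=> nAu; split=> //; apply: contrapT => nA; apply: nAu; rewrite /interior /=.
  by apply: filterS (h u Du) => v hv Dv /(hv Dv).
Qed.

(** The strip ]0, r[ x R is the universal cover of a punctured disc. Two moves connect its points:
    one along the radius, then one along the angle. *)
Lemma locconst_rectangle {R : realType} (r : R) (A : R * R -> Prop) p q :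
  (forall p, 0 < p.1 < r -> \forall q \near p, A q <-> A p) ->
  0 < p.1 < r -> 0 < q.1 < r -> A p -> A q.
Proof.
case: p q => [rho t] [rho' t'] /= h hr hr' Ap.
have A1 : A (rho', t).
  have := @locconst_connected R `]0, r[%classic (fun u => A (u, t)) rho rho'.
  apply=> //=; rewrite ?in_itv //=.
    by apply/connected_intervalP; exact: interval_is_interval.
  move=> u; rewrite /= in_itv /= => hu.
  have cu : (fun v : R => (v, t)) @ u --> (u, t).
    by apply: cvg_nbhs_pair; [exact: cvg_id|exact: cvg_cst].
  have hh : \forall v \near u, A (v, t) <-> A (u, t) := cu _ (h (u, t) hu).
  by apply: filterS hh.
have := @locconst_connected R setT (fun u => A (rho', u)) t t'.
apply=> //=.
  by apply/connected_intervalP => ? ? ? ?.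
move=> u _.
have cu : (fun v : R => (rho', v)) @ u --> (rho', u).
  by apply: cvg_nbhs_pair; [exact: cvg_cst|exact: cvg_id].
have hh : \forall v \near u, A (rho', v) <-> A (rho', u) := cu _ (h (rho', u) hr').
by apply: filterS hh => v + _.
Qed.

(** * Neighbourhoods read in topological charts *)

Section Charts.
Context {R : realType} {T : topologicalType}.
Implicit Types (c : chart R T) (P : T -> Prop).

Lemma chart_dom_near c y : is_chart c -> dom c y -> \forall y' \near y, dom c y'.
Proof. by move=> [oc _ _ _] dy; apply: open_nbhs_nbhs; split. Qed.

Lemma chart_inj c y y' : is_chart c -> dom c y -> dom c y' -> c y = c y' ->
  y = y'.
Proof. by move=> [_ ic _ _] dy dy'; apply: ic; rewrite inE. Qed.

Lemma chart_near c y (P : plane R -> Prop) : is_chart c -> dom c y ->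
  (\forall z \near c y, P z) -> \forall y' \near y, P (c y').
Proof. by move=> [_ _ cc _] /cc; exact. Qed.

Lemma chart_open c y P : is_chart c -> dom c y -> (\forall y' \near y, P y') ->
  \forall z \near c y, exists y', [/\ dom c y', P y' & c y' = z].
Proof.
move=> [oc _ _ hc] dy Py; have : nbhs y P := Py.
rewrite nbhsE => -[B [oB By] BP].
have : open (c @` (B `&` dom c)) by apply: hc; [exact: openI|move=> ? []].
rewrite openE => /(_ (c y)) /=; rewrite /interior => h.
have {}h := h (ex_intro2 _ _ y (conj By dy) erefl).
by apply: filterS h => z [y' [/BP Py' dy'] <-]; exists y'.
Qed.

Lemma chart_nbhsP c y P : is_chart c -> dom c y ->
  (\forall y' \near y, P y') <-> (exists2 e : R, 0 < e &
     forall y', dom c y' -> `|c y' - c y| < e%:C -> P y').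
Proof.
move=> hc dy; split.
  move=> /(chart_open hc dy) /nbhs_planeP[e e0 h]; exists e => // y' dy' /h.
  by move=> [y'' [dy'' Py'' /(chart_inj hc dy'' dy') <-]].
move=> [e e0 h].
have : \forall y' \near y, `|c y' - c y| < e%:C.
  apply: (chart_near (P := fun z => `|z - c y| < e%:C)) => //.
  by apply/nbhs_planeP; exists e.
by apply: filterS2 (chart_dom_near hc dy) => y' dy'; exact: h.
Qed.

(** The image of a neighbourhood contains a disc, hence also a point at distance e / 2 from the
    centre. The absence of isolated points is what makes coefficients of germs unique. *)
Lemma chart_not_isolated c y : is_chart c -> dom c y ->
  ~ (\forall y' \near y, y' = y).
Proof.
move=> hc dy /(chart_open hc dy) /nbhs_planeP[e e0 h].
have e2 : 0 < e / 2 by rewrite divr_gt0.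
have [] := h (c y + (e / 2)%:C).
  rewrite addrC addKr ger0_norm ?lecR ?ltW// ltcR.
  by rewrite ltr_pdivrMr// ltr_pMr// ltr1n.
move=> y' [_ -> /eqP]; rewrite -subr_eq0 opprD addNKr oppr_eq0.
by rewrite (inj_eq (@complexI R)) gt_eqF.
Qed.

End Charts.

(** * Polar coordinates on a cone *)

Section Cone.
Context {R : realType}.
Implicit Types (theta : R) (p : R * R).

(** This is the recorded coordinate of [cone_chart] as a function of the pair (rho, t). The angle
    [p.2] is a real number, not a class modulo theta, so that multivalued objects on the cone can be
    followed as functions of [p]. *)
Definition cone theta p : plane R := polar p.1 (2 * pi * p.2 / theta).

Lemma cone_near theta p (P : plane R -> Prop) :
  (\forall z \near cone theta p, P z) -> \forall q \near p, P (cone theta q).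
Proof.
move=> h; suff : cone theta q @[q --> p] --> cone theta p by exact.
have h1 : (q.1, 2 * pi * q.2 / theta) @[q --> p] --> (p.1, 2 * pi * p.2 / theta).
  apply: cvg_nbhs_pair; first exact: cvg_fst.
  apply: cvgM; last exact: cvg_cst.
  apply: cvgM; first exact: cvg_cst.
  exact: cvg_snd.
exact: (cvg_comp _ _ h1 (@continuous_polar R _)).
Qed.

Lemma cone_open theta p (P : R * R -> Prop) : 0 < theta -> 0 < p.1 ->
  (\forall q \near p, P q) ->
  \forall z \near cone theta p, exists2 q, P q & z = cone theta q.
Proof.
move=> t0 p0 h.
have pi2 : 2 * pi != 0 :> R by rewrite mulf_neq0 ?pnatr_eq0// gt_eqF// pi_gt0.
have tn : theta != 0 by rewrite gt_eqF.
have : \forall q \near (p.1, 2 * pi * p.2 / theta), P (q.1, q.2 * theta / (2 * pi)).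
  have h1 : (q.1, q.2 * theta / (2 * pi)) @[q --> (p.1, 2 * pi * p.2 / theta)] -->
      (p.1, (2 * pi * p.2 / theta) * theta / (2 * pi)).
    apply: cvg_nbhs_pair; first exact: cvg_fst.
    apply: cvgM; last exact: cvg_cst.
    apply: cvgM; last exact: cvg_cst.
    exact: cvg_snd.
  apply: h1; suff -> : (p.1, 2 * pi * p.2 / theta * theta / (2 * pi)) = p by [].
  by case: (p) => a b /=; congr pair; rewrite divfK// mulrAC mulfV// mul1r.
move=> /(polar_open p0); apply: filterS => z [q Pq ->].
exists (q.1, q.2 * theta / (2 * pi)) => //; rewrite /cone /=; congr polar.
by rewrite [2 * pi * _]mulrC divfK// mulfK.
Qed.

Lemma coneD theta p (j : int) : theta != 0 ->
  cone theta (p.1, p.2 + theta * j%:~R) = cone theta p.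
Proof.
move=> tn; rewrite /cone /= -(polarDpi p.1 (2 * pi * p.2 / theta) j).
by congr polar; field.
Qed.

Lemma cone_inj theta p q : theta != 0 -> 0 < p.1 -> 0 < q.1 ->
  cone theta p = cone theta q ->
  exists j : int, q = (p.1, p.2 + theta * j%:~R).
Proof.
move=> tn p0 q0 /(polar_inj p0 q0)[e [j h]]; exists j.
have pi2 : 2 * pi != 0 :> R by rewrite mulf_neq0 ?pnatr_eq0// gt_eqF// pi_gt0.
rewrite e; case: q h {e q0} => a b /= h; congr pair.
apply: (mulfI pi2); rewrite -[LHS](divfK tn) h.
by field.
Qed.

Lemma cone_surj theta (z : plane R) : theta != 0 ->
  exists p, [/\ 0 <= p.1, z = cone theta p & `|z| = p.1%:C].
Proof.
move=> tn; have [rho [t [r0 ->]]] := polar_surj z.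
exists (rho, t * theta / (2 * pi)); rewrite normr_polar//; split=> //.
have pi2 : 2 * pi != 0 :> R by rewrite mulf_neq0 ?pnatr_eq0// gt_eqF// pi_gt0.
rewrite /cone /=; congr polar.
by rewrite [2 * pi * _]mulrC divfK// mulfK.
Qed.

Lemma cone0 theta t : cone theta (0, t) = 0.
Proof. exact: polar0. Qed.

Lemma normr_cone theta p : 0 <= p.1 -> `|cone theta p| = p.1%:C.
Proof. exact: normr_polar. Qed.

Lemma cone_neq0 theta p : 0 < p.1 -> cone theta p != 0.
Proof. exact: polar_neq0. Qed.

Lemma near_annulus (r : R) p : 0 < p.1 < r -> \forall q \near p, 0 < q.1 < r.
Proof.
move=> hp; have hu : \forall u \near p.1, u \in `]0, r[.
  by apply: near_in_itvoo; rewrite in_itv.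
have hf : (fun q : R * R => q.1) @ p --> p.1 by exact: cvg_fst.
have hfu : \forall q \near p, q.1 \in `]0, r[ := hf _ hu.
by apply: filterS hfu => q; rewrite in_itv.
Qed.

Lemma near_gt0 p : 0 < p.1 -> \forall q \near p, 0 < q.1.
Proof.
move=> p0; have h1 : (fun q : R * R => q.1) @ p --> p.1 by exact: cvg_fst.
exact: (cvgr_gt _ h1 0 p0).
Qed.

End Cone.

(** * Isometric germs *)

Section Germ.
Context {R : realType} {S : flat_surface R}.
Implicit Types (y x : S) (g : S -> plane R) (a b : plane R) (p q : R * R).

(** Only the values of [g] near [y] matter. Allowing every unit affine change of an atlas chart
    gives all oriented isometric charts at [y], whichever of them the atlas happens to contain. *)
Definition germ y g := exists c a b,
  [/\ atlas c, dom c y, `|a| = 1 & \forall y' \near y, g y' = a * c y' + b].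

Lemma norm1_neq0 a : `|a| = 1 -> a != 0.
Proof. by move=> h; rewrite -normr_eq0 h oner_eq0. Qed.

Lemma germ_regular y g : germ y g -> regular y.
Proof.
move=> [c [a [b [ac dy _ _]]]].
by rewrite /regular -(@atlas_cover _ S); exists c.
Qed.

Lemma regular_atlas y : regular y -> exists c, atlas c /\ dom c y.
Proof. by rewrite /regular -(@atlas_cover _ S) => -[c ac dy]; exists c. Qed.

Lemma atlas_germ c y : atlas c -> dom c y -> germ y c.
Proof.
move=> ac dy; exists c, 1, 0; split=> //; first exact: normr1.
by apply: filterE => y'; rewrite mul1r addr0.
Qed.

Lemma regular_germ y : regular y -> exists g, germ y g.
Proof.
by move=> /regular_atlas[c [ac dy]]; exists c; exact: atlas_germ.
Qed.

Lemma germ_near y g : germ y g -> \forall y' \near y, germ y' g.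
Proof.
move=> [c [a [b [ac dy a1 h]]]].
have := chart_dom_near (atlas_chart ac) dy.
by apply: filterS2 (near_join h) => y' h' dy'; exists c, a, b.
Qed.

Lemma germ_affine y g g' a b : germ y g -> `|a| = 1 ->
  (\forall y' \near y, g' y' = a * g y' + b) -> germ y g'.
Proof.
move=> [c [a0 [b0 [ac dy a1 h]]]] a1' h'; exists c, (a * a0), (a * b0 + b).
split=> //; first by rewrite normrM a1 a1' mulr1.
by apply: filterS2 h h' => y' -> ->; rewrite mulrDr addrA mulrA.
Qed.

Lemma germ_scale y g a : germ y g -> `|a| = 1 -> germ y (fun z => a * g z).
Proof.
move=> h a1; apply: (germ_affine (b := 0) h a1).
by apply: filterE => y'; rewrite addr0.
Qed.

Lemma germ_transition y g g' : germ y g -> germ y g' ->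
  exists a b, `|a| = 1 /\ \forall y' \near y, g' y' = a * g y' + b.
Proof.
move=> [c [a0 [b0 [ac dy a1 h]]]] [c' [a0' [b0' [ac' dy' a1' h']]]].
have [a [b [a2 ht]]] := atlas_compatible ac ac' dy dy'.
have an := norm1_neq0 a1.
exists (a0' * a / a0), (b0' + a0' * b - a0' * a / a0 * b0); split.
  by rewrite !normrM normfV a1 a1' a2 invr1 !mulr1.
near=> y'.
have -> : g' y' = a0' * c' y' + b0' by near: y'.
have -> : g y' = a0 * c y' + b0 by near: y'.
have -> : c' y' = a * c y' + b by near: y'.
by field.
Unshelve. all: by end_near. Qed.

Lemma germ_inj_near y g : germ y g ->
  \forall y' \near y, g y' = g y -> y' = y.
Proof.
move=> [c [a [b [ac dy a1 h]]]]; have hc := atlas_chart ac.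
have hy := nbhs_singleton h; rewrite hy.
apply: filterS2 h (chart_dom_near hc dy) => y' -> dy' /addIr.
by move=> /(mulfI (norm1_neq0 a1)) /(chart_inj hc dy' dy).
Qed.

Lemma germ_not_isolated y g : germ y g -> ~ (\forall y' \near y, y' = y).
Proof.
move=> [c [a [b [ac dy a1 h]]]].
exact: chart_not_isolated (atlas_chart ac) dy.
Qed.

(** Some point near [y] differs from [y], and [g] separates it from [y]. Subtracting the identity at
    the two points determines the linear coefficient, and then the constant. *)
Lemma germ_transition_uniq y g a b a' b' : germ y g ->
  (\forall y' \near y, a * g y' + b = a' * g y' + b') -> a = a' /\ b = b'.
Proof.
move=> hg h.
have aa : a = a'.
  apply: contrapT => /eqP naa; apply: (germ_not_isolated hg).
  have hy := nbhs_singleton h.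
  apply: filterS2 h (germ_inj_near hg) => y' h'; apply.
  have na : a - a' != 0 by rewrite subr_eq0.
  apply: (mulfI na); rewrite !mulrBl.
  move: h' hy => /eqP; rewrite -subr_eq -addrA => /eqP h1 /eqP.
  rewrite -subr_eq -addrA => /eqP h2.
  have e1 : a' * g y' - a * g y' = b - b'.
    by rewrite -h1; ring.
  have e2 : a' * g y - a * g y = b - b'.
    by rewrite -h2; ring.
  by rewrite -[LHS]opprB e1 -e2 opprB.
split=> //; have := nbhs_singleton h.
by rewrite aa => /addrI.
Qed.

Section ConeChart.
Variables (x : S) (r : R) (c : chart R S).
Hypothesis hc : cone_chart (@atlas R S) (@regular R S) x (angle x) r c.
Local Notation theta := (angle x).

Let tn : theta != 0. Proof. by rewrite gt_eqF// angle_gt0. Qed.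

Lemma cone_is_chart : is_chart c. Proof. by case: hc. Qed.

Lemma cone_center : dom c x. Proof. by case: hc => _ []. Qed.

Lemma cone_center0 : c x = 0. Proof. by case: hc => _ []. Qed.

Lemma cone_radius_gt0 : 0 < r. Proof. by case: hc => _ _ []. Qed.

Lemma cone_point p : 0 <= p.1 < r -> exists y, dom c y /\ c y = cone theta p.
Proof.
move=> /andP[p0 pr]; have [_ _ [_ hr] _ _] := hc.
have : (c @` dom c) (cone theta p) by rewrite hr /= normr_cone// ltcR.
by move=> [y dy <-]; exists y.
Qed.

Lemma cone_coord y : dom c y -> exists p, 0 <= p.1 < r /\ c y = cone theta p.
Proof.
move=> dy; have [_ _ [_ hr] _ _] := hc.
have : (c @` dom c) (c y) by exists y.
have [p [p0 hp hn]] := cone_surj (c y) tn.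
by rewrite hr /= hn ltcR => pr; exists p; rewrite p0.
Qed.

Lemma cone_neq_center y p : 0 < p.1 -> c y = cone theta p -> y != x.
Proof.
move=> p0 hy; apply/eqP => yx; move: hy; rewrite yx cone_center0 => /esym/eqP.
by rewrite (negbTE (cone_neq0 _ p0)).
Qed.

Lemma cone_coord_neq y : dom c y -> y != x ->
  exists p, 0 < p.1 < r /\ c y = cone theta p.
Proof.
move=> dy yx; have [p [/andP[p0 pr] h]] := cone_coord dy; exists p; split=> //.
rewrite pr andbT lt_neqAle p0 andbT; apply/eqP => p00.
move/eqP: yx; apply; apply: (chart_inj cone_is_chart dy cone_center).
by rewrite cone_center0 h; case: (p) p00 => a b /= <-; rewrite cone0.
Qed.

Lemma cone_coord_lt y p : dom c y -> 0 <= p.1 -> c y = cone theta p -> p.1 < r.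
Proof.
move=> dy p0 hp; have [_ _ [_ hr] _ _] := hc.
have : (c @` dom c) (c y) by exists y.
by rewrite hr /= hp normr_cone// ltcR.
Qed.

Lemma cone_regular y : dom c y -> y != x -> regular y.
Proof. by move=> dy /eqP yx; case: hc => _ _ _ h _; exact: h. Qed.

(** Together with [cone_point_near], this is the dictionary between neighbourhoods of a point of the
    cone and neighbourhoods of a lift [p] in the strip. *)
Lemma cone_near_point y p (P : R * R -> Prop) : dom c y -> 0 < p.1 ->
  c y = cone theta p -> (\forall q \near p, P q) ->
  \forall y' \near y, dom c y' /\ exists2 q, P q & c y' = cone theta q.
Proof.
move=> dy p0 cy hP.
apply: filterS2 (chart_dom_near cone_is_chart dy) _ => [y' dy' h|]; first exact: (conj dy' h).
apply: (chart_near (P := fun z => exists2 q, P q & z = cone theta q) cone_is_chart dy).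
by rewrite cy; apply: cone_open; rewrite ?angle_gt0.
Qed.

Lemma cone_point_near y p (P : S -> Prop) : dom c y -> c y = cone theta p ->
  (\forall y' \near y, P y') ->
  \forall q \near p, forall y', dom c y' -> c y' = cone theta q -> P y'.
Proof.
move=> dy cy /(chart_open cone_is_chart dy); rewrite cy => /cone_near.
apply: filterS => q [y' [dy' Py' cy']] y2 dy2 cy2.
by have -> : y2 = y' by apply: (chart_inj cone_is_chart) => //; rewrite cy2.
Qed.

Lemma cone_near_center (P : S -> Prop) : (\forall y \near x, P y) <->
  exists2 e : R, 0 < e <= r &
    forall y p, 0 <= p.1 < e -> dom c y -> c y = cone theta p -> P y.
Proof.
have := chart_nbhsP P cone_is_chart cone_center; rewrite cone_center0 => ->.
split=> -[e e0 h].
  exists (Num.min e r); first by rewrite lt_min e0 cone_radius_gt0/= ge_min lexx orbT.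
  move=> y p /andP[p0]; rewrite lt_min => /andP[pe pr] dy cy; apply: h => //.
  by rewrite subr0 cy normr_cone// ltcR.
exists e; first by case/andP: e0.
move=> y dy; rewrite subr0 => hy.
have [p [p0 cy hn]] := cone_surj (c y) tn.
by apply: (h y p) => //; rewrite p0 -ltcR -hn.
Qed.

(** The germ [g] is the branch at [p] of the developing map (rho, t) |-> polar rho t. The branch
    depends on the lift [p], not only on the point of the surface below it. *)
Definition dev p g := \forall q \near p, forall y', dom c y' ->
  c y' = cone theta q -> g y' = polar q.1 q.2.

Lemma dev_near p g : dev p g -> \forall q \near p, dev q g.
Proof. exact: near_join. Qed.

Lemma dev_val p g y : dev p g -> dom c y -> c y = cone theta p ->
  g y = polar p.1 p.2.
Proof. by move=> /nbhs_singleton; exact. Qed.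

(** The isometry clause of [cone_chart] writes an atlas chart as [a] times the developing map plus
    [b]; undoing this affine map gives the branch. *)
Lemma dev_exists y p : dom c y -> 0 < p.1 -> c y = cone theta p ->
  exists g, germ y g /\ dev p g.
Proof.
move=> dy p0 cy; have yx := cone_neq_center p0 cy.
have [phi [aphi dphi]] := regular_atlas (cone_regular dy yx).
have [_ _ _ _ /(_ y phi p.1 p.2 dy aphi dphi p0 cy)] := hc.
move=> [a [b [a1 h]]]; have an := norm1_neq0 a1.
exists (fun z => a^-1 * (phi z - b)); split.
  apply: (germ_affine (a := a^-1) (b := - (a^-1 * b)) (atlas_germ aphi dphi)).
    by rewrite normfV a1 invr1.
  by apply: filterE => y'; rewrite mulrBr.
move: h; rewrite -surjective_pairing; apply: filterS => q h y' dy' cy'.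
by rewrite h// addrK mulKf.
Qed.

Lemma dev_eq y p g g' : dom c y -> 0 < p.1 -> c y = cone theta p ->
  dev p g -> dev p g' -> \forall y' \near y, g y' = g' y'.
Proof.
move=> dy p0 cy h h'.
have hI := @filterI _ (nbhs p) (nbhs_filter p) _ _ h h'.
have hn := cone_near_point dy p0 cy hI.
by apply: filterS hn => y' [dy' [q [h1 h2] cq]]; rewrite h1// h2.
Qed.

Lemma dev_germ y p g : dom c y -> 0 < p.1 -> c y = cone theta p ->
  dev p g -> germ y g.
Proof.
move=> dy p0 cy h; have [g' [hg' h']] := dev_exists dy p0 cy.
apply: (germ_affine (a := 1) (b := 0) hg'); first exact: normr1.
by have := dev_eq dy p0 cy h h'; apply: filterS => y' ->; rewrite mul1r addr0.
Qed.

(** The shifted lift lies over the same point after [j] turns round the apex. The branch picks up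
    the rotation by [j] cone angles, which is the holonomy of the cone point. *)
Lemma dev_rotate p g (j : int) : dev p g ->
  dev (p.1, p.2 + theta * j%:~R) (fun z => polar 1 (theta * j%:~R) * g z).
Proof.
move=> h; set s := theta * j%:~R.
have hcv : (q.1, q.2 - s) @[q --> (p.1, p.2 + s)] --> (p.1, p.2 + s - s).
  apply: cvg_nbhs_pair; first exact: cvg_fst.
  by apply: cvgB; [exact: cvg_snd|exact: cvg_cst].
rewrite addrK -surjective_pairing in hcv.
have : \forall q \near (p.1, p.2 + s), forall y', dom c y' ->
    c y' = cone theta (q.1, q.2 - s) -> g y' = polar q.1 (q.2 - s) by exact: hcv h.
apply: filterS => q h' y' dy' cy'; rewrite (h' y' dy').
  by rewrite polarM mul1r addrC subrK.
by rewrite cy' -(coneD (q.1, q.2 - s) j tn) /= subrK -surjective_pairing.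
Qed.

Lemma dev_rotate_eq y p q g g' : dom c y -> 0 < p.1 -> 0 < q.1 ->
  c y = cone theta p -> c y = cone theta q -> dev p g -> dev q g' ->
  exists j : int, q = (p.1, p.2 + theta * j%:~R) /\
    \forall y' \near y, g' y' = polar 1 (theta * j%:~R) * g y'.
Proof.
move=> dy p0 q0 cp cq h h'.
have [j hj] : exists j : int, q = (p.1, p.2 + theta * j%:~R).
  by apply: cone_inj tn p0 q0 _; rewrite -cp -cq.
exists j; split=> //; apply: (dev_eq dy q0 cq h').
by rewrite hj; exact: dev_rotate.
Qed.

End ConeChart.
End Germ.

(** * Distinguished families of charts *)

Section Reduction.
Context {R : realType} {S : flat_surface R}.
Implicit Types (y x : S) (g : S -> plane R) (a b : plane R) (p q : R * R).
Implicit Types (Phi : S -> (S -> plane R) -> Prop).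

Lemma not_isolated x : ~ (\forall y \near x, y = x).
Proof.
have [r [c hc]] := conical x.
exact: chart_not_isolated (cone_is_chart hc) (cone_center hc).
Qed.

Lemma near_punctured_absurd (A : S -> Prop) x :
  (\forall y \near x, y != x -> A y) -> (\forall y \near x, y != x -> ~ A y) ->
  False.
Proof.
move=> h1 h2; apply: (@not_isolated x).
apply: filterS2 h1 h2 => y h1 h2; apply: contrapT => /eqP ny.
by apply: (h2 ny); exact: h1.
Qed.

Lemma near_regular x : \forall y \near x, y != x -> regular y.
Proof.
have [r [c hc]] := conical x.
apply: filterS (chart_dom_near (cone_is_chart hc) (cone_center hc)) => y.
exact: cone_regular hc y.
Qed.

(** A punctured cone disc is the image of a strip, to which locally constant predicates lift. The
    neighbourhood [N] is chosen before [A], so one [N] serves all the predicates indexed by a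
    rotation in [reduction_extend]. *)
Lemma punctured_const x (P : S -> Prop) : (\forall y \near x, P y) ->
  exists N : set S, [/\ nbhs x N, N `<=` P & forall A : S -> Prop,
    (forall y, P y -> y != x -> \forall y' \near y, A y' <-> A y) ->
    forall y1 y2, N y1 -> N y2 -> y1 != x -> y2 != x -> A y1 -> A y2].
Proof.
move=> hP; have [r [c hc]] := conical x.
have [e /andP[e0 er] he] := (cone_near_center hc P).1 hP.
exists [set y | dom c y /\ exists2 p, 0 <= p.1 < e & c y = cone (angle x) p].
split.
- apply/(cone_near_center hc); exists e; first by rewrite e0.
  by move=> y p pe dy cy; split=> //; exists p.
- by move=> y [dy [p pe cy]]; exact: he cy.
move=> A hA y1 y2 [dy1 [p1 pe1 cy1]] [dy2 [p2 pe2 cy2]] yx1 yx2 A1.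
have pos y p : dom c y -> 0 <= p.1 -> c y = cone (angle x) p -> y != x -> 0 < p.1.
  move=> dy; rewrite le_eqVlt => /orP[/eqP p0|//] cy /eqP; case.
  apply: (chart_inj (cone_is_chart hc) dy (cone_center hc)).
  by rewrite (cone_center0 hc) cy; case: (p) p0 => ? ? /= <-; rewrite cone0.
have p10 := pos _ _ dy1 (proj1 (andP pe1)) cy1 yx1.
have p20 := pos _ _ dy2 (proj1 (andP pe2)) cy2 yx2.
pose B p := forall y, dom c y -> c y = cone (angle x) p -> A y.
have BA p y : dom c y -> c y = cone (angle x) p -> B p <-> A y.
  move=> dy cy; split=> [|Ay y' dy' cy']; first exact.
  suff -> : y' = y by [].
  by apply: (chart_inj (cone_is_chart hc) dy' dy); rewrite cy'.
apply/(BA p2 y2) => //; apply: (@locconst_rectangle R e B p1 p2).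
- move=> p /andP[p0 pe].
  have pr : 0 <= p.1 < r by rewrite ltW//= (lt_le_trans pe).
  have [y [dy cy]] := cone_point hc pr.
  have Py : P y by apply: he dy cy; rewrite ltW.
  have := cone_point_near hc dy cy (hA y Py (cone_neq_center hc p0 cy)).
  have hq : \forall q \near p, 0 < q.1 < e by apply: near_annulus; rewrite p0.
  apply: filterS2 hq => q /andP[q0 qe] hAq.
  have qr : 0 <= q.1 < r by rewrite ltW//= (lt_le_trans qe).
  have [y' [dy' cy']] := cone_point hc qr.
  by rewrite (BA q y' dy' cy') (BA p y dy cy); exact: hAq.
- by rewrite p10; case/andP: pe1.
- by rewrite p20; case/andP: pe2.
- exact/(BA p1 y1).
Qed.

Lemma punctured_dichotomy x (A : S -> Prop) :
  (\forall y \near x, y != x -> \forall y' \near y, A y' <-> A y) ->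
  (\forall y \near x, y != x -> A y) \/ (\forall y \near x, y != x -> ~ A y).
Proof.
move=> /punctured_const[N [nN NP /(_ A) hN]].
have [h|h] := pselect (forall y, N y -> y != x -> A y).
  by left; apply: filterS nN.
right; apply: filterS nN => y Ny yx Ay; apply: h => y' Ny' y'x.
by apply: hN Ay => // y2 h2 /h2.
Qed.

(** The regular part is connected because removing isolated points does not disconnect a surface. *)
Lemma regular_connected (A : S -> Prop) y y' :
  (forall y, regular y -> \forall y' \near y, A y' <-> A y) ->
  regular y -> regular y' -> A y -> A y'.
Proof.
move=> hA ry ry' Ay.
have hA' x : \forall y \near x, y != x -> \forall y' \near y, A y' <-> A y.
  by apply: filterS (@near_regular x) => z h /h; exact: hA.
(* [B] extends [A] over the singular points by its value on a small punctured disc, which is well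
   defined by [punctured_dichotomy]. *)
pose B x := \forall y \near x, y != x -> A y.
have AB z : regular z -> A z <-> B z.
  move=> rz; split=> h.
    by apply: filterS (hA z rz) => z' h' _; exact/h'.
  apply: contrapT => nA; apply: (near_punctured_absurd h).
  by apply: filterS (hA z rz) => z' h' _ /h'.
apply/AB => //.
refine (@locconst_connected S setT B y y' (@flat_connected R S) _ I I ((AB y ry).1 Ay)).
move=> x _.
have [h|h] := punctured_dichotomy (hA' x).
  near=> z => _; split=> _; first exact: h.
  have [->//|zx] := eqVneq z x.
  have rz : regular z by move: zx; near: z; exact: near_regular.
  by apply/(AB z rz); move: zx; near: z.
near=> z => _; have nB : ~ B x by move=> /near_punctured_absurd; exact.
have [->//|zx] := eqVneq z x; split=> // Bz; exfalso.
have rz : regular z by move: zx; near: z; exact: near_regular.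
by move: Bz; apply/(AB z rz); move: zx; near: z.
Unshelve. all: by end_near. Qed.

Lemma germ_scale_norm y g a : germ y g -> germ y (fun z => a * g z) -> `|a| = 1.
Proof.
move=> h h'; have [a' [b [a1 e]]] := germ_transition h h'.
have e0 : \forall y' \near y, a * g y' + 0 = a' * g y' + b.
  by apply: filterS e => y'; rewrite addr0.
by have [-> _] := germ_transition_uniq h e0.
Qed.

(* [Phi y] is a family of distinguished isometric charts at [y], not required to
   be members of the atlas. *)
Record reduction_at Phi y : Prop := ReductionAt {
  red_regular : regular y;
  red_germ : forall g, Phi y g -> germ y g;
  red_translate : forall g g' b, Phi y g ->
    (\forall y' \near y, g' y' = g y' + b) -> Phi y g';
  red_local : forall g, germ y g -> \forall y' \near y, Phi y' g <-> Phi y g;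
  red_ex : exists g, Phi y g;
  red_finite : forall g, Phi y g -> finite_set [set a | Phi y (fun z => a * g z)] }.

Lemma red_rotate Phi y g : reduction_at Phi y -> germ y g ->
  exists a, `|a| = 1 /\ Phi y (fun z => a * g z).
Proof.
move=> h hg; have [g' hg'] := red_ex h.
have [a [b [a1 e]]] := germ_transition hg (red_germ h hg').
exists a; split=> //; apply: (red_translate (b := - b) h hg').
by apply: filterS e => y' ->; rewrite addrK.
Qed.

(** A puncture at a regular point is removable: a chart there is single valued on a full
    neighbourhood, so being distinguished is constant on the punctured disc. Families therefore need
    to be built only away from a discrete set, such as the branch points. *)
Lemma reduction_extend Phi :
  (forall x, \forall y \near x, y != x -> reduction_at Phi y) ->
  exists Psi, forall y, regular y -> reduction_at Psi y.
Proof.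
move=> hPhi.
pose Psi y g := germ y g /\ \forall y' \near y, y' != y -> Phi y' g.
have loc y g : germ y g ->
    \forall y' \near y, y' != y -> \forall y'' \near y', Phi y'' g <-> Phi y' g.
  move=> hg; apply: filterS2 (hPhi y) (germ_near hg) => y' h hg' y'y.
  exact (red_local (h y'y) hg').
exists Psi => y ry; split=> //.
- by move=> g [].
- move=> g g' b [hg hn] e; split.
    apply: (germ_affine hg (normr1 _)) => //.
    by apply: filterS e => y' ->; rewrite mul1r.
  near=> y' => y'y; apply: (@red_translate _ y' _ g g' b).
  + by move: y'y; near: y'; exact: hPhi.
  + by move: y'y; near: y'.
  + by near: y'; exact: near_join.
- move=> g hg; have [h|h] := punctured_dichotomy (loc y g hg).
    near=> y'; split=> [_|_]; first by split.
    have [->|y'y] := eqVneq y' y; first by split.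
    split; first by near: y'; exact: germ_near.
    have Py' : Phi y' g by move: y'y; near: y'.
    have : \forall y'' \near y', Phi y'' g <-> Phi y' g.
      by move: y'y; near: y'; exact: loc.
    by apply: filterS => y'' -> _.
  have nPsi : ~ Psi y g by move=> [_ /near_punctured_absurd]; exact.
  near=> y'; split=> // -[_ hy'].
  have [y'y|y'y] := eqVneq y' y.
    by move: hy'; rewrite y'y => /near_punctured_absurd /(_ h).
  exfalso; apply: (near_punctured_absurd hy').
  have nPy' : ~ Phi y' g by move: y'y; near: y'.
  have : \forall y'' \near y', Phi y'' g <-> Phi y' g.
    by move: y'y; near: y'; exact: loc.
  by apply: filterS => y'' -> _.
- have [g0 hg0] := regular_germ ry.
  have hP : \forall y' \near y, (y' != y -> reduction_at Phi y') /\ germ y' g0.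
    exact: filterI (hPhi y) (germ_near hg0).
  have [N [nN NP hN]] := punctured_const hP.
  have [y1 [Ny1 yy1]] : exists y1, N y1 /\ y1 != y.
    apply: contrapT => nex; apply: (@not_isolated y); apply: filterS nN => y' Ny'.
    by apply: contrapT => /eqP h; apply: nex; exists y'.
  have [r1 hg1] := NP _ Ny1.
  have [a [a1 ha]] := red_rotate (r1 yy1) hg1.
  exists (fun z => a * g0 z); split; first exact: germ_scale.
  apply: filterS nN => y' Ny' y'y.
  apply: (hN (fun y => Phi y (fun z => a * g0 z)) _ y1) => //.
  move=> y2 [r2 hg2] y2y; apply: (red_local (r2 y2y)).
  exact: germ_scale.
- move=> g [hg hn].
  have hP : \forall y' \near y,
      (y' != y -> reduction_at Phi y' /\ Phi y' g) /\ germ y' g.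
    apply: filterI (germ_near hg).
    by apply: filterS2 (hPhi y) hn => y' h1 h2 y'y; split; [exact: h1|exact: h2].
  have [N [nN NP hN]] := punctured_const hP.
  have [y1 [Ny1 yy1]] : exists y1, N y1 /\ y1 != y.
    apply: contrapT => nex; apply: (@not_isolated y); apply: filterS nN => y' Ny'.
    by apply: contrapT => /eqP h; apply: nex; exists y'.
  have [/(_ yy1)[r1 h1] hg1] := NP _ Ny1.
  apply: sub_finite_set (red_finite r1 h1) => a [hga hna] /=.
  have a1 := germ_scale_norm hg hga.
  (* The point [y2] depends on [a], but [y1] does not: continuation inside [N] brings every such [a]
     into the single finite set attached to [y1]. *)
  have [y2 [[Ny2 P2] yy2]] : exists y2,
      (N y2 /\ (y2 != y -> Phi y2 (fun z => a * g z))) /\ y2 != y.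
    apply: contrapT => nex; apply: (@not_isolated y).
    apply: filterS2 nN hna => y' Ny' hy'.
    by apply: contrapT => /eqP h; apply: nex; exists y'.
  apply: (hN (fun y => Phi y (fun z => a * g z)) _ y2) => //.
    move=> y3 [r3 hg3] y3y; have [{}r3 _] := r3 y3y; apply: (red_local r3).
    exact: germ_scale.
  exact: P2.
Unshelve. all: by end_near. Qed.

Lemma cone2pi p : cone (2 * pi : R) p = polar p.1 p.2.
Proof.
by rewrite /cone mulrAC mulfV ?mul1r// mulf_neq0 ?pnatr_eq0// gt_eqF// pi_gt0.
Qed.

(** Off [x], [cone_chart] relates [c] to an atlas chart by a unit affine map whose coefficients may
    depend on the point. They are locally constant, hence constant on a punctured disc, and
    continuity extends the relation to [x]. *)
Lemma cone_germ x r c : regular x ->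
  cone_chart (@atlas R S) (@regular R S) x (angle x) r c -> germ x c.
Proof.
move=> rx hc; have [phi [aphi dphi]] := regular_atlas rx.
have hphi := atlas_chart aphi.
have hdom : \forall y \near x, dom phi y /\ dom c y.
  apply: filterI; first exact: chart_dom_near.
  by apply: chart_dom_near; [exact: cone_is_chart hc|exact: cone_center hc].
have [N [nN NP hN]] := punctured_const hdom.
have aff y : dom phi y /\ dom c y -> y != x -> exists a b, [/\ `|a| = 1,
    germ y c & \forall y' \near y, phi y' = a * c y' + b].
  move=> [dpy dcy] yx; have [p [/andP[p0 pr] cy]] := cone_coord_neq hc dcy yx.
  have [_ _ _ _ /(_ y phi p.1 p.2 dcy aphi dpy p0 cy)] := hc.
  rewrite -surjective_pairing => -[a [b [a1 h]]]; exists a, b.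
  have := cone_near_point hc dcy p0 cy h.
  have e : angle x = 2 * pi by [].
  move=> {}h; have {}h : \forall y' \near y, phi y' = a * c y' + b.
    apply: filterS h => y' [dy' [q hq cq]].
    by rewrite (hq y' dy' cq) cq e cone2pi.
  split=> //; apply: (germ_affine (a := a^-1) (b := - (a^-1 * b)) (atlas_germ aphi dpy)).
    by rewrite normfV a1 invr1.
  apply: filterS h => y' ->.
  by rewrite mulrDr mulKf ?norm1_neq0// addrK.
have [y0 [Ny0 y0x]] : exists y0, N y0 /\ y0 != x.
  apply: contrapT => nex; apply: (@not_isolated x); apply: filterS nN => y' Ny'.
  by apply: contrapT => /eqP h; apply: nex; exists y'.
have [a [b [a1 _ h0]]] := aff y0 (NP _ Ny0) y0x.
have an := norm1_neq0 a1.
have hall : \forall y \near x, y != x -> phi y = a * c y + b.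
  apply: filterS nN => y Ny yx.
  suff h : \forall y' \near y, phi y' = a * c y' + b by exact: (nbhs_singleton h).
  refine (hN (fun y => \forall y' \near y, phi y' = a * c y' + b) _ y0 y Ny0 Ny
    y0x yx h0).
  move=> y1 Py1 y1x; have [a' [b' [a1' hg h1]]] := aff y1 Py1 y1x.
  suff hs : \forall y2 \near y1, (\forall y' \near y2, phi y' = a * c y' + b) <->
      a' = a /\ b' = b.
    apply: filterS hs => y2 ->; split=> [[<- <-]//|h2].
    have e : \forall y' \near y1, a' * c y' + b' = a * c y' + b.
      by apply: filterS2 h1 h2 => y' ->.
    exact: (germ_transition_uniq hg e).
  apply: filterS2 (near_join h1) (germ_near hg) => y2 h2 hg2; split.
    move=> h3; have e : \forall y' \near y2, a' * c y' + b' = a * c y' + b.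
      by apply: filterS2 h2 h3 => y' ->.
    exact: (germ_transition_uniq hg2 e).
  by move=> [<- <-].
have cx0 := cone_center0 hc.
(* If [phi x] and [b] were at distance d > 0, a point [y] other than [x] with both coordinate
   differences below d / 2 would give d < d. *)
have phix : phi x = b.
  apply: contrapT => /eqP; rewrite -subr_eq0 -normr_gt0 => d0.
  set d := `|phi x - b| in d0.
  have d2 : 0 < d / 2 by rewrite divr_gt0.
  apply: (@not_isolated x).
  have n1 : \forall y \near x, `|phi x - phi y| < d / 2.
    apply: (chart_near (P := fun z => `|phi x - z| < d / 2) hphi dphi).
    by apply/nbhs_ballP; exists (d / 2) => // z; rewrite -ball_normE.
  have n2 : \forall y \near x, `|c x - c y| < d / 2.
    apply: (chart_near (P := fun z => `|c x - z| < d / 2) (cone_is_chart hc)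
      (cone_center hc)).
    by apply/nbhs_ballP; exists (d / 2) => // z; rewrite -ball_normE.
  near=> y; apply: contrapT => /eqP yx.
  have h1 : `|phi x - phi y| < d / 2 by near: y.
  have h2 : `|c x - c y| < d / 2 by near: y.
  have h3 : phi y = a * c y + b by move: yx; near: y.
  suff : d < d by rewrite ltxx.
  have de : d = `|(phi x - phi y) - a * (c x - c y)|.
    by rewrite h3 cx0 /d; congr `|_|; ring.
  rewrite [ltLHS]de; apply: (le_lt_trans (ler_normB _ _)).
  by rewrite normrM a1 mul1r [ltRHS]splitr ltrD.
apply: (germ_affine (a := a^-1) (b := - (a^-1 * b)) (atlas_germ aphi dphi)).
  by rewrite normfV a1 invr1.
apply: filterS hall => y hy.
have -> : phi y = a * c y + b.
  by have [->|/hy//] := eqVneq y x; rewrite phix cx0 mulr0 add0r.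
by rewrite mulrDr mulKf// addrK.
Unshelve. all: by end_near. Qed.

End Reduction.

(** * Holonomy *)

Section Holonomy.
Context {R : realType} {S : flat_surface R}.
Implicit Types (y x : S) (g : S -> plane R) (a b : plane R) (gamma : R -> S).

Lemma within_continuousP (D : set R) gamma :
  {within D, continuous gamma} <->
  forall t, D t -> forall P : S -> Prop, (\forall y \near gamma t, P y) ->
    \forall u \near t, D u -> P (gamma u).
Proof.
rewrite continuous_subspace_in; split=> h t.
  move=> Dt P hP; have := h t; rewrite inE => /(_ Dt) /(_ P hP).
  move=> hn; change (within D (nbhs t) (gamma @^-1` P)).
  by rewrite nbhs_subspace_in.
rewrite inE => Dt P hP; suff : within D (nbhs t) (gamma @^-1` P) by rewrite nbhs_subspace_in.
exact: h.
Qed.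

(** Parallel transport of charts instead of vectors. Translations are left free along the path,
    since only the linear part of a chart is transported. *)
Definition parallel_germs gamma (G : R -> S -> plane R) :=
  forall t, t \in `[0, 1] -> germ (gamma t) (G t) /\
    \forall u \near t, u \in `[0, 1] ->
      exists b, \forall y' \near gamma u, G u y' = G t y' + b.

Definition transports y g y' g' := exists gamma G,
  [/\ {within `[0, 1], continuous gamma}, gamma 0 = y, gamma 1 = y',
      parallel_germs gamma G & G 0 = g /\ G 1 = g'].

Lemma transports_germ y g y' g' : transports y g y' g' -> germ y g /\ germ y' g'.
Proof.
move=> [gamma [G [_ <- <- hG [<- <-]]]].
by split; [have [] := hG 0|have [] := hG 1]; rewrite ?in_itv /= ?lexx ?ler01.
Qed.

(** The path is constant and the germ jumps from [g] to [g'] just after time 0; [parallel_germs]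
    permits the jump because it is a translation. *)
Lemma transports_translate y g g' b : germ y g ->
  (\forall y' \near y, g' y' = g y' + b) -> transports y g y g'.
Proof.
move=> hg h; exists (fun=> y), (fun t => if t == 0 then g else g'); split=> //.
- by apply: continuous_subspaceT => t; exact: cvg_cst.
- have hg' : germ y g' by apply: (germ_affine hg (normr1 _)); apply: filterS h => z ->; rewrite mul1r.
  move=> t _; split; first by case: ifP.
  apply: filterE => u _; case: ifP => _; case: ifP => _.
  + by exists 0; apply: filterE => z; rewrite addr0.
  + by exists (- b); apply: filterS h => z ->; rewrite addrK.
  + by exists b.
  + by exists 0; apply: filterE => z; rewrite addr0.
- by rewrite eqxx oner_eq0.
Qed.

Lemma transports_sym y g y' g' : transports y g y' g' -> transports y' g' y g.
Proof.
move=> [gamma [G [/within_continuousP cg g0 g1 hG [G0 G1]]]].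
have rev t : t \in `[0, 1] -> (1 - t) \in `[0, 1 : R].
  by rewrite !in_itv /= => /andP[h1 h2]; rewrite subr_ge0 h2/= lerBlDr lerDl.
have nearB (t : R) (P : R -> Prop) : (\forall u \near (1 - t), P u) ->
    \forall u \near t, P (1 - u).
  suff hc : (1 - u) @[u --> t] --> 1 - t by exact: hc.
  by apply: cvgB; [exact: cvg_cst|exact: cvg_id].
exists (fun t => gamma (1 - t)), (fun t => G (1 - t)).
rewrite subr0 subrr; split=> //.
- apply/within_continuousP => t ht P /cg => /(_ (rev t ht)) /nearB.
  by apply: filterS => u hu /rev; exact: hu.
- move=> t /rev /hG[h1 /nearB h2]; split=> //.
  by apply: filterS h2 => u hu /rev; exact: hu.
Qed.

Lemma transports_scale y g y' g' a : `|a| = 1 -> transports y g y' g' ->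
  transports y (fun z => a * g z) y' (fun z => a * g' z).
Proof.
move=> a1 [gamma [G [cg g0 g1 hG [<- <-]]]].
exists gamma, (fun t z => a * G t z); split=> //.
move=> t /hG[h1 h2]; split; first exact: germ_scale.
apply: filterS h2 => u h /h[b hb]; exists (a * b).
by apply: filterS hb => z ->; rewrite mulrDr.
Qed.

Lemma transports_trans y g y' g' y'' g'' : transports y g y' g' ->
  transports y' g' y'' g'' -> transports y g y'' g''.
Proof.
move=> [gamma1 [G1 [/within_continuousP c1 e10 e11 h1 [G10 G11]]]].
move=> [gamma2 [G2 [/within_continuousP c2 e20 e21 h2 [G20 G21]]]].
pose gamma t := if t <= 2^-1 then gamma1 (t * 2) else gamma2 (t * 2 - 1).
pose G t := if t <= 2^-1 then G1 (t * 2) else G2 (t * 2 - 1).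
have nearM (t : R) (P : R -> Prop) : (\forall u \near (t * 2), P u) ->
    \forall u \near t, P (u * 2).
  suff hc : (u * 2) @[u --> t] --> t * 2 by exact: hc.
  by apply: cvgM; [exact: cvg_id|exact: cvg_cst].
have nearMB (t : R) (P : R -> Prop) : (\forall u \near (t * 2 - 1), P u) ->
    \forall u \near t, P (u * 2 - 1).
  suff hc : (u * 2 - 1) @[u --> t] --> t * 2 - 1 by exact: hc.
  by apply: cvgB; [apply: cvgM; [exact: cvg_id|exact: cvg_cst]|exact: cvg_cst].
have i1 (t : R) : t \in `[0, 1] -> t <= 2^-1 -> t * 2 \in `[0, 1].
  by rewrite !in_itv /= => /andP[h3 h4] h5; apply/andP; split; lra.
have i2 (t : R) : t \in `[0, 1] -> 2^-1 <= t -> t * 2 - 1 \in `[0, 1].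
  by rewrite !in_itv /= => /andP[h3 h4] h5; apply/andP; split; lra.
have hh : 2^-1 * 2 = 1 :> R by rewrite mulVf// pnatr_eq0.
have g2 t : 2^-1 <= t -> gamma t = gamma2 (t * 2 - 1) /\ G t = G2 (t * 2 - 1).
  rewrite le_eqVlt => /orP[/eqP <-|h]; last by rewrite /gamma /G leNgt h.
  by rewrite /gamma /G lexx hh subrr e11 e20 G11 G20.
have g1 t : t <= 2^-1 -> gamma t = gamma1 (t * 2) /\ G t = G1 (t * 2).
  by rewrite /gamma /G => ->.
(* Only at the midpoint do both halves contain [t]; elsewhere a neighbourhood of [t] avoids the
   other half, whose condition is then vacuous. *)
have paste (t : R) (P : R -> Prop) :
    (t <= 2^-1 -> \forall u \near t, u <= 2^-1 -> P u) ->
    (2^-1 <= t -> \forall u \near t, 2^-1 <= u -> P u) -> \forall u \near t, P u.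
  move=> hl hr.
  have hl' : \forall u \near t, u <= 2^-1 -> P u.
    have [/hl//|ht] := leP t 2^-1.
    have := @Nlt_nbhsl R t (- 2^-1); rewrite ltrN2 => /(_ ht).
    by apply: filterS => u; rewrite ltrN2 ltNge => /negbTE ->.
  have hr' : \forall u \near t, 2^-1 <= u -> P u.
    have [/hr//|ht] := leP 2^-1 t.
    by apply: filterS (lt_nbhsl ht) => u; rewrite ltNge => /negbTE ->.
  by apply: filterS2 hl' hr' => u h3 h4; have [/h3//|/ltW/h4] := leP u 2^-1.
exists gamma, G; split.
- apply/within_continuousP => t ht P hP; apply: paste => htl.
    have [gt _] := g1 t htl; rewrite gt in hP.
    have := nearM _ _ (c1 _ (i1 t ht htl) _ hP).
    by apply: filterS => u hu hul hu1; rewrite (g1 u hul).1; apply: hu; exact: i1.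
  have [gt _] := g2 t htl; rewrite gt in hP.
  have := nearMB _ _ (c2 _ (i2 t ht htl) _ hP).
  by apply: filterS => u hu hul hu1; rewrite (g2 u hul).1; apply: hu; exact: i2.
- by rewrite (g1 0 _).1 ?mul0r// invr_ge0.
- have h12 : 2^-1 <= 1 :> R by rewrite invf_le1// ler1n.
  by rewrite (g2 1 h12).1 mul1r -[2]/(1 + 1) addrK.
- move=> t ht; split.
    have [htl|/ltW htl] := leP t 2^-1.
      by have [-> ->] := g1 t htl; have [] := h1 _ (i1 t ht htl).
    by have [-> ->] := g2 t htl; have [] := h2 _ (i2 t ht htl).
  apply: paste => htl.
    have [_ Gt] := g1 t htl; rewrite Gt.
    have [_ /nearM] := h1 _ (i1 t ht htl).
    apply: filterS => u hu hul hu1; have [-> ->] := g1 u hul; apply: hu; exact: i1.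
  have [_ Gt] := g2 t htl; rewrite Gt.
  have [_ /nearMB] := h2 _ (i2 t ht htl).
  by apply: filterS => u hu hul hu1; have [-> ->] := g2 u hul; apply: hu; exact: i2.
- have h12 : 2^-1 <= 1 :> R by rewrite invf_le1// ler1n.
  rewrite (g2 1 h12).2 mul1r -[2]/(1 + 1) addrK (g1 0 _).2 ?mul0r ?invr_ge0//.
Qed.

(** Join [y] to [y'] by the path that is a straight segment in an atlas chart. It stays in a disc on
    which [g] remains an isometric germ, so the constant field [g] is parallel. *)
Lemma transports_near y g : germ y g ->
  \forall y' \near y, transports y g y' g.
Proof.
move=> hg; have [c [ac dy]] := regular_atlas (germ_regular hg).
have hc := atlas_chart ac.
have /nbhs_planeP[e e0 he] := chart_open hc dy (germ_near hg).
have hd : \forall y' \near y, `|c y' - c y| < e%:C.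
  apply: (chart_near (P := fun z => `|z - c y| < e%:C)) => //.
  by apply/nbhs_planeP; exists e.
apply: filterS2 (chart_dom_near hc dy) hd => y' dy' hy'.
pose z (t : R) : plane R := c y + t%:C * (c y' - c y).
have zP t : t \in `[0, 1] -> exists y'', [/\ dom c y'', germ y'' g & c y'' = z t].
  rewrite in_itv /= => /andP[t0 t1]; apply: he; rewrite /z addrC addKr normrM.
  have tn : `|t%:C| = t%:C by rewrite ger0_norm// lecR.
  apply: le_lt_trans hy'; rewrite tn ler_piMl//.
  by rewrite -[leRHS]/(1%:C) lecR.
pose gamma t := xget y [set y'' | [/\ dom c y'', germ y'' g & c y'' = z t]].
have gP t : t \in `[0, 1] -> [/\ dom c (gamma t), germ (gamma t) g & c (gamma t) = z t].
  by move=> /zP[y'' h]; rewrite /gamma; case: xgetP => [y3 _ //|/(_ y'')].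
have t0 : (0 : R) \in `[0, 1] by rewrite in_itv /= lexx ler01.
have t1 : (1 : R) \in `[0, 1] by rewrite in_itv /= lexx ler01.
exists gamma, (fun=> g); split=> //.
- apply/within_continuousP => t /gP[dt gt ct] P hP.
  have := chart_open hc dt hP; rewrite ct => hz.
  have zc : z u @[u --> t] --> z t.
    have cu (v w : R) : v * u + w @[u --> t] --> v * t + w.
      by apply: cvgD (cvg_cst w); apply: cvgM (cvg_cst v) cvg_id.
    have ez u : z u = ((complex.Re (c y' - c y)) * u + complex.Re (c y)) +i*
                      ((complex.Im (c y' - c y)) * u + complex.Im (c y)).
      rewrite /z; case: (c y' - c y) => v w; case: (c y) => v' w'.
      by apply/eqP; rewrite eq_complex /= !mul0r subr0 addr0 ![u * _]mulrC ![_ + v']addrC ![_ + w']addrC !eqxx.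
    by apply: cvg_plane; rewrite ez; under eq_fun do rewrite ez; exact: cu.
  have hu : \forall u \near t, exists y', [/\ dom c y', P y' & c y' = z u].
    exact: zc _ hz.
  apply: filterS hu => u [y'' [dy'' Py'' cy'']] /gP[du gu cu].
  by have <- : y'' = gamma u by apply: (chart_inj hc) => //; rewrite cu.
- have [d0 _ c0] := gP 0 t0; apply: (chart_inj hc) => //.
  by rewrite c0 /z mul0r addr0.
- have [d1 _ c1] := gP 1 t1; apply: (chart_inj hc) => //.
  by rewrite c1 /z mul1r addrC subrK.
- move=> t ht; split; first by have [] := gP t ht.
  by apply: filterE => u _; exists 0; apply: filterE => v; rewrite addr0.
Qed.

(** Membership of the transported germ in [Psi] is locally constant in the time parameter, and
    [0, 1] is connected. This is the source of the minimality of the transported family. *)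
Lemma transports_invariant (Psi : S -> (S -> plane R) -> Prop) y g y' g' :
  (forall y g g' b, Psi y g -> (\forall y' \near y, g' y' = g y' + b) ->
    Psi y g') ->
  (forall y g, germ y g -> \forall y' \near y, Psi y' g <-> Psi y g) ->
  transports y g y' g' -> Psi y g -> Psi y' g'.
Proof.
move=> ht hl [gamma [G [/within_continuousP cg <- <- hG [<- <-]]]].
have t0 : (0 : R) \in `[0, 1] by rewrite in_itv /= lexx ler01.
have t1 : (1 : R) \in `[0, 1] by rewrite in_itv /= lexx ler01.
refine (@locconst_connected R `[0, 1]%classic (fun t => Psi (gamma t) (G t)) 0 1
  (@segment_connected R 0 1) _ t0 t1).
move=> t ht01; have [gt hn] := hG t ht01.
have hc := cg t ht01 _ (hl _ _ gt).
apply: filterS2 hn hc => u hu hcu hu01; rewrite -(hcu hu01).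
have [b hb] := hu hu01; split=> h.
  by apply: (ht _ _ _ (- b) h); apply: filterS hb => z ->; rewrite addrK.
exact: ht hb.
Qed.

End Holonomy.

(** * Finite holonomy and distinguished families *)

Section ReallyFlat.
Context {R : realType} {S : flat_surface R}.
Implicit Types (y x : S) (g : S -> plane R) (a b : plane R) (gamma : R -> S).

(** The inverse comes from passing from charts to vectors: the vector with coordinate 1 in the
    transported germ starts as the unit vector of [g] and ends as that of [a * g], whose coordinate
    in [g] is [a^-1]. *)
Lemma loop_holonomy y g a : transports y g y (fun z => a * g z) ->
  holonomy_group y a^-1.
Proof.
move=> ht; have [hg hag] := transports_germ ht.
have a1 := germ_scale_norm hg hag; have an := norm1_neq0 a1.
move: ht => [gamma [G [cg g0 g1 hG [G0 G1]]]].
have cg' := (within_continuousP _ _).1 cg.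
have t0 : (0 : R) \in `[0, 1] by rewrite in_itv /= lexx ler01.
have t1 : (1 : R) \in `[0, 1] by rewrite in_itv /= lexx ler01.
exists gamma; split.
  split=> // t ht; have [h _] := hG t ht; exact: germ_regular h.
(* [e] is the linear part of [c] relative to [G t], that is, the coordinate in [c] of the vector
   whose coordinate in [G t] is 1. *)
pose coef t (c : chart R S) (e : plane R) :=
  exists b, \forall y' \near gamma t, c y' = e * G t y' + b.
pose X t (c : chart R S) : plane R := xget 0 [set e | coef t c e].
have coef_uniq t c e e' : t \in `[0, 1] -> coef t c e -> coef t c e' -> e = e'.
  move=> ht [b hb] [b' hb']; have [h _] := hG t ht.
  have hh : \forall y' \near gamma t, e * G t y' + b = e' * G t y' + b'.
    by apply: filterS2 hb hb' => z <-.
  by have [] := germ_transition_uniq h hh.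
have coef_ex t c : t \in `[0, 1] -> atlas c -> dom c (gamma t) ->
    exists e, `|e| = 1 /\ coef t c e.
  move=> ht ac dc; have [h _] := hG t ht.
  by have [e [b [e1 hb]]] := germ_transition h (atlas_germ ac dc); exists e; split=> //; exists b.
have XP t c e : t \in `[0, 1] -> coef t c e -> X t c = e.
  move=> ht he; rewrite /X; case: xgetP => [e' _ /= he'|/(_ e)//].
  exact: coef_uniq he' he.
exists X; split; first split.
- move=> t c c' d b ht ac ac' dc dc' tr.
  have [e [_ he]] := coef_ex t c ht ac dc; rewrite (XP _ _ _ ht he).
  apply: XP => //; have [b' hb'] := he; exists (d * b' + b).
  by apply: filterS2 tr hb' => z -> ->; rewrite mulrDr mulrA addrA.
- move=> t c ht ac dc; have [e [_ he]] := coef_ex t c ht ac dc.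
  have [b hb] := he; have [_ hn] := hG t ht.
  have := cg' t ht _ (near_join hb); apply: filterS2 hn => u hn hu hu01.
  rewrite (XP _ _ _ ht he); apply: XP => //.
  have [b' hb'] := hn hu01; exists (b - e * b').
  apply: filterS2 hb' (hu hu01) => z -> ->; ring.
- move=> c ac dc.
  have dc0 : dom c (gamma 0) by rewrite g0.
  have dc1 : dom c (gamma 1) by rewrite g1.
  have [e [e1 he]] := coef_ex 0 c t0 ac dc0; rewrite (XP _ _ _ t0 he); split=> //.
  apply: XP => //; have [b hb] := he; exists b.
  rewrite g1 G1 -g0; apply: filterS hb => z ->; rewrite G0.
  by field.
Qed.

(** Take all germs reached by transport from a single germ. Two of them at the same point that
    differ by a rotation come from a loop, so finite holonomy bounds the rotations. The second
    conclusion is minimality, stated as an induction principle. *)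
Lemma really_flat_reduction : really_flat S ->
  exists Phi : S -> (S -> plane R) -> Prop,
    (forall y, regular y -> reduction_at Phi y) /\
    forall Psi : S -> (S -> plane R) -> Prop,
    (forall y g g' b, Psi y g -> (\forall y' \near y, g' y' = g y' + b) ->
      Psi y g') ->
    (forall y g, germ y g -> \forall y' \near y, Psi y' g <-> Psi y g) ->
    forall y g y' g', Phi y g -> Phi y' g' -> Psi y g -> Psi y' g'.
Proof.
move=> hrf.
have [x0 _] := flat_nonempty S.
have [y0 ry0] : exists y0 : S, regular y0.
  apply: contrapT => nex; apply: (@not_isolated _ _ x0).
  apply: filterS (near_regular x0) => y h; apply: contrapT => /eqP yx.
  by apply: nex; exists y; exact: h.
have [g0 hg0] := regular_germ ry0.
pose Phi y g := transports y0 g0 y g; exists Phi.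
have loc y g : germ y g -> \forall y' \near y, Phi y' g <-> Phi y g.
  move=> /transports_near; apply: filterS => y' h; split=> h'.
    exact: transports_trans h' (transports_sym h).
  exact: transports_trans h' h.
have ex y : regular y -> exists g, Phi y g.
  move=> ry.
  apply: (regular_connected (A := fun y => exists g, Phi y g) _ ry0 ry).
    move=> y1 ry1; have [g1 hg1] := regular_germ ry1.
    apply: filterS2 (germ_near hg1) (transports_near hg1) => y2 hg2 tr; split.
      (* The germ reached at [y2] need not be [g1], but up to translation it is a rotation [a * g1],
         and that germ can be transported back to [y1]. *)
      move=> [g2 h2]; have [_ hg2'] := transports_germ h2.
      have [a [b [a1 hab]]] := germ_transition hg2 hg2'.
      exists (fun z => a * g1 z); apply: (transports_trans h2).
      apply: (transports_trans (y' := y2) (g' := fun z => a * g1 z)).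
        apply: (transports_translate (b := - b) hg2').
        by apply: filterS hab => z ->; rewrite addrK.
      exact/(transports_scale a1)/transports_sym.
    move=> [g2 h2]; have [_ hg2'] := transports_germ h2.
    have [a [b [a1 hab]]] := germ_transition hg1 hg2'.
    exists (fun z => a * g1 z); apply: (transports_trans h2).
    apply: (transports_trans (y' := y1) (g' := fun z => a * g1 z)).
      apply: (transports_translate (b := - b) hg2').
      by apply: filterS hab => z ->; rewrite addrK.
    exact: transports_scale.
  exists g0; apply: (transports_translate (b := 0) hg0).
  by apply: filterE => z; rewrite addr0.
split.
  move=> y ry; split=> //.
  - by move=> g /transports_germ[].
  - move=> g g' b h hb; have [_ hg] := transports_germ h.
    exact: transports_trans h (transports_translate hg hb).
  - exact: loc.
  - exact: ex.
  - move=> g h; apply: sub_finite_set (finite_image (fun a => a^-1) (hrf y ry)).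
    move=> a /= ha; exists a^-1; last by rewrite invrK.
    apply: (@loop_holonomy y g).
    exact: transports_trans (transports_sym h) ha.
move=> Psi ht hl y g y' g' h h'.
apply: (transports_invariant ht hl).
exact: transports_trans (transports_sym h) h'.
Qed.

(** Along the loop, follow the rotated charts in which the parallel vector has the fixed coordinate
    [lam]. They stay distinguished by local constancy, and at the end the vector has been multiplied
    by [a], so the chart has been multiplied by [a^-1]. *)
Lemma reduction_holonomy (Phi : S -> (S -> plane R) -> Prop) y g a :
  (forall y, regular y -> reduction_at Phi y) -> Phi y g ->
  holonomy_group y a -> Phi y (fun z => a^-1 * g z).
Proof.
move=> hPhi hPg.
move=> [gamma [[/within_continuousP cg g0 g1 rg] [X [[tr loc] hX]]]].
have t0 : (0 : R) \in `[0, 1] by rewrite in_itv /= lexx ler01.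
have t1 : (1 : R) \in `[0, 1] by rewrite in_itv /= lexx ler01.
have ry : regular y by rewrite -g0; exact: rg.
have [c0 [ac0 dc0]] := regular_atlas ry.
have hc0 := atlas_germ ac0 dc0.
have [e [b0 [e1 heb]]] := germ_transition hc0 (red_germ (hPhi y ry) hPg).
have en := norm1_neq0 e1.
have he : Phi y (fun z => e * c0 z).
  apply: (red_translate (b := - b0) (hPhi y ry) hPg).
  by apply: filterS heb => z ->; rewrite addrK.
have [X01 X1] := hX c0 ac0 dc0; have X0n := norm1_neq0 X01.
(* With this value the chart followed starts at [e * c0], which is [g] up to translation. *)
pose lam := e * X 0 c0.
have phi_eq t f f' b : t \in `[0, 1] ->
    (\forall y' \near gamma t, f' y' = f y' + b) ->
    Phi (gamma t) f <-> Phi (gamma t) f'.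
  move=> /rg rt h; split=> h'; first exact (red_translate (hPhi _ rt) h' h).
  apply: (red_translate (b := - b) (hPhi _ rt) h').
  by apply: filterS h => z ->; rewrite addrK.
pose A t := forall c, atlas c -> dom c (gamma t) ->
  Phi (gamma t) (fun z => lam * (X t c)^-1 * c z).
have AP t c : t \in `[0, 1] -> atlas c -> dom c (gamma t) ->
    A t <-> Phi (gamma t) (fun z => lam * (X t c)^-1 * c z).
  move=> ht ac dc; split=> [|h c' ac' dc']; first exact.
  have [d [b [d1 tcc']]] := atlas_compatible ac ac' dc dc'.
  have dn := norm1_neq0 d1.
  rewrite (tr t c c' d b ht ac ac' dc dc' tcc').
  apply/(phi_eq t _ _ (lam * (d * X t c)^-1 * b) ht _).1: h.
  apply: filterS tcc' => z ->; rewrite invfM.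
  by rewrite mulrDr -!mulrA; congr (_ + _); rewrite [_ * (d * _)]mulrCA mulKf.
have A0 : A 0.
  apply/(AP 0 c0) => //; rewrite ?g0//.
  by apply: (red_translate (b := 0) (hPhi y ry) he); apply: filterE => z;
    rewrite /lam mulfK// addr0.
have A1 : A 1.
  refine (@locconst_connected R `[0, 1]%classic A 0 1
    (@segment_connected R 0 1) _ t0 t1 A0).
  move=> t ht; have [c [ac dc]] := regular_atlas (rg t ht).
  have hn := cg t ht _ (chart_dom_near (atlas_chart ac) dc).
  have hl := loc t c ht ac dc.
  have hp : \forall u \near t, u \in `[0, 1] ->
      (Phi (gamma u) (fun z => lam * (X t c)^-1 * c z) <->
       Phi (gamma t) (fun z => lam * (X t c)^-1 * c z)).
    (* [hol] requires norm 1 only at the base point. If the factor is not of norm 1, neither side of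
       the equivalence can hold, since distinguished charts are isometric. *)
    have [k1|k1] := pselect (`|lam * (X t c)^-1| = 1).
      have hg := germ_scale (atlas_germ ac dc) k1.
      exact (cg t ht _ (red_local (hPhi _ (rg t ht)) hg)).
    apply: filterS hn => u hn hu; split=> h; exfalso; apply: k1.
      have hg := red_germ (hPhi _ (rg u hu)) h.
      exact: germ_scale_norm (atlas_germ ac (hn hu)) hg.
    have hg := red_germ (hPhi _ (rg t ht)) h.
    exact: germ_scale_norm (atlas_germ ac dc) hg.
  near=> u => hu.
  have dcu : dom c (gamma u) by move: hu; near: u; exact: hn.
  rewrite (AP u c hu ac dcu) (AP t c ht ac dc).
  have -> : X u c = X t c by move: hu; near: u; exact: hl.
  by move: hu; near: u; exact: hp.
have dc1 : dom c0 (gamma 1) by rewrite g1.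
have := A1 c0 ac0 dc1; rewrite g1 X1 => h.
apply: (red_translate (b := a^-1 * b0) (hPhi y ry) h).
apply: filterS heb => z ->; rewrite mulrDr; congr (_ + _).
by rewrite /lam invfM mulrACA mulfV// mulr1 mulrCA mulrA.
Unshelve. all: by end_near. Qed.

Lemma reduction_really_flat (Phi : S -> (S -> plane R) -> Prop) :
  (forall y, regular y -> reduction_at Phi y) -> really_flat S.
Proof.
move=> hPhi y ry; have [g hg] := red_ex (hPhi y ry).
apply: sub_finite_set (finite_image (fun a => a^-1) (red_finite (hPhi y ry) hg)).
by move=> a /(reduction_holonomy hPhi hg) h; exists a^-1; rewrite ?invrK.
Qed.

End ReallyFlat.

(** A continuous map from a compact space to a Hausdorff space is closed; the image of the points
    where [P] fails to hold nearby is a closed set that misses [y]. *)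
Lemma near_fiber {T U : topologicalType} (f : T -> U) (P : T -> Prop) (y : U) :
  compact [set: T] -> hausdorff_space U -> continuous f ->
  (forall x, f x = y -> \forall x' \near x, P x') ->
  \forall y' \near y, forall x, f x = y' -> P x.
Proof.
move=> cT hU cf h.
pose K := ~` interior [set x | P x].
have cK : closed K by apply: open_closedC; exact: open_interior.
have : compact (f @` K).
  apply: continuous_compact; first exact: continuous_subspaceT.
  by apply: (subclosed_compact cK cT).
move=> /(compact_closed hU) /closed_openC oC.
have : nbhs y (~` (f @` K)).
  by apply: open_nbhs_nbhs; split=> // -[x nx fx]; apply: nx; exact: h.
apply: filterS => y' ny x fx; apply: contrapT => nP; apply: ny.
by exists x => // /nbhs_singleton.
Qed.

(** * Branched coverings *)

Section LocalDegree.
Context {R : realType}.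

Lemma expr_inj_near (z0 : plane R) k : z0 != 0 -> (0 < k)%N ->
  exists2 B : set (plane R), nbhs z0 B &
    forall z z', B z -> B z' -> z ^+ k = z' ^+ k -> z = z'.
Proof.
move=> z00 k0; have [rho [t [r0 ez]]] := polar_surj z0.
have {}r0 : 0 < rho.
  rewrite lt_neqAle r0 andbT; apply: contra z00 => /eqP e.
  by rewrite ez -e polar0.
have kR : 0 < k%:R :> R by rewrite ltr0n.
have hpi := pi_gt0 R.
(* Points with equal [k]-th powers have arguments differing by a multiple of 2 pi / k. In a sector
   of half-opening pi / k the difference is strictly smaller, so it vanishes. *)
have pk : 0 < pi / k%:R :> R by rewrite divr_gt0.
pose P (p : R * R) := 0 < p.1 /\ `|p.2 - t| < pi / k%:R.
have nP : \forall p \near (rho, t), P p.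
  have h1 : (fun p : R * R => p.1) @ (rho, t) --> rho by exact: cvg_fst.
  have h2 : (fun p : R * R => p.2) @ (rho, t) --> t by exact: cvg_snd.
  apply: filterI; first exact: (cvgr_gt _ h1 0 r0).
  move/cvgrPdist_lt : h2 => /(_ _ pk); apply: filterS => p.
  by rewrite distrC.
exists [set z | exists2 p, P p & z = polar p.1 p.2].
  by rewrite ez; exact: polar_open nP.
move=> z z' [[a s] [/= a0 hs] ->] [[a' s'] [/= a0' hs'] ->].
rewrite !polarX => /polar_inj; rewrite !exprn_gt0// => /(_ isT isT)[ea [j ej]].
have -> : a = a'.
  by apply/eqP; rewrite -(eqrXn2 k0) ?ltW//; exact/eqP.
congr polar.
have hss : `|s' - s| < 2 * pi / k%:R.
  have -> : s' - s = (s' - t) - (s - t) by ring.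
  apply: (le_lt_trans (ler_normB _ _)).
  by rewrite -mulrA mulr_natl mulr2n ltrD.
have ej' : (s' - s) * k%:R = 2 * pi * j%:~R.
  by rewrite mulrBl !mulr_natr ej addrC addKr.
have j0 : j = 0.
  have : `|2 * pi * j%:~R| < 2 * pi :> R.
    by rewrite -ej' normrM (ger0_norm (ltW kR)) -ltr_pdivlMr.
  rewrite normrM ger0_norm ?mulr_ge0 ?ltW//.
  rewrite -[ltRHS]mulr1 ltr_pM2l ?mulr_gt0// -intr_norm -[1]/(1%:~R) ltr_int.
  by case: j {ej ej'} => -[].
move: ej'; rewrite j0 mulr0 => /eqP; rewrite mulf_eq0 (gt_eqF kR) orbF subr_eq0.
by move=> /eqP ->.
Qed.

Lemma polar_root_neq1 k : (1 < k)%N -> polar 1 (2 * pi / k%:R) != 1 :> plane R.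
Proof.
move=> k1; apply/eqP; rewrite -polar00 => /(polar_inj ltr01 ltr01)[_ [j hj]].
have kR : 1 < k%:R :> R by rewrite ltr1n.
have pi2 : 2 * pi != 0 :> R by rewrite mulf_neq0 ?pnatr_eq0// gt_eqF// pi_gt0.
have e : (- j)%:~R = k%:R^-1 :> R.
  apply: (mulfI pi2); rewrite mulrNz mulrN.
  by apply/eqP; rewrite eq_sym -addr_eq0 -hj.
have h1 : 0 < (- j)%:~R :> R by rewrite e invr_gt0 (lt_trans ltr01).
have h2 : (- j)%:~R < 1 :> R by rewrite e invf_lt1// (lt_trans ltr01).
move: h1 h2; rewrite -[1]/(1%:~R) -[0]/(0%:~R) !ltr_int.
by case: (- j) => -[].
Qed.

Context {T U : topologicalType} (f : T -> U).

(** In charts [f] is a power map, which is locally injective off the centre and sends only the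
    centre to 0. A local degree above 1 at a nearby point would contradict that injectivity. *)
Lemma local_degree_near x k : local_degree R f x k ->
  \forall x' \near x, x' != x ->
    f x' <> f x /\ forall k', local_degree R f x' k' -> (k' <= 1)%N.
Proof.
move=> [k0 [c [c' [[hc hc'] [dx cx] [dfx cfx] hcc']]]].
apply: filterS (chart_dom_near hc dx) => x' dx' x'x.
have [dfx' cfx'] := hcc' x' dx'.
have cn : c x' != 0.
  by apply: contra x'x => /eqP h; apply/eqP/(chart_inj hc) => //; rewrite cx.
split.
  by move=> e; move: cfx'; rewrite e cfx => /esym/eqP; rewrite expf_eq0 k0 (negbTE cn).
move=> k' [k'0 [d [d' [[hd hd'] [dx2 dx0] [dfx2 dfx0] hdd']]]].
rewrite leqNgt; apply/negP => k'1.
have [B nB hB] := expr_inj_near cn k0.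
have hn : \forall p \near x', dom c p /\ B (c p).
  by apply: filterI; [exact: chart_dom_near|exact: chart_near hc dx' nB].
have := chart_open hd dx2 hn; rewrite dx0 => /nbhs_planeP[e e0 he].
(* Two distinct points with the same [k']-th power, close enough to 0 for their preimages under [d]
   to lie where [f] is injective. *)
pose w : plane R := (e / 2)%:C.
pose w' : plane R := w * polar 1 (2 * pi / k'%:R).
have e2 : 0 < e / 2 by rewrite divr_gt0.
have e2e : e / 2 < e by rewrite ltr_pdivrMr// ltr_pMr// ltr1n.
have nw : `|w| < e%:C by rewrite ger0_norm ?ltcR// lecR ltW.
have nw' : `|w'| < e%:C by rewrite normrM normr_polar// mulr1.
have [p [dp [dcp Bp] wp]] : exists p, [/\ dom d p, dom c p /\ B (c p) & d p = w].
  by apply: he; rewrite subr0.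
have [q [dq [dcq Bq] wq]] : exists p, [/\ dom d p, dom c p /\ B (c p) & d p = w'].
  by apply: he; rewrite subr0.
have [dfp dfpE] := hdd' p dp; have [dfq dfqE] := hdd' q dq.
have fpq : f p = f q.
  apply: (chart_inj hd') => //; rewrite dfpE dfqE wp wq exprMn polarX expr1n.
  have -> : 2 * pi / k'%:R *+ k' = 0 + 2 * pi * 1%:~R :> R.
    by rewrite add0r mulr1 -mulr_natr divfK// pnatr_eq0 -lt0n.
  by rewrite polarDpi polar00 mulr1.
have [_ cp] := hcc' p dcp; have [_ cq] := hcc' q dcq.
have : c p = c q by apply: hB => //; rewrite -cp -cq fpq.
move=> /(chart_inj hc dcp dcq) pq; move: wq; rewrite -pq wp /w' => /eqP.
rewrite -[X in X == _]mulr1 (inj_eq (mulfI _)); last first.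
  by rewrite (inj_eq (@complexI R)) gt_eqF.
by rewrite eq_sym (negbTE (polar_root_neq1 k'1)).
Qed.

End LocalDegree.

(** Branch points are isolated: [local_degree_near] applies at every point of the fibre, and
    [near_fiber] makes the conclusion uniform over nearby fibres. *)
Lemma near_not_branch {R : realType} {T U : topologicalType} (f : T -> U) y :
  compact [set: T] -> hausdorff_space U -> branched_covering R f ->
  \forall y' \near y, y' != y -> ~ branch_points R f y'.
Proof.
move=> cT hU [cf _ _ hdeg].
have : \forall y' \near y, forall x, f x = y' ->
    (f x <> y -> forall k, local_degree R f x k -> (k <= 1)%N).
  apply: near_fiber => // x <-; have [k /local_degree_near] := hdeg x.
  apply: filterS => x' h fx; apply: (proj2 (h _)).
  by apply: contra_notN fx => /eqP ->.
apply: filterS => y' h /eqP y'y [x [k [fx hk]]]; rewrite ltnNge (h x fx)//.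
by rewrite fx.
Qed.

Lemma red_finite_germ {R : realType} {S0 : flat_surface R} (Phi : S0 -> (S0 -> plane R) -> Prop) y
    (g : S0 -> plane R) :
  reduction_at Phi y -> germ y g -> finite_set [set a | Phi y (fun z => a * g z)].
Proof.
move=> h hg; have [e [e1 he]] := red_rotate h hg; have en := norm1_neq0 e1.
apply: sub_finite_set (finite_image (fun a => a * e) (red_finite h he)).
move=> a /= ha; exists (a / e); last by rewrite divfK.
apply: (red_translate (b := 0) h ha); apply: filterE => z.
by rewrite mulrA divfK// addr0.
Qed.

(** * Distinguished families along flat coverings *)

Section FlatCovering.
Context {R : realType} {S S' : flat_surface R} {f : S -> S'}.
Hypothesis hf : flat_covering f.
Implicit Types (x : S) (y : S').

Let cf : continuous f. Proof. by case: hf => -[]. Qed.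

Let unbranched x := regular x /\ ~ branch_points R f (f x).

Lemma unbranched_regular x : unbranched x -> regular (f x).
Proof.
by move=> [rx /(proj2 hf)[e _]]; rewrite /regular /= e.
Qed.

Lemma near_comp x (P : S' -> Prop) : (\forall y \near f x, P y) ->
  \forall x' \near x, P (f x').
Proof. exact: cf. Qed.

Lemma near_unbranched x : \forall x' \near x, x' != x -> unbranched x'.
Proof.
have [k /local_degree_near hk] := (let: And4 _ _ _ h := proj1 hf in h) x.
have h := near_comp (near_not_branch (f x) (@flat_compact _ S) (@flat_hausdorff _ S') (proj1 hf)).
near=> x' => x'x; split.
  by move: x'x; near: x'; exact: near_regular.
have /eqP : f x' <> f x.
  by apply: (proj1 (_ : _ /\ forall k, local_degree R f x' k -> (k <= 1)%N)); move: x'x; near: x'.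
by near: x'.
Unshelve. all: by end_near. Qed.

Lemma germ_comp x g : unbranched x -> germ (f x) g -> germ x (g \o f).
Proof.
move=> [rx nb] hg; have [e [r [c [c' [hc hc' hcc']]]]] := (proj2 hf) x nb.
have rfx : regular (f x) by rewrite /regular /= e.
have hgc := cone_germ rx hc; have hgc' := cone_germ rfx hc'.
have [a [b [a1 hab]]] := germ_transition hgc' hg.
apply: (germ_affine (a := a) (b := b) hgc a1).
apply: filterS2 (near_comp hab) (chart_dom_near (cone_is_chart hc) (cone_center hc)).
by move=> x' /= -> /hcc'[_ ->].
Qed.

Lemma near_image x (P : S -> Prop) : unbranched x -> (\forall x' \near x, P x') ->
  \forall y \near f x, exists2 x', f x' = y & P x'.
Proof.
move=> [rx nb] hP; have [e [r [c [c' [hc hc' hcc']]]]] := (proj2 hf) x nb.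
have := chart_open (cone_is_chart hc) (cone_center hc) hP.
rewrite (cone_center0 hc) -(cone_center0 hc') => h.
have hn := chart_near (cone_is_chart hc') (cone_center hc') h.
apply: filterS2 hn (chart_dom_near (cone_is_chart hc') (cone_center hc')).
move=> y [x' [dx' Px' cx']] dy; exists x' => //.
have [dfx' cfx'] := hcc' x' dx'.
by apply: (chart_inj (cone_is_chart hc')) => //; rewrite cfx'.
Qed.

(** At an unbranched point [f] is a local isometry, so every germ upstairs descends and may be
    tested below. The other points are isolated and are filled in by [reduction_extend]. *)
Lemma reduction_pullback (Phi : S' -> (S' -> plane R) -> Prop) :
  (forall y, regular y -> reduction_at Phi y) ->
  exists Psi : S -> (S -> plane R) -> Prop,
    forall x, regular x -> reduction_at Psi x.
Proof.
move=> hPhi.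
pose Psi x g := germ x g /\ exists g', Phi (f x) g' /\
  \forall x' \near x, g x' = g' (f x').
(* The germ below is determined up to translation, so the existential in [Psi] can be tested on any
   one descended germ. *)
have PsiP x g g' : regular (f x) -> germ (f x) g' -> germ x g ->
    (\forall x' \near x, g x' = g' (f x')) -> Psi x g <-> Phi (f x) g'.
  move=> rfx hg' hg e; split=> [[_ [g2 [h2 e2]]]|h]; last by split=> //; exists g'.
  have [a [b [a1 hab]]] := germ_transition hg' (red_germ (hPhi _ rfx) h2).
  have : \forall x' \near x, 1 * g x' + 0 = a * g x' + b.
    apply: filterS2 (filterI e e2) (near_comp hab) => x' [e1 e2'].
    by rewrite mul1r addr0 -e2' e1.
  move=> /(germ_transition_uniq hg)[a0 b0].
  apply: (red_translate (b := 0) (hPhi _ rfx) h2).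
  by apply: filterS hab => z ->; rewrite -a0 -b0 mul1r !addr0.
apply: (reduction_extend (Phi := Psi)) => x0.
apply: filterS (near_unbranched x0) => x h /h {h}ux; have rfx := unbranched_regular ux.
have lift g : germ x g -> exists g', germ (f x) g' /\
    \forall x' \near x, g x' = g' (f x').
  move=> hg; have [h' hh'] := regular_germ rfx.
  have [a [b [a1 hab]]] := germ_transition (germ_comp ux hh') hg.
  exists (fun z => a * h' z + b); split=> //.
  by apply: (germ_affine hh' a1); exact: filterE.
split.
- by case: ux.
- by move=> g [].
- move=> g g' b [hg [g2 [h2 e2]]] e; split.
    by apply: (germ_affine hg (normr1 _)); apply: filterS e => z ->; rewrite mul1r.
  exists (fun z => g2 z + b); split.
    by apply: (red_translate (hPhi _ rfx) h2); exact: filterE.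
  by apply: filterS2 e e2 => z -> ->.
- move=> g hg; have [g' [hg' e]] := lift g hg.
  have hl := near_comp (red_local (hPhi _ rfx) hg').
  have hgn := near_comp (germ_near hg').
  apply: filterS2 (filterI hl hgn) (filterI (germ_near hg) (near_join e)).
  move=> x' [hl' hg2'] [hg2 e'].
  rewrite (PsiP x' g g' (germ_regular hg2') hg2' hg2 e').
  by rewrite (PsiP x g g' rfx hg' hg e).
- have [g' hg'] := red_ex (hPhi _ rfx).
  exists (g' \o f); split; first exact: germ_comp ux (red_germ (hPhi _ rfx) hg').
  by exists g'; split=> //; exact: filterE.
- move=> g [hg _]; have [g' [hg' e]] := lift g hg.
  apply: sub_finite_set (red_finite_germ (hPhi _ rfx) hg') => a /= ha.
  have hag := ha.1; have a1 := germ_scale_norm hg hag.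
  apply/(PsiP x (fun z => a * g z)) => //; first exact: germ_scale.
  by apply: filterS e => z ->.
Unshelve. all: by end_near. Qed.

(** A chart below is distinguished when its pullback is so at some point of the fibre. This union
    over the fibre adds finitely many rotations per preimage, and fibres are finite. *)
Lemma reduction_pushforward (Phi : S -> (S -> plane R) -> Prop) :
  (forall x, regular x -> reduction_at Phi x) ->
  exists Psi : S' -> (S' -> plane R) -> Prop,
    forall y, regular y -> reduction_at Psi y.
Proof.
move=> hPhi; have [_ fsurj ffin _] := proj1 hf.
pose Psi y g := germ y g /\ exists2 x, f x = y & Phi x (g \o f).
apply: (reduction_extend (Phi := Psi)) => y0.
have hnb := near_not_branch y0 (@flat_compact _ S) (@flat_hausdorff _ S') (proj1 hf).
apply: filterS2 (near_regular y0) hnb => y h1 h2 yy0.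
have {h1} ry := h1 yy0; have {h2} nby := h2 yy0.
have unb x : f x = y -> unbranched x.
  move=> fx; have nb : ~ branch_points R f (f x) by rewrite fx.
  split=> //; have [e _] := proj2 hf x nb.
  by rewrite /regular /= -e fx.
split=> //.
- by move=> g [].
- move=> g g' b [hg [x fx hx]] e; split.
    by apply: (germ_affine hg (normr1 _)); apply: filterS e => z ->; rewrite mul1r.
  exists x => //; apply: (red_translate (b := b) (hPhi x (proj1 (unb x fx))) hx).
  by rewrite -fx in e; exact: near_comp e.
(* Membership spreads from a single preimage because [f] is open there; non-membership concerns all
   preimages at once and needs [near_fiber]. *)
- move=> g hg; have [[_ [x fx hx]]|nPsi] := pselect (Psi y g).
    have hl : \forall x' \near x, Phi x' (g \o f) <-> Phi x (g \o f).
      apply: (red_local (hPhi x (proj1 (unb x fx)))).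
      by apply: germ_comp; [exact: unb|rewrite fx].
    have := near_image (unb x fx) hl; rewrite fx => hy.
    apply: filterS2 hy (germ_near hg) => y' [x' fx' hx'] hg'; split=> _.
      by split=> //; exists x.
    by split=> //; exists x' => //; exact/hx'.
  have : \forall y' \near y, forall x, f x = y' -> ~ Phi x (g \o f).
    apply: near_fiber => //; [exact: flat_compact|exact: flat_hausdorff|].
    move=> x fx; have ux := unb x fx.
    have hl : \forall x' \near x, Phi x' (g \o f) <-> Phi x (g \o f).
      by apply: (red_local (hPhi x (proj1 ux))); apply: germ_comp; rewrite ?fx.
    apply: filterS hl => x' hx' /hx' h; apply: nPsi.
    by split=> //; exists x.
  apply: filterS => y' hy'; split=> [[_ [x /hy' h /h//]]|/nPsi//].
- have [x _ fx] : range f y by rewrite fsurj.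
  have [g' hg'] := regular_germ ry.
  have hgx : germ x (g' \o f) by apply: germ_comp; [exact: unb|rewrite fx].
  have [a [a1 ha]] := red_rotate (hPhi x (proj1 (unb x fx))) hgx.
  exists (fun z => a * g' z); split; first exact: germ_scale.
  by exists x.
- move=> g [hg _].
  have : finite_set (\bigcup_(x in f @^-1` [set y]) [set a | Phi x (fun z => a * (g \o f) z)]).
    apply: bigcup_finite => // x fx; apply: red_finite_germ.
      exact: hPhi x (proj1 (unb x fx)).
    by apply: germ_comp; [exact: unb|rewrite fx].
  by apply: sub_finite_set => a [_ [x fx hx]]; exists x.
Qed.

Lemma flat_covering_really_flat : really_flat S <-> really_flat S'.
Proof.
split=> /really_flat_reduction[Phi [hPhi _]].
  by have [Psi] := reduction_pushforward hPhi; exact: reduction_really_flat.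
by have [Psi] := reduction_pullback hPhi; exact: reduction_really_flat.
Qed.

End FlatCovering.

(** * Recoordinatizing charts by rotations and radial powers *)

Section ChartMap.
Context {R : realType}.

Definition chart_map {T : Type} (c : chart R T) (h : plane R -> plane R) :=
  Chart (dom c) (fun y => h (c y)).

Lemma is_chart_map {T : topologicalType} (c : chart R T) (h : plane R -> plane R) :
  is_chart c -> injective h -> continuous h ->
  (forall z (P : plane R -> Prop), (\forall w \near z, P w) ->
    \forall w \near h z, exists2 z', P z' & w = h z') ->
  is_chart (chart_map c h).
Proof.
move=> hc hi hcont hop; have [oc ic cc hcO] := hc; split.
- exact: oc.
- by move=> x y xd yd /hi; exact: ic.
- by move=> x dx P hP; apply: (cc x dx (fun z => P (h z))); exact: hcont hP.
move=> A oA Ad; have := hcO A oA Ad; rewrite openE => hO.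
move=> _ [y Ay <-]; rewrite /interior.
have hA : \forall w \near c y, (c @` A) w.
  by apply: hO; exists y.
by apply: filterS (hop _ _ hA) => w [_ [y' Ay' <-] ->]; exists y'.
Qed.

Lemma is_chart_scale {T : topologicalType} (c : chart R T) (u : plane R) :
  is_chart c -> `|u| = 1 -> is_chart (chart_map c (fun z => u * z)).
Proof.
move=> hc u1; have un := norm1_neq0 u1; apply: is_chart_map => //.
- exact: mulfI.
- move=> z P /nbhs_planeP[e e0 he]; apply/nbhs_planeP; exists e => // w hw.
  by apply: he; rewrite -mulrBr normrM u1 mul1r.
- move=> z P /nbhs_planeP[e e0 he]; apply/nbhs_planeP; exists e => // w hw.
  exists (u^-1 * w); last by rewrite mulVKf.
  by apply: he; rewrite -[z](mulKf un) -mulrBr normrM normfV u1 invr1 mul1r.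
Qed.

(** A homeomorphism of the plane sending (rho, t) to (rho^k, t). The projection of the cover
    multiplies the recorded angle by k but keeps the radius; composing the target chart with
    [radial k] turns it into the complex power demanded by [local_degree]. *)
Definition radial k (z : plane R) : plane R := `|z| ^+ k.-1 * z.

Lemma radial_polar k rho t : (0 < k)%N -> 0 <= rho ->
  radial k (polar rho t) = polar (rho ^+ k) t.
Proof.
move=> k0 r0; rewrite /radial normr_polar// -rmorphXn/=.
by rewrite polar_realM (polar_realM (rho ^+ k)) mulrA -rmorphM -exprSr prednK.
Qed.

Lemma real_root (s : R) k : (0 < k)%N -> 0 < s ->
  0 < expR (ln s / k%:R) /\ expR (ln s / k%:R) ^+ k = s.
Proof.
move=> k0 s0; split; first exact: expR_gt0.
rewrite -expRM_natl mulrC divfK ?pnatr_eq0 -?lt0n//.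
by rewrite lnK.
Qed.

Lemma radial_inj k : (0 < k)%N -> injective (radial k).
Proof.
move=> k0 z z'.
have [rho [s [r0 ->]]] := polar_surj z; have [rho' [s' [r0' ->]]] := polar_surj z'.
rewrite !radial_polar// => e.
have er : rho = rho'.
  have : `|polar (rho ^+ k) s| = `|polar (rho' ^+ k) s'| by rewrite e.
  rewrite !normr_polar ?exprn_ge0// => /complexI h.
  by apply/eqP; rewrite -(eqrXn2 k0)// h.
rewrite -er in e *; move: r0; rewrite le_eqVlt => /orP[/eqP <-|r0].
  by rewrite !polar0.
have := polar_inj (exprn_gt0 k r0) (exprn_gt0 k r0) e => -[_ [j ->]].
by rewrite polarDpi.
Qed.

Lemma radial_continuous k : continuous (radial k).
Proof.
move=> z; have h1 : `|w| @[w --> z] --> `|z| by exact: norm_continuous.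
have h2 n : (`|w| ^+ n) @[w --> z] --> `|z| ^+ n.
  elim: n => [|n ih]; first by under eq_fun do rewrite expr0; exact: cvg_cst.
  by rewrite exprS; under eq_fun do rewrite exprS; exact: cvgM h1 ih.
exact: cvgM (h2 k.-1) cvg_id.
Qed.

Lemma radial_open k z (P : plane R -> Prop) : (0 < k)%N ->
  (\forall w \near z, P w) -> \forall w \near radial k z, exists2 z', P z' & w = radial k z'.
Proof.
move=> k0; have [rho [s [r0 ->]]] := polar_surj z => hP.
rewrite radial_polar//; move: r0; rewrite le_eqVlt => /orP[/eqP r0|r0].
  rewrite -r0 expr0n gtn_eqF//= polar0 in hP *.
  have /nbhs_planeP[e e0 he] := hP; apply/nbhs_planeP; exists (e ^+ k).
    exact: exprn_gt0.
  move=> w; rewrite subr0; have [sg [t [sg0 ->]]] := polar_surj w.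
  rewrite normr_polar// ltcR => hs.
  move: sg0; rewrite le_eqVlt => /orP[/eqP sg0|sg0].
    exists 0; first by apply: he; rewrite subr0 normr0 ltcR.
    by rewrite -sg0 polar0 /radial mulr0.
  have [rt0 rtk] := real_root k0 sg0.
  exists (polar (expR (ln sg / k%:R)) t).
    apply: he; rewrite subr0 normr_polar ?ltW// ltcR.
    by rewrite -(ltr_pXn2r k0) ?nnegrE ?ltW// rtk.
  by rewrite radial_polar ?ltW// rtk.
have rk0 := exprn_gt0 k r0.
have hq : \forall q \near (rho ^+ k, s), P (polar (expR (ln q.1 / k%:R)) q.2) /\ 0 < q.1.
  have h1 : (fun q : R * R => q.1) @ (rho ^+ k, s) --> rho ^+ k by exact: cvg_fst.
  apply: filterI; last exact: (cvgr_gt _ h1 0 rk0).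
  have h2 : expR (ln q.1 / k%:R) @[q --> (rho ^+ k, s)] --> rho.
    have -> : nbhs rho = nbhs (expR (ln (rho ^+ k) / k%:R)).
      congr nbhs; apply/eqP; rewrite -(eqrXn2 k0) ?ltW// ?expR_gt0//.
      by rewrite (proj2 (real_root k0 rk0)).
    apply: continuous_cvg; first exact: continuous_expR.
    apply: cvgM; last exact: cvg_cst.
    by apply: continuous_cvg => //; exact: continuous_ln.
  have h3 : (expR (ln q.1 / k%:R), q.2) @[q --> (rho ^+ k, s)] --> (rho, s).
    by apply: cvg_nbhs_pair => //; exact: cvg_snd.
  exact: (cvg_comp _ _ h3 (@continuous_polar R _)) hP.
apply: filterS (polar_open rk0 hq) => w [q [Pq q0] ->].
have [rt0 rtk] := real_root k0 q0.
by eexists; first exact: Pq; rewrite radial_polar ?ltW// rtk.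
Qed.

End ChartMap.

(** * Surfaces whose atlas changes by translations *)

Section Translation.
Context {R : realType} {S : flat_surface R}.
Hypothesis translations : forall (c c' : chart R S) y, atlas c -> atlas c' ->
  dom c y -> dom c' y -> exists b, \forall y' \near y, c' y' = c y' + b.

(** The atlas charts up to translation. Since changes of charts are translations, the only multiple
    of a member that is again a member is the one by 1. *)
Let Phi (y : S) (g : S -> plane R) := exists c b,
  [/\ atlas c, dom c y & \forall y' \near y, g y' = c y' + b].

Let PhiP c y g a b : atlas c -> dom c y ->
  (\forall y' \near y, g y' = a * c y' + b) -> Phi y g <-> a = 1.
Proof.
move=> ac dy h; split=> [[c' [b' [ac' dy' h']]]|a1].
  have [b2 h2] := translations ac ac' dy dy'.
  have e : \forall y' \near y, a * c y' + b = 1 * c y' + (b2 + b').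
    by apply: filterS2 (filterI h h') h2 => z [<- ->] ->; rewrite mul1r addrA.
  by have [] := germ_transition_uniq (atlas_germ ac dy) e.
exists c, b; split=> //; apply: filterS h => z ->.
by rewrite a1 mul1r.
Qed.

Let reduction_Phi y : regular y -> reduction_at Phi y.
Proof.
move=> ry; have [c [ac dy]] := regular_atlas ry; split=> //.
- move=> g [c' [b [ac' dy' h]]].
  apply: (germ_affine (a := 1) (b := b) (atlas_germ ac' dy')); first exact: normr1.
  by apply: filterS h => z ->; rewrite mul1r.
- move=> g g' b [c' [b' [ac' dy' h]]] e; exists c', (b' + b); split=> //.
  by apply: filterS2 e h => z -> ->; rewrite addrA.
- move=> g hg; have [a [b [a1 h]]] := germ_transition (atlas_germ ac dy) hg.
  apply: filterS2 (near_join h) (chart_dom_near (atlas_chart ac) dy) => y' h' dy'.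
  by rewrite (PhiP ac dy h) (PhiP ac dy' h').
- exists c, c, 0; split=> //; apply: filterE => z; rewrite addr0 //.
- move=> g [c' [b [ac' dy' h]]]; apply: (sub_finite_set _ (finite_set1 (1 : plane R))).
  move=> a; rewrite /= (@PhiP c' y _ a (a * b)) //.
  by apply: filterS h => z ->; rewrite mulrDr.
Qed.

(** Holonomy acts on the family of atlas charts by rotations, and that family admits only the
    rotation 1; the constant loop realizes it. *)
Lemma translation_very_flat : very_flat S.
Proof.
move=> y ry; have [c [ac dy]] := regular_atlas ry; apply/seteqP; split=> [a ha|_ ->].
  have hc : Phi y c.
    by exists c, 0; split=> //; apply: filterE => z; rewrite addr0.
  have := reduction_holonomy reduction_Phi hc ha.
  rewrite (@PhiP c y _ a^-1 0) //.
    by move=> e; rewrite /= -[a]invrK e invr1.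
  by apply: filterE => z; rewrite addr0.
have hg := atlas_germ ac dy; rewrite -[1]invr1; apply: (@loop_holonomy _ _ y c).
apply: (transports_translate (b := 0) hg).
by apply: filterE => z; rewrite mul1r addr0.
Qed.

End Translation.

(** * The very flat cover *)

Section Cover.
Context {R : realType} {S : flat_surface R}.
Variable Phi : S -> (S -> plane R) -> Prop.
Hypothesis hPhi : forall y, regular y -> reduction_at Phi y.
Variables (rr : S -> R) (cc : S -> chart R S).
Hypothesis hcc : forall x,
  cone_chart (@atlas R S) (@regular R S) x (angle x) (rr x) (cc x).
Implicit Types (x y : S) (g : S -> plane R) (a b u v : plane R) (p q : R * R).

Local Notation rot x j := (polar 1 (angle x * j%:~R) : plane R).

Lemma cone_sample x : exists y p g,
  [/\ 0 < p.1 < rr x, dom (cc x) y, cc x y = cone (angle x) p,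
      dev x (cc x) p g & germ y g].
Proof.
have r0 := cone_radius_gt0 (hcc x).
have [y [dy cy]] := @cone_point _ _ _ _ _ (hcc x) (rr x / 2, 0) (ltac:(
  by rewrite /= divr_ge0 ?ltW//= ltr_pdivrMr// ltr_pMr// ltr1n)).
have p0 : 0 < (rr x / 2, 0 : R).1 by rewrite /= divr_gt0.
have [g [hg hd]] := dev_exists (hcc x) dy p0 cy.
exists y, (rr x / 2, 0), g; split=> //=.
by rewrite divr_gt0//= ltr_pdivrMr// ltr_pMr// ltr1n.
Qed.

Lemma cone_point_regular x y p : dom (cc x) y -> 0 < p.1 ->
  cc x y = cone (angle x) p -> regular y.
Proof.
move=> dy p0 cy; apply: (cone_regular (hcc x) dy).
exact (cone_neq_center (hcc x) p0 cy).
Qed.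

(* The rotations [u] for which [u * zeta] is distinguished, [zeta] being the
   developing map of the punctured cone at [x] along the polar angle. *)
Definition rotations x u := forall y p g, dom (cc x) y -> 0 < p.1 ->
  cc x y = cone (angle x) p -> dev x (cc x) p g -> Phi y (fun z => u * g z).

(** One lift of one point decides: the condition is locally constant on the strip over the punctured
    cone, and the strip is connected. *)
Lemma rotationsP x u y p g : dom (cc x) y -> 0 < p.1 ->
  cc x y = cone (angle x) p -> dev x (cc x) p g ->
  Phi y (fun z => u * g z) -> rotations x u.
Proof.
move=> dy p0 cy hd hP y' q g' dy' q0 cy' hd'.
have ry := cone_point_regular dy p0 cy.
have u1 : `|u| = 1.
  apply: germ_scale_norm (dev_germ (hcc x) dy p0 cy hd) _.
  exact (red_germ (hPhi ry) hP).
pose B q := forall y g, dom (cc x) y -> cc x y = cone (angle x) q ->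
  dev x (cc x) q g -> Phi y (fun z => u * g z).
have BP y2 p2 g2 : dom (cc x) y2 -> 0 < p2.1 -> cc x y2 = cone (angle x) p2 ->
    dev x (cc x) p2 g2 -> B p2 <-> Phi y2 (fun z => u * g2 z).
  move=> dy2 p20 cy2 hd2; split=> [|h y3 g3 dy3 cy3 hd3]; first exact.
  have e : y3 = y2.
    by apply: (chart_inj (cone_is_chart (hcc x)) dy3 dy2); rewrite cy3.
  rewrite e in dy3 cy3 *.
  apply: (red_translate (b := 0) (hPhi (cone_point_regular dy2 p20 cy2)) h).
  by apply: filterS (dev_eq (hcc x) dy2 p20 cy2 hd3 hd2) => z ->; rewrite addr0.
apply/(BP y' q g' dy' q0 cy' hd').
apply: (@locconst_rectangle R (rr x) B p q); last exact/(BP y p g).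
- move=> p1 /andP[p10 p1r].
  have [y1 [dy1 cy1]] := @cone_point _ _ _ _ _ (hcc x) p1 (ltac:(by rewrite ltW)).
  have [g1 [hg1 hd1]] := dev_exists (hcc x) dy1 p10 cy1.
  have ry1 := cone_point_regular dy1 p10 cy1.
  have hl := cone_point_near (hcc x) dy1 cy1
    (red_local (hPhi ry1) (germ_scale hg1 u1)).
  have hr : \forall q \near p1, 0 < q.1 < rr x by apply: near_annulus; rewrite p10.
  apply: filterS2 (filterI hl hr) (dev_near hd1) => p2 [hl2 /andP[p20 p2r]] hd2.
  have [y2 [dy2 cy2]] := @cone_point _ _ _ _ _ (hcc x) p2 (ltac:(by rewrite ltW)).
  rewrite (BP y2 p2 g1 dy2 p20 cy2 hd2) (BP y1 p1 g1 dy1 p10 cy1 hd1).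
  exact: hl2.
- by rewrite p0 (cone_coord_lt (hcc x) dy (ltW p0) cy).
- by rewrite q0 (cone_coord_lt (hcc x) dy' (ltW q0) cy').
Qed.

Lemma rotations_norm x u : rotations x u -> `|u| = 1.
Proof.
have [y [p [g [/andP[p0 _] dy cy hd hg]]]] := cone_sample x.
move=> /(_ y p g dy p0 cy hd) h; apply: germ_scale_norm hg _.
exact (red_germ (hPhi (cone_point_regular dy p0 cy)) h).
Qed.

Lemma rotations_finite x : finite_set (rotations x).
Proof.
have [y [p [g [/andP[p0 _] dy cy hd hg]]]] := cone_sample x.
apply: sub_finite_set (red_finite_germ (hPhi (cone_point_regular dy p0 cy)) hg).
by move=> u /(_ y p g dy p0 cy hd).
Qed.

Lemma rotations_ex x : exists u, rotations x u.
Proof.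
have [y [p [g [/andP[p0 _] dy cy hd hg]]]] := cone_sample x.
have [u [_ h]] := red_rotate (hPhi (cone_point_regular dy p0 cy)) hg.
by exists u; exact: rotationsP hd h.
Qed.

(** [rotations] quantifies over all lifts, including those shifted by [j] turns, where [dev_rotate]
    multiplies the branch by the corresponding rotation. *)
Lemma rotations_rot x u (j : int) : rotations x u -> rotations x (rot x j * u).
Proof.
have [y [p [g [/andP[p0 _] dy cy hd hg]]]] := cone_sample x.
have tn : angle x != 0 by rewrite gt_eqF// angle_gt0.
move=> /(_ y (p.1, p.2 + angle x * j%:~R) _ dy p0 _ (dev_rotate j hd)) h.
apply: (rotationsP dy p0 cy hd).
apply: (red_translate (b := 0) (hPhi (cone_point_regular dy p0 cy)) (h _)).
  by rewrite coneD.
by apply: filterE => z; rewrite addr0 mulrA (mulrC (rot x j)).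
Qed.

(** For cone angle 2 pi the chart [cc y] is its own developing map at every lift. Local constancy
    then carries the condition between nearby points and the centre, which [rotations] does not
    test. *)
Lemma regular_rotations y v : regular y ->
  rotations y v <-> Phi y (fun z => v * cc y z).
Proof.
move=> ry; have hg := cone_germ ry (hcc y).
have e : angle y = 2 * pi by [].
have hdev p : dev y (cc y) p (cc y).
  by apply: filterE => q y' _ ->; rewrite e cone2pi.
have near_dom := chart_dom_near (cone_is_chart (hcc y)) (cone_center (hcc y)).
have pick (P : S -> Prop) : (\forall y' \near y, P y') ->
    exists y' p, [/\ P y', dom (cc y) y', 0 < p.1 & cc y y' = cone (angle y) p].
  move=> hP; apply: contrapT => nex; apply: (@not_isolated _ _ y).
  apply: filterS2 hP near_dom => y' Py' dy'; apply: contrapT => /eqP yy'.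
  have [p [/andP[p0 _] cp]] := cone_coord_neq (hcc y) dy' yy'.
  by apply: nex; exists y', p.
split=> [hv|hv].
  have v1 := rotations_norm hv.
  have [y' [p [hl dy' p0 cy']]] := pick _ (red_local (hPhi ry) (germ_scale hg v1)).
  by apply/hl; exact: hv (hdev p).
have v1 := germ_scale_norm hg (red_germ (hPhi ry) hv).
have [y' [p [hl dy' p0 cy']]] := pick _ (red_local (hPhi ry) (germ_scale hg v1)).
by apply: (rotationsP dy' p0 cy' (hdev p)); exact/hl.
Qed.

Lemma rotX x n : polar 1 (angle x) ^+ n = rot x n.
Proof. by rewrite polarX expr1n -mulr_natr. Qed.

(** Multiplication by exp(i theta) preserves a nonempty finite set of nonzero numbers, so two of its
    powers coincide. *)
Lemma rot_order x : exists k, k.-primitive_root (polar 1 (angle x) : plane R).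
Proof.
have [u hu] := rotations_ex x.
have un : u != 0 := norm1_neq0 (rotations_norm hu).
pose f (n : nat) : plane R := polar 1 (angle x) ^+ n * u.
have fU n : rotations x (f n) by rewrite /f rotX; exact: rotations_rot.
have [inj|ninj] := pselect (injective f).
  exfalso; have : finite_set [set: nat].
    have := @finite_preimage _ _ (rotations x) f (in2W inj) (rotations_finite x).
    by apply: sub_finite_set => n _; exact: fU.
  exact: infinite_nat.
have [n [m [nm fnm]]] : exists n m, (n < m)%N /\ f n = f m.
  apply: contrapT => nex; apply: ninj => n m fnm.
  have [h|h|//] := ltngtP n m; exfalso; apply: nex.
    by exists n, m.
  by exists m, n.
have en : (polar 1 (angle x) : plane R) != 0 by apply: polar_neq0.
have h : (polar 1 (angle x) : plane R) ^+ (m - n) = 1.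
  move: fnm => /(mulIf un); rewrite -{1}(subnK (ltnW nm)) exprD.
  rewrite -[LHS]mul1r => /(mulIf (expf_neq0 _ en)) <-.
  by [].
have [k hk _] := prim_order_exists (ltac:(by rewrite subn_gt0) : (0 < m - n)%N) h.
by exists k.
Qed.

(** * Order of the cone rotation and the angle upstairs *)

Variable kk : S -> nat.
Hypothesis hkk : forall x, (kk x).-primitive_root (polar 1 (angle x) : plane R).

Lemma kk_gt0 x : (0 < kk x)%N. Proof. exact: prim_order_gt0 (hkk x). Qed.

(** The angle after which a branch closes up, a multiple of 2 pi by the choice of [kk x]. It equals
    2 pi at every regular [x], and possibly at a singular one. *)
Definition total_angle x : R := (kk x)%:R * angle x.
Local Notation Theta := total_angle.

Lemma total_angle_gt0 x : 0 < Theta x.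
Proof. by rewrite mulr_gt0 ?angle_gt0// ltr0n kk_gt0. Qed.

Lemma regular_kk y : regular y -> kk y = 1%N.
Proof.
move=> ry; have e : angle y = 2 * pi by [].
have := prim_order_dvd (hkk y) 1; rewrite expr1 e.
have -> : (polar 1 (2 * pi) : plane R) = 1.
  by have := polarDpi (1 : R) 0 1; rewrite add0r mulr1 polar00.
by rewrite eqxx dvdn1 => /eqP.
Qed.

Lemma regular_total_angle y : regular y -> Theta y = 2 * pi.
Proof. by move=> ry; rewrite /total_angle regular_kk// mul1r. Qed.

Lemma rot_period x (j : int) : polar 1 (Theta x * j%:~R) = 1 :> plane R.
Proof.
have := prim_expr_order (hkk x); rewrite rotX -polar00 => /esym.
move=> /(polar_inj ltr01 ltr01)[_ [i hi]].
have -> : Theta x * j%:~R = 0 + 2 * pi * (i * j)%:~R :> R.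
  rewrite add0r intrM mulrA; congr (_ * _).
  by move: hi; rewrite add0r /total_angle mulrC.
by rewrite polarDpi.
Qed.

Lemma rotations_pow x u v : rotations x u -> rotations x v ->
  u ^+ kk x = v ^+ kk x -> exists j : nat, v = rot x j * u.
Proof.
move=> hu hv e; have un := norm1_neq0 (rotations_norm hu).
have : (v / u) ^+ kk x = 1 by rewrite exprMn exprVn -e divff// expf_neq0.
move=> /(prim_rootP (hkk x))[j hj]; exists j.
by rewrite -rotX -hj divfK.
Qed.

Lemma rot_eq1 x (j : int) : rot x j = 1 -> exists l : int, j = (kk x)%:Z * l.
Proof.
have pos (n : nat) : rot x n = 1 -> exists l : int, n%:Z = (kk x)%:Z * l.
  rewrite -rotX => /eqP; rewrite -(prim_order_dvd (hkk x)) => /dvdnP[l ->].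
  by exists l; rewrite PoszM mulrC.
case: j => n; first exact: pos.
rewrite NegzE => h.
have : rot x (- n.+1%:Z) * rot x n.+1 = 1.
  by rewrite polarM mulr1 -mulrDr -intrD addNr mulr0 polar00.
by rewrite h mul1r => /pos[l ->]; exists (- l); rewrite mulrN.
Qed.

Lemma rot_pow x (j : int) : (rot x j) ^+ kk x = 1.
Proof.
rewrite polarX expr1n -mulr_natl mulrA; exact: rot_period.
Qed.

(** The [kk]-th power is a complete invariant of the orbit of [u] under exp(i theta), by
    [rotations_pow]. Recording it gives a subset of S x C in place of a quotient, with plain
    equality of pairs. *)
Definition cover := {q : S * plane R |
  exists u, rotations q.1 u /\ q.2 = u ^+ kk q.1}.

HB.instance Definition _ := gen_eqMixin cover.
HB.instance Definition _ := gen_choiceMixin cover.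

Lemma cover_inj (q q' : cover) : sval q = sval q' -> q = q'.
Proof.
case: q q' => [q hq] [q' hq'] /= e; rewrite e in hq *.
by congr exist; exact: Prop_irrelevance.
Qed.

Variable q0 : cover.

(** [q0] is only a junk value for [u] outside [rotations x]; it spares a membership proof as an
    argument. *)
Definition mk x u : cover := match pselect (rotations x u) with
  | left h => exist (fun q : S * plane R => exists u, rotations q.1 u /\ q.2 = u ^+ kk q.1)
      (x, u ^+ kk x) (ex_intro _ u (conj h erefl))
  | right _ => q0 end.

Definition proj (q : cover) : S := (sval q).1.

Lemma val_mk x u : rotations x u -> sval (mk x u) = (x, u ^+ kk x).
Proof. by rewrite /mk; case: pselect. Qed.

Lemma proj_mk x u : rotations x u -> proj (mk x u) = x.
Proof. by rewrite /proj => /val_mk ->. Qed.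

Lemma mk_eq x u v : rotations x u -> rotations x v ->
  mk x u = mk x v <-> u ^+ kk x = v ^+ kk x.
Proof.
move=> hu hv; split=> [e|e].
  by have := congr1 sval e; rewrite !val_mk// => -[].
by apply: cover_inj; rewrite !val_mk// e.
Qed.

Lemma mk_surj (q : cover) : exists u, rotations (proj q) u /\ q = mk (proj q) u.
Proof.
have [u [hu e]] := svalP q; exists u; split=> //.
by apply: cover_inj; rewrite val_mk// /proj -e; case: (sval q).
Qed.

Lemma mk_rot x u v : rotations x u -> rotations x v -> mk x u = mk x v ->
  exists j : nat, v = rot x j * u.
Proof. by move=> hu hv /mk_eq => /(_ hu hv); exact: rotations_pow. Qed.

(** The linear part of [g] relative to the cone chart at [y], with the translation discarded; 0 is a
    junk value for functions that have none. *)
Definition coef y g : plane R :=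
  xget 0 [set v | exists b, \forall y' \near y, g y' = v * cc y y' + b].

Lemma coef_eq y g v b : germ y g ->
  (\forall y' \near y, g y' = v * cc y y' + b) -> coef y g = v.
Proof.
move=> hg h; have hc := cone_germ (germ_regular hg) (hcc y).
rewrite /coef; case: xgetP => [v' _ [b' h']|/(_ v)]; last by case; exists b.
have e : \forall y' \near y, v' * cc y y' + b' = v * cc y y' + b.
  by apply: filterS2 h h' => z -> ->.
by have [] := germ_transition_uniq hc e.
Qed.

Lemma coefP y g : germ y g ->
  `|coef y g| = 1 /\ exists b, \forall y' \near y, g y' = coef y g * cc y y' + b.
Proof.
move=> hg; have hc := cone_germ (germ_regular hg) (hcc y).
have [a [b [a1 h]]] := germ_transition hc hg.
by rewrite (coef_eq hg h); split=> //; exists b.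
Qed.

Lemma coef_rotations y g : regular y -> Phi y g -> rotations y (coef y g).
Proof.
move=> ry h; apply/(regular_rotations _ ry).
have [_ [b hb]] := coefP (red_germ (hPhi ry) h).
apply: (red_translate (b := - b) (hPhi ry) h).
by apply: filterS hb => z ->; rewrite addrK.
Qed.

Lemma coef_scale y g a : germ y g -> `|a| = 1 ->
  coef y (fun z => a * g z) = a * coef y g.
Proof.
move=> hg a1; have [_ [b hb]] := coefP hg.
apply: (coef_eq (b := a * b) (germ_scale hg a1)).
by apply: filterS hb => z ->; rewrite mulrDr mulrA.
Qed.

(* The point of the cover above the regular point [y] at which [g] is the
   preferred chart. *)
Definition pt y g : cover := mk y (coef y g).

Lemma proj_pt y g : regular y -> Phi y g -> proj (pt y g) = y.
Proof. by move=> ry h; rewrite proj_mk//; exact: coef_rotations. Qed.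

Lemma pt_translate y g g' b : germ y g ->
  (\forall y' \near y, g' y' = g y' + b) -> pt y g' = pt y g.
Proof.
move=> hg e; have [_ [b' hb]] := coefP hg; rewrite /pt; congr mk.
have hg' : germ y g'.
  by apply: (germ_affine hg (normr1 _)); apply: filterS e => z ->; rewrite mul1r.
apply: (coef_eq (b := b' + b) hg').
by apply: filterS2 e hb => z -> ->; rewrite addrA.
Qed.

Lemma pt_inj y g g' : regular y -> Phi y g -> Phi y g' -> pt y g = pt y g' ->
  exists b, \forall y' \near y, g' y' = g y' + b.
Proof.
move=> ry h h'; rewrite /pt (mk_eq (coef_rotations ry h) (coef_rotations ry h')).
rewrite regular_kk// !expr1 => e.
have [_ [b hb]] := coefP (red_germ (hPhi ry) h).
have [_ [b' hb']] := coefP (red_germ (hPhi ry) h').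
exists (b' - b); apply: filterS2 hb hb' => z -> ->; rewrite e; ring.
Qed.

Lemma mk_pt y v : regular y -> rotations y v ->
  mk y v = pt y (fun z => v * cc y z).
Proof.
move=> ry hv; have hc := cone_germ ry (hcc y).
rewrite /pt (coef_eq (v := v) (b := 0)) //.
  by apply: germ_scale hc _; exact: rotations_norm hv.
by apply: filterE => z; rewrite addr0.
Qed.

Lemma pt_surj (q : cover) : regular (proj q) ->
  exists g, Phi (proj q) g /\ q = pt (proj q) g.
Proof.
move=> rq; have [u [hu e]] := mk_surj q.
exists (fun z => u * cc (proj q) z); split; last by rewrite -mk_pt.
exact/(regular_rotations _ rq).
Qed.

(** * Polar sheets of the cover *)

Definition point x p : S :=
  xget x [set y | dom (cc x) y /\ cc x y = cone (angle x) p].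

Lemma pointP x p : 0 <= p.1 < rr x ->
  dom (cc x) (point x p) /\ cc x (point x p) = cone (angle x) p.
Proof.
move=> /(cone_point (hcc x))[y hy]; rewrite /point.
by case: xgetP => [y' _ //|/(_ y)].
Qed.

Lemma point_eq x y p : dom (cc x) y -> 0 <= p.1 ->
  cc x y = cone (angle x) p -> point x p = y.
Proof.
move=> dy p0 cy; have pr := cone_coord_lt (hcc x) dy p0 cy.
have [dp cp] := @pointP x p (ltac:(by rewrite p0)).
by apply: (chart_inj (cone_is_chart (hcc x)) dp dy); rewrite cp.
Qed.

Lemma point_regular x p : 0 < p.1 < rr x -> regular (point x p).
Proof.
move=> /andP[p0 pr]; have [dp cp] := @pointP x p (ltac:(by rewrite ltW)).
exact: cone_point_regular dp p0 cp.
Qed.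

Lemma point_neq x p : 0 < p.1 < rr x -> point x p != x.
Proof.
move=> /andP[p0 pr]; have [dp cp] := @pointP x p (ltac:(by rewrite ltW)).
exact (cone_neq_center (hcc x) p0 cp).
Qed.

Definition devg x p : S -> plane R := xget (fun=> 0) [set g | dev x (cc x) p g].

Lemma devgP x p : 0 < p.1 < rr x ->
  dev x (cc x) p (devg x p) /\ germ (point x p) (devg x p).
Proof.
move=> /andP[p0 pr]; have [dp cp] := @pointP x p (ltac:(by rewrite ltW)).
have [g [hg hd]] := dev_exists (hcc x) dp p0 cp.
have hd' : dev x (cc x) p (devg x p).
  by rewrite /devg; case: xgetP => [g' _ //|/(_ g)].
by split=> //; exact (dev_germ (hcc x) dp p0 cp hd').
Qed.

(* Polar coordinates on the sheet through [mk x u]; it has [kk x] times the cone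
   angle of [x]. *)
Definition sheet x u p : cover :=
  if p.1 == 0 then mk x u else pt (point x p) (fun z => u * devg x p z).

Lemma sheet0 x u p : p.1 = 0 -> sheet x u p = mk x u.
Proof. by rewrite /sheet => ->; rewrite eqxx. Qed.

Lemma sheet_pt x u y p g : rotations x u -> dom (cc x) y -> 0 < p.1 ->
  cc x y = cone (angle x) p -> dev x (cc x) p g ->
  [/\ regular y, Phi y (fun z => u * g z) &
      sheet x u p = pt y (fun z => u * g z)].
Proof.
move=> hu dy p0 cy hd; split.
- exact: cone_point_regular dy p0 cy.
- exact: hu dy p0 cy hd.
have p0r : 0 < p.1 < rr x by rewrite p0 (cone_coord_lt (hcc x) dy (ltW p0)).
rewrite /sheet gt_eqF// (point_eq dy (ltW p0) cy).
apply: (pt_translate (b := 0)).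
  apply: germ_scale (rotations_norm hu).
  exact (dev_germ (hcc x) dy p0 cy hd).
apply: filterS (dev_eq (hcc x) dy p0 cy (proj1 (devgP p0r)) hd) => z ->.
by rewrite addr0.
Qed.

Lemma proj_sheet x u p : rotations x u -> 0 <= p.1 < rr x ->
  proj (sheet x u p) = point x p.
Proof.
move=> hu /andP[p0 pr]; have [dp cp] := @pointP x p (ltac:(by rewrite p0)).
move: p0; rewrite le_eqVlt => /orP[/eqP p0|p0].
  rewrite sheet0// proj_mk//; apply/esym/point_eq; rewrite ?p0//.
    exact: cone_center (hcc x).
  by rewrite (cone_center0 (hcc x)); case: (p) p0 => ? ? /= <-; rewrite cone0.
have [hd hg] := devgP (ltac:(by rewrite p0) : 0 < p.1 < rr x).
have [rp hP ->] := sheet_pt hu dp p0 cp hd.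
exact: proj_pt.
Qed.

Lemma sheet_rot x u p (j : int) : rotations x u -> 0 <= p.1 < rr x ->
  sheet x (rot x j * u) p = sheet x u (p.1, p.2 + angle x * j%:~R).
Proof.
move=> hu /andP[p0 pr]; have [dp cp] := @pointP x p (ltac:(by rewrite p0)).
have hu' := rotations_rot j hu.
move: p0; rewrite le_eqVlt => /orP[/eqP p0|p0].
  rewrite !sheet0//=; apply/mk_eq => //.
  by rewrite exprMn rot_pow mul1r.
have [hd hg] := devgP (ltac:(by rewrite p0) : 0 < p.1 < rr x).
have [_ _ ->] := sheet_pt hu' dp p0 cp hd.
have cp' : cc x (point x p) = cone (angle x) (p.1, p.2 + angle x * j%:~R).
  by rewrite coneD// gt_eqF// angle_gt0.
have [_ _ ->] := sheet_pt (p := (p.1, p.2 + angle x * j%:~R)) hu dp p0 cp'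
  (dev_rotate j hd).
by congr pt; apply/funext => z; rewrite mulrA (mulrC u).
Qed.

Lemma sheet_period x u p (j : int) : rotations x u -> 0 <= p.1 < rr x ->
  sheet x u (p.1, p.2 + Theta x * j%:~R) = sheet x u p.
Proof.
move=> hu hp; have := sheet_rot ((kk x)%:Z * j) hu hp.
have -> : angle x * ((kk x)%:Z * j)%:~R = Theta x * j%:~R :> R.
  by rewrite intrM mulrA /total_angle (mulrC (angle x)).
by rewrite rot_period mul1r => <-.
Qed.

(** Equal points project to the same point, so the lifts differ by [j] turns; equality of the
    preferred charts then turns [u] into [v] by the opposite rotation. At the apex the angle carries
    no information, hence the guard on the last clause. *)
Lemma sheet_inj x u v p q : rotations x u -> rotations x v ->
  0 <= p.1 < rr x -> 0 <= q.1 < rr x -> sheet x u p = sheet x v q ->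
  p.1 = q.1 /\ exists j : int, v = rot x (- j) * u /\
    (0 < p.1 -> q = (p.1, p.2 + angle x * j%:~R)).
Proof.
move=> hu hv hp hq e; have tn : angle x != 0 by rewrite gt_eqF// angle_gt0.
have ep : point x p = point x q by rewrite -(proj_sheet hu hp) e proj_sheet.
have [dp cp] := pointP hp; have [dq cq] := pointP hq.
have e1 : p.1 = q.1.
  apply: (@complexI R).
  rewrite -(normr_cone (angle x) (proj1 (andP hp))).
  by rewrite -(normr_cone (angle x) (proj1 (andP hq))) -cp -cq ep.
split=> //; case/andP: (hp) => p0 pr; case/andP: (hq) => q0' qr.
move: p0; rewrite le_eqVlt => /orP[/eqP p0|p0].
  have [j hj] : exists j : nat, v = rot x j * u.
    by apply: (mk_rot hu hv); move: e; rewrite !sheet0 -?e1.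
  by exists (- j%:Z); rewrite opprK -p0 ltxx.
have qp : 0 < q.1 by rewrite -e1.
have [hd hg] := devgP (ltac:(by rewrite p0) : 0 < p.1 < rr x).
have [hd' hg'] := devgP (ltac:(by rewrite qp) : 0 < q.1 < rr x).
rewrite -ep in hg' dq cq.
have [ry hP e2] := sheet_pt hu dp p0 cp hd.
have [_ hP' e3] := sheet_pt hv dq qp cq hd'.
move: e; rewrite e2 e3 => /(pt_inj ry hP hP')[b hb].
have [i [ei hi]] := dev_rotate_eq (hcc x) dp p0 qp cp cq hd hd'.
have vu : v * rot x i = u.
  have hh : \forall y' \near point x p,
      (v * rot x i) * devg x p y' + 0 = u * devg x p y' + b.
    by apply: filterS2 hb hi => z hz hz'; rewrite addr0 -mulrA -hz'.
  by have [] := germ_transition_uniq hg hh.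
exists i; split=> //.
rewrite -vu mulrCA polarM mulr1 -mulrDr -intrD addNr mulr0 polar00 mulr1 //.
Qed.

Definition polar_coord x (z : plane R) : R * R :=
  xget (0, 0) [set p | 0 <= p.1 /\ z = cone (Theta x) p].

Lemma polar_coordP x z : 0 <= (polar_coord x z).1 /\
  z = cone (Theta x) (polar_coord x z).
Proof.
have [p [p0 hp _]] := @cone_surj R (Theta x) z
  (ltac:(by rewrite gt_eqF// total_angle_gt0)).
by rewrite /polar_coord; case: xgetP => [q _ //|/(_ p)]; case.
Qed.

(** The same sheet as a function on a disc. The arbitrary choice made by [polar_coord] is harmless
    because sheets have period [Theta x]. *)
Definition sheetd x u (z : plane R) : cover := sheet x u (polar_coord x z).

Lemma sheetd_cone x u p : rotations x u -> 0 <= p.1 < rr x ->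
  sheetd x u (cone (Theta x) p) = sheet x u p.
Proof.
move=> hu hp; have [c0 hc] := polar_coordP x (cone (Theta x) p).
rewrite /sheetd; set q := polar_coord x _ in c0 hc *.
have e : q.1 = p.1.
  apply: (@complexI R).
  by rewrite -(normr_cone (Theta x) c0) -hc normr_cone//; case/andP: hp.
case/andP: (hp); rewrite le_eqVlt => /orP[/eqP p0 _|p0 pr].
  by rewrite !sheet0// e.
have [j ->] : exists j : int, q = (p.1, p.2 + Theta x * j%:~R).
  by apply: cone_inj => //; rewrite ?e// gt_eqF// total_angle_gt0.
exact: sheet_period.
Qed.

Lemma disc_cone x (z : plane R) : `|z| < (rr x)%:C ->
  exists p, 0 <= p.1 < rr x /\ z = cone (Theta x) p.
Proof.
move=> hz; have [p0 hp] := polar_coordP x z; exists (polar_coord x z).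
by split=> //; rewrite p0 -ltcR -(normr_cone (Theta x) p0) -hp.
Qed.

Lemma sheetd0 x u : rotations x u -> sheetd x u 0 = mk x u.
Proof.
move=> hu; rewrite -(cone0 (Theta x) 0) sheetd_cone//= ?sheet0//.
by rewrite lexx (cone_radius_gt0 (hcc x)).
Qed.

(** Two lifts on one sheet give the same point only if [j] turns act trivially. As the order is
    exactly [kk x], [j] is a multiple of it, and the two lifts have the same disc coordinate. *)
Lemma sheetd_inj x u z z' : rotations x u ->
  `|z| < (rr x)%:C -> `|z'| < (rr x)%:C -> sheetd x u z = sheetd x u z' -> z = z'.
Proof.
move=> hu /disc_cone[p [hp ->]] /disc_cone[q [hq ->]].
rewrite !sheetd_cone// => /(sheet_inj hu hu hp hq)[e [j [ej hj]]].
case/andP: (hp); rewrite le_eqVlt => /orP[/eqP p0 _|p0 pr].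
  by rewrite [p]surjective_pairing [q]surjective_pairing -e -p0 !cone0.
have un := norm1_neq0 (rotations_norm hu).
have : rot x (- j) = 1 by apply: (mulIf un); rewrite -ej mul1r.
move=> /rot_eq1[l hl]; rewrite (hj p0).
have -> : angle x * j%:~R = Theta x * (- l)%:~R.
  by rewrite -[j]opprK hl -mulrN intrM mulrA /total_angle (mulrC (angle x)).
by rewrite coneD// gt_eqF// total_angle_gt0.
Qed.

(** * Sheets near regular points and the topology of the cover *)

Lemma near_sheet x u y p g : rotations x u -> dom (cc x) y -> 0 < p.1 ->
  cc x y = cone (angle x) p -> dev x (cc x) p g ->
  \forall q \near p, forall y', dom (cc x) y' -> cc x y' = cone (angle x) q ->
    sheet x u q = pt y' (fun z => u * g z).
Proof.
move=> hu dy p0 cy hd.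
apply: filterS2 (near_gt0 p0) (dev_near hd) => q q0' hq y' dy' cy'.
by have [_ _ ->] := sheet_pt hu dy' q0' cy' hq.
Qed.

Lemma regular_sheet y v y' p : regular y -> rotations y v ->
  dom (cc y) y' -> 0 < p.1 -> cc y y' = cone (angle y) p ->
  sheet y v p = pt y' (fun z => v * cc y z).
Proof.
move=> ry hv dy' p0 cy'.
have e : angle y = 2 * pi by [].
have hdev : dev y (cc y) p (cc y).
  by apply: filterE => q y2 _ ->; rewrite e cone2pi.
by have [_ _ ->] := sheet_pt hv dy' p0 cy' hdev.
Qed.

Lemma near_pt_coef y g : regular y -> Phi y g ->
  \forall y' \near y, pt y' g = pt y' (fun z => coef y g * cc y z).
Proof.
move=> ry h; have hg := red_germ (hPhi ry) h.
have [v1 [b hb]] := coefP hg.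
have hc := cone_germ ry (hcc y).
apply: filterS2 (near_join hb) (germ_near (germ_scale hc v1)) => y' hb' hg'.
exact: pt_translate hg' hb'.
Qed.

Lemma near_Phi y g : regular y -> Phi y g -> \forall y' \near y, regular y' /\ Phi y' g.
Proof.
move=> ry h; have hg := red_germ (hPhi ry) h.
apply: filterS2 (germ_near hg) (red_local (hPhi ry) hg) => y' hg' hl.
by split; [exact: germ_regular hg'|exact/hl].
Qed.

(** Every point of the cover is the centre [mk x u] of some sheet, so small sheet discs can be
    declared a neighbourhood basis. That these discs are themselves open is then a theorem,
    [sheetd_open]. *)
Definition opens (O : set cover) := forall x u, rotations x u -> O (mk x u) ->
  exists2 e, 0 < e <= rr x & forall p, 0 < p.1 < e -> O (sheet x u p).

Lemma opens_pt O y g : opens O -> regular y -> Phi y g -> O (pt y g) ->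
  \forall y' \near y, O (pt y' g).
Proof.
move=> hO ry h Opt; have hv := coef_rotations ry h.
have [e /andP[e0 er] he] := hO _ _ hv Opt.
have : \forall y' \near y, O (pt y' (fun z => coef y g * cc y z)).
  apply/(cone_near_center (hcc y)); exists e; rewrite ?e0// => y' p /andP[p0 pe] dy' cy'.
  move: p0; rewrite le_eqVlt => /orP[/eqP p0|p0].
    have -> : y' = y.
      apply: (chart_inj (cone_is_chart (hcc y)) dy' (cone_center (hcc y))).
      by rewrite cy' (cone_center0 (hcc y)) [p]surjective_pairing -p0 cone0.
    by rewrite -mk_pt.
  by rewrite -(regular_sheet ry hv dy' p0 cy'); apply: he; rewrite p0.
by apply: filterS2 (near_pt_coef ry h) => y' ->.
Qed.

Lemma opens_sheet O x u p : opens O -> rotations x u -> 0 < p.1 < rr x ->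
  O (sheet x u p) -> \forall q \near p, O (sheet x u q).
Proof.
move=> hO hu hp; have [p0 pr] := andP hp.
have [dp cp] := @pointP x p (ltac:(by rewrite ltW)).
have [hd hg] := devgP hp.
have [ry hP ->] := sheet_pt hu dp p0 cp hd.
move=> /(opens_pt hO ry hP) /(cone_point_near (hcc x) dp cp) h1.
apply: filterS2 (filterI h1 (near_annulus hp)) (near_sheet hu dp p0 cp hd).
move=> q [hq /andP[q0' qr]] hs.
have [dq cq] := @pointP x q (ltac:(by rewrite ltW)).
by rewrite (hs _ dq cq); exact: hq.
Qed.

Lemma sheetd_continuous O x u z0 : opens O -> rotations x u ->
  `|z0| < (rr x)%:C -> O (sheetd x u z0) -> \forall z \near z0, O (sheetd x u z).
Proof.
move=> hO hu /disc_cone[p [hp ->]]; rewrite sheetd_cone// => Op.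
have [/eqP p0|p0] := eqVneq p.1 0.
  rewrite sheet0 in Op; last exact/eqP.
  have [e /andP[e0 er] he] := hO _ _ hu Op.
  rewrite [p]surjective_pairing (eqP p0) cone0; apply/nbhs_planeP; exists e => // z.
  rewrite subr0 => ze.
  have [q [/andP[q0' qr] ez]] := @disc_cone x z (ltac:(by rewrite (lt_le_trans ze)// lecR)).
  rewrite ez sheetd_cone ?q0'//.
  move: q0'; rewrite le_eqVlt => /orP[/eqP q0'|q0']; first by rewrite sheet0.
  by apply: he; rewrite q0'/= -ltcR -(normr_cone (Theta x) (ltW q0')) -ez.
have {}p0 : 0 < p.1 by rewrite lt_neqAle eq_sym p0; case/andP: hp.
have hp' : 0 < p.1 < rr x by rewrite p0; case/andP: hp.
have hq : \forall q \near p, O (sheet x u q) /\ 0 < q.1 < rr x.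
  by apply: filterS2 (opens_sheet hO hu hp' Op) (near_annulus hp') => q; split.
apply: filterS (cone_open (total_angle_gt0 x) p0 hq) => z [q [Oq /andP[q0' qr]] ->].
by rewrite sheetd_cone// ltW.
Qed.

(** A noncentral point of a sheet lies over a regular [y] and has a sheet of its own. Near it both
    sheets consist of the points [pt y' g] for one and the same germ [g], so they agree. At the
    centre, another representative of the point merely turns the disc. *)
Lemma sheetd_open x u (V : set (plane R)) : rotations x u -> open V ->
  (forall z, V z -> `|z| < (rr x)%:C) -> opens (sheetd x u @` V).
Proof.
move=> hu oV Vr x1 u1 hu1 [z0 Vz0 e0].
have [p [hp ez]] := disc_cone (Vr _ Vz0).
have nV : \forall z \near z0, V z by apply: open_nbhs_nbhs.
rewrite ez sheetd_cone// in e0.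
have [p0|p0] := eqVneq p.1 0.
  rewrite sheet0// in e0.
  have ex : x1 = x by rewrite -(proj_mk hu1) -e0 proj_mk.
  rewrite ex in hu1 e0 *.
  have [j hj] := mk_rot hu hu1 e0.
  rewrite ez [p]surjective_pairing p0 cone0 in nV.
  have /nbhs_planeP[e ee he] := nV.
  exists (Num.min e (rr x)).
    by rewrite lt_min ee (cone_radius_gt0 (hcc x)) ge_min lexx orbT.
  move=> q /andP[q0']; rewrite lt_min => /andP[qe qr].
  have hq : 0 <= q.1 < rr x by rewrite ltW.
  rewrite hj sheet_rot// -sheetd_cone//; apply: imageP; apply: he.
  by rewrite subr0 normr_cone ?ltcR//= ltW.
have {}p0 : 0 < p.1 by rewrite lt_neqAle eq_sym p0; case/andP: hp.
have hp' : 0 < p.1 < rr x by rewrite p0; case/andP: hp.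
have [dp cp] := pointP hp; have [hd hg] := devgP hp'.
set y := point x p in dp cp hg; set g := devg x p in hd hg.
have [ry hP ep] := sheet_pt hu dp p0 cp hd; rewrite ep in e0.
have ex : x1 = y by rewrite -(proj_mk hu1) -e0 proj_pt.
rewrite ex in hu1 e0 *.
have hcf := coef_rotations ry hP.
have eu : u1 = coef y (fun z => u * g z).
  by move/esym: e0; rewrite (mk_eq hu1 hcf) regular_kk// !expr1.
have nq : \forall q \near p, [/\ V (cone (Theta x) q), 0 < q.1 < rr x &
    forall y', dom (cc x) y' -> cc x y' = cone (angle x) q ->
      sheet x u q = pt y' (fun z => u * g z)].
  have h1 : \forall q \near p, V (cone (Theta x) q).
    by apply: cone_near; rewrite -ez.
  apply: filterS2 (filterI h1 (near_annulus hp')) (near_sheet hu dp p0 cp hd).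
  by move=> q [].
have ny := cone_near_point (hcc x) dp p0 cp nq.
have ny2 : \forall y' \near y,
    (sheetd x u @` V) (pt y' (fun z => u1 * cc y z)).
  apply: filterS2 ny (near_pt_coef ry hP) => y' [dy' [q [Vq hq hs] cq]].
  rewrite -eu => <-; rewrite -(hs y' dy' cq) -sheetd_cone//; last first.
    by case/andP: hq => q0' ->; rewrite ltW.
have [e he heP] := (cone_near_center (hcc y) _).1 ny2.
exists e => // q /andP[q0' qe].
have hq : 0 < q.1 < rr y by rewrite q0' (lt_le_trans qe)//; case/andP: he.
have [dq cq] := @pointP y q (ltac:(by case/andP: hq => /ltW ->)).
rewrite (regular_sheet ry hu1 dq q0' cq); apply: heP dq cq.
by rewrite ltW.
Qed.

Lemma opensT : opens setT.
Proof.
move=> x u hu _; exists (rr x) => //.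
by rewrite (cone_radius_gt0 (hcc x)) lexx.
Qed.

Lemma opensI : setI_closed opens.
Proof.
move=> A B hA hB x u hu [Ax Bx].
have [e1 /andP[e10 e1r] h1] := hA x u hu Ax.
have [e2 /andP[e20 e2r] h2] := hB x u hu Bx.
exists (Num.min e1 e2); first by rewrite lt_min e10 e20 ge_min e1r.
move=> p /andP[p0]; rewrite lt_min => /andP[pe1 pe2].
by split; [apply: h1; rewrite p0|apply: h2; rewrite p0].
Qed.

Lemma opens_bigU (I : Type) (f : I -> set cover) :
  (forall i, opens (f i)) -> opens (\bigcup_i f i).
Proof.
move=> hf x u hu [i _ fi]; have [e he h] := hf i x u hu fi.
by exists e => // p /h fp; exists i.
Qed.

HB.instance Definition _ :=
  isOpenTopological.Build cover opensT opensI opens_bigU.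

(** * Charts and flat structure of the cover *)

Definition sheet_chart x u : chart R cover :=
  Chart [set q : cover | exists z, `|z| < (rr x)%:C /\ q = sheetd x u z]
    (fun q : cover => xget 0 [set z | `|z| < (rr x)%:C /\ q = sheetd x u z]).

Lemma sheet_chartK x u z : rotations x u -> `|z| < (rr x)%:C ->
  dom (sheet_chart x u) (sheetd x u z) /\ sheet_chart x u (sheetd x u z) = z.
Proof.
move=> hu hz; split; first by exists z.
rewrite /sheet_chart /=; case: xgetP => [w _ [hw e]|/(_ z)]; last by case.
exact (sheetd_inj hu hw hz (esym e)).
Qed.

Lemma sheet_chart_cone x u p : rotations x u -> 0 <= p.1 < rr x ->
  dom (sheet_chart x u) (sheet x u p) /\
  sheet_chart x u (sheet x u p) = cone (Theta x) p.
Proof.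
move=> hu hp; rewrite -sheetd_cone//; apply: sheet_chartK => //.
by case/andP: hp => p0 pr; rewrite normr_cone// ltcR.
Qed.

Lemma sheet_chart_dom x u (q : cover) : rotations x u -> dom (sheet_chart x u) q ->
  exists p, 0 <= p.1 < rr x /\ q = sheet x u p.
Proof.
move=> hu [z [/disc_cone[p [hp ->]] ->]]; exists p.
by rewrite sheetd_cone.
Qed.

Lemma sheet_chart_center x u : rotations x u ->
  dom (sheet_chart x u) (mk x u) /\ sheet_chart x u (mk x u) = 0.
Proof.
move=> hu; have hr := cone_radius_gt0 (hcc x).
have := @sheet_chart_cone x u (0, 0) hu (ltac:(by rewrite /= lexx)).
by rewrite sheet0// cone0.
Qed.

Lemma sheet_chart_is_chart x u : rotations x u -> is_chart (sheet_chart x u).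
Proof.
move=> hu; split.
- have -> : dom (sheet_chart x u) = sheetd x u @` [set z | `|z| < (rr x)%:C].
    apply/seteqP; split=> [q [z [hz ->]]|q [z hz <-]]; first by exists z.
    by exists z.
  exact (sheetd_open hu (@open_disc R (rr x)) (fun z h => h)).
- move=> q q'; rewrite !inE => -[z [hz ->]] [z' [hz' ->]].
  have [_ e1] := sheet_chartK hu hz; have [_ e2] := sheet_chartK hu hz'.
  by move=> e; congr (sheetd x u _); rewrite -e1 e.
- move=> q [z [hz ->]] P; rewrite (proj2 (sheet_chartK hu hz)) => hP.
  have hN : \forall w \near z, P w /\ `|w| < (rr x)%:C.
    apply: filterI hP _; apply: open_nbhs_nbhs; split=> //; exact: open_disc.
  have [V [oV Vz] VP] : exists2 V : set (plane R), open V /\ V z &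
      forall w, V w -> P w /\ `|w| < (rr x)%:C.
    have : nbhs z (fun w => P w /\ `|w| < (rr x)%:C) by [].
    by rewrite nbhsE => -[V oV VP]; exists V.
  have oI := sheetd_open hu oV (fun w Vw => proj2 (VP w Vw)).
  have : nbhs (sheetd x u z : cover) (sheetd x u @` V).
    by apply: open_nbhs_nbhs; split=> //; exists z.
  apply: filterS => _ [w /VP[Pw hw] <-].
  by change (P (sheet_chart x u (sheetd x u w))); rewrite (proj2 (sheet_chartK hu hw)).
- move=> A oA Ad.
  rewrite openE => w [q Aq <-]; have [z [hz eq]] := Ad q Aq.
  rewrite eq (proj2 (sheet_chartK hu hz)) in Aq *.
  have hN : \forall w \near z, A (sheetd x u w) /\ `|w| < (rr x)%:C.
    apply: filterI; first exact: sheetd_continuous oA hu hz Aq.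
    by apply: open_nbhs_nbhs; split=> //; exact: open_disc.
  rewrite /interior; apply: filterS hN => v [Av hv]; exists (sheetd x u v) => //.
  exact (proj2 (sheet_chartK hu hv)).
Qed.

Lemma proj_sheetP x u p : rotations x u -> 0 <= p.1 < rr x ->
  [/\ dom (cc x) (proj (sheet x u p)),
      cc x (proj (sheet x u p)) = cone (angle x) p &
      (0 < p.1 -> regular (proj (sheet x u p)) /\ proj (sheet x u p) != x)].
Proof.
move=> hu hp; have [dp cp] := pointP hp; rewrite proj_sheet//; split=> // p0.
have hp' : 0 < p.1 < rr x by rewrite p0; case/andP: hp.
by split; [exact: point_regular|exact: point_neq].
Qed.

Lemma proj_continuous : continuous proj.
Proof.
move=> q P; have [u [hu eq]] := mk_surj q; set x := proj q in hu eq * => hP.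
have [e /andP[e0 er] he] := (cone_near_center (hcc x) P).1 hP.
have hz : `|0 : plane R| < e%:C by rewrite normr0 ltcR.
have oI := sheetd_open hu (@open_disc R e) (fun z (h : `|z| < e%:C) =>
  lt_le_trans h (ltac:(by rewrite lecR) : e%:C <= (rr x)%:C)).
have : nbhs (q : cover) (sheetd x u @` [set z | `|z| < e%:C]).
  by apply: open_nbhs_nbhs; split=> //; exists 0 => //; rewrite sheetd0.
apply: filterS => _ [z hz' <-] /=.
have [p [hp ez]] : exists p, 0 <= p.1 < rr x /\ z = cone (Theta x) p.
  by apply: disc_cone; apply: (lt_le_trans hz'); rewrite lecR.
rewrite ez sheetd_cone//; have [dp cp _] := proj_sheetP hu hp.
apply: he dp cp; case/andP: hp => p0 _; rewrite p0 -ltcR.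
by rewrite -(normr_cone (Theta x) p0) -ez.
Qed.

(** The factor [u] turns the sheet coordinate into the preferred chart of the points of the sheet,
    at least when the angle upstairs is 2 pi. *)
Definition cover_chart x u := chart_map (sheet_chart x u) (fun z => u * z).

Lemma cover_chartE x u (q : cover) : cover_chart x u q = u * sheet_chart x u q.
Proof. by []. Qed.

Lemma cover_chart_is_chart x u : rotations x u -> is_chart (cover_chart x u).
Proof.
move=> hu; apply: is_chart_scale; first exact: sheet_chart_is_chart.
exact: rotations_norm hu.
Qed.

(** Whatever sheet is used, the chart reads [g] up to translation near [pt y g]. This is the source
    of the translation atlas and of the isometry clause of the cone charts. *)
Lemma cover_chart_pt x u y g : rotations x u -> Theta x = 2 * pi ->
  regular y -> Phi y g -> dom (cover_chart x u) (pt y g) ->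
  exists b, \forall y' \near y, cover_chart x u (pt y' g) = g y' + b.
Proof.
move=> hu tx ry h [z [/disc_cone[p [hp ->]]]]; rewrite sheetd_cone// => e.
have [p0|p0] := eqVneq p.1 0.
  rewrite sheet0// in e.
  have yx : y = x by rewrite -(proj_pt ry h) e proj_mk.
  rewrite yx in ry h e *; have hv := coef_rotations ry h.
  have uv : coef x g = u.
    by move: e; rewrite /pt (mk_eq hv hu) regular_kk// !expr1.
  have [_ [b hb]] := coefP (red_germ (hPhi ry) h); rewrite uv in hb.
  have ex : angle x = 2 * pi by [].
  exists (- b).
  have hd := chart_dom_near (cone_is_chart (hcc x)) (cone_center (hcc x)).
  apply: filterS2 (filterI hb hd) (near_pt_coef ry h) => y' [hy' dy'] ->.
  rewrite uv hy' addrK cover_chartE.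
  have [q [hq cq]] := cone_coord (hcc x) dy'.
  have -> : pt y' (fun z => u * cc x z) = sheet x u q.
    case/andP: (hq); rewrite le_eqVlt => /orP[/eqP q0' _|q0' qr].
      rewrite sheet0//; have -> : y' = x.
        apply: (chart_inj (cone_is_chart (hcc x)) dy' (cone_center (hcc x))).
        by rewrite cq (cone_center0 (hcc x)) [q]surjective_pairing -q0' cone0.
      by rewrite -mk_pt.
    by rewrite (regular_sheet ry hu dy' q0' cq).
  rewrite (proj2 (sheet_chart_cone hu hq)) cq tx ex.
  by [].
have {}p0 : 0 < p.1 by rewrite lt_neqAle eq_sym p0; case/andP: hp.
have hp' : 0 < p.1 < rr x by rewrite p0; case/andP: hp.
have [dp cp] := pointP hp; have [hd hg] := devgP hp'.
have [_ hP ep] := sheet_pt hu dp p0 cp hd.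
have yp : y = point x p by rewrite -(proj_pt ry h) e proj_sheet.
rewrite -yp in dp cp hg hP ep; rewrite ep in e.
have [b hb] := pt_inj ry h hP e; exists b.
have hgp := red_germ (hPhi ry) h.
have nq : \forall q \near p, [/\ 0 < q.1 < rr x, dev x (cc x) q (devg x p) &
    forall y', dom (cc x) y' -> cc x y' = cone (angle x) q ->
      sheet x u q = pt y' (fun z => u * devg x p z)].
  apply: filterS2 (filterI (near_annulus hp') (dev_near hd)) (near_sheet hu dp p0 cp hd).
  by move=> q [].
have ny := cone_near_point (hcc x) dp p0 cp nq.
apply: filterS2 (filterI ny hb) (filterI (near_join hb) (germ_near hgp)).
move=> y' [[dy' [q [hq hdq hs] cq]] hb1] [hb' hg'].
have -> : pt y' g = sheet x u q.
  by rewrite (hs y' dy' cq) (pt_translate hg' hb').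
have hq' : 0 <= q.1 < rr x by case/andP: hq => /ltW ->.
rewrite cover_chartE (proj2 (sheet_chart_cone hu hq')) -hb1.
by rewrite tx cone2pi (dev_val hdq dy' cq).
Qed.

Lemma near_pt_image y g (P : S -> Prop) : regular y -> Phi y g ->
  (\forall y' \near y, P y') ->
  \forall q \near (pt y g : cover), exists2 y', P y' & q = pt y' g.
Proof.
move=> ry h hP; have hv := coef_rotations ry h; set v := coef y g in hv.
have [e /andP[e0 er] he] := (cone_near_center (hcc y) _).1 (filterI hP (near_pt_coef ry h)).
have oI := sheetd_open hv (@open_disc R e) (fun z (h : `|z| < e%:C) =>
  lt_le_trans h (ltac:(by rewrite lecR) : e%:C <= (rr y)%:C)).
have : nbhs (pt y g : cover) (sheetd y v @` [set z | `|z| < e%:C]).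
  apply: open_nbhs_nbhs; split=> //; exists 0; last by rewrite sheetd0.
  by rewrite /= normr0 ltcR.
apply: filterS => _ [z hz' <-] /=.
have [p [hp ez]] : exists p, 0 <= p.1 < rr y /\ z = cone (Theta y) p.
  by apply: disc_cone; apply: (lt_le_trans hz'); rewrite lecR.
have pe : 0 <= p.1 < e.
  case/andP: hp => p0 _; rewrite p0 -ltcR.
  by rewrite -(normr_cone (Theta y) p0) -ez.
have [dp cp] := pointP hp; have [Py' hpt] := he _ p pe dp cp.
exists (point y p) => //; rewrite hpt ez sheetd_cone//.
case/andP: (hp); rewrite le_eqVlt => /orP[/eqP p0 _|p0 pr].
  rewrite sheet0//; have -> : point y p = y.
    apply: (chart_inj (cone_is_chart (hcc y)) dp (cone_center (hcc y))).
    by rewrite cp (cone_center0 (hcc y)) [p]surjective_pairing -p0 cone0.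
  by rewrite mk_pt.
exact: regular_sheet.
Qed.

Definition cover_angle (q : cover) : R := Theta (proj q).

(** The condition is on the angle upstairs: charts centred over a singular [x] are included when its
    total angle is 2 pi. *)
Definition cover_atlas : set (chart R cover) :=
  [set c | exists x u, [/\ rotations x u, Theta x = 2 * pi & c = cover_chart x u]].

Lemma dom_cover_chart x u (q : cover) : rotations x u -> dom (cover_chart x u) q ->
  regular (proj q) \/ (proj q = x /\ q = mk x u).
Proof.
move=> hu /(sheet_chart_dom hu)[p [hp ->]]; have [p0|p0] := eqVneq p.1 0.
  by right; rewrite sheet0// proj_mk.
left; have [_ _ h] := proj_sheetP hu hp; have [|//] := h _.
by rewrite lt_neqAle eq_sym p0; case/andP: hp.
Qed.

Lemma cover_atlas_cover :
  \bigcup_(c in cover_atlas) dom c = [set q | cover_angle q = 2 * pi].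
Proof.
apply/seteqP; split=> q.
  move=> [_ [x [u [hu tx ->]]] /(dom_cover_chart hu)[rq|[px _]]].
    by rewrite /= /cover_angle regular_total_angle.
  by rewrite /= /cover_angle px.
move=> /= tq; have [u [hu eq]] := mk_surj q.
exists (cover_chart (proj q) u); first by exists (proj q), u.
by rewrite {2}eq; have [] := sheet_chart_center hu.
Qed.

(** Replacing [u] by another representative of the same point shifts the polar angle of the sheet by
    the opposite amount, and the factor in [cover_chart] cancels the shift. *)
Lemma cover_chart_rot x u p (j : int) : rotations x u -> Theta x = 2 * pi ->
  0 <= p.1 < rr x ->
  cover_chart x (rot x j * u) (sheet x u p) = cover_chart x u (sheet x u p).
Proof.
move=> hu tx hp; have hu' := rotations_rot j hu.
pose p' := (p.1, p.2 + angle x * (- j)%:~R).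
have e : sheet x u p = sheet x (rot x j * u) p'.
  rewrite sheet_rot//; congr (sheet x u _); rewrite /p' /= -addrA -mulrDr.
  by rewrite -intrD addNr mulr0 addr0 -surjective_pairing.
rewrite !cover_chartE {1}e (proj2 (@sheet_chart_cone x _ p' hu' hp)).
rewrite (proj2 (sheet_chart_cone hu hp)) tx !cone2pi /p' /=.
rewrite [_ * u]mulrC -mulrA polarM mul1r; congr (_ * polar _ _).
by rewrite addrCA -mulrDr -intrD subrr mulr0 addr0.
Qed.

(** Over a regular point both charts are the preferred chart up to translation. Over a singular one
    the point must be the centre of both charts, whose parameters then differ by a turn, so the
    charts coincide. *)
Lemma cover_translations c c' (q : cover) : cover_atlas c -> cover_atlas c' ->
  dom c q -> dom c' q -> exists b, \forall q' \near q, c' q' = c q' + b.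
Proof.
move=> [x [u [hu tx ->]]] [x' [u' [hu' tx' ->]]] dq dq'.
have [rq|nrq] := pselect (regular (proj q)).
  have [g [h eq]] := pt_surj rq; set y := proj q in rq h eq.
  rewrite eq in dq dq'.
  have [b hb] := cover_chart_pt hu tx rq h dq.
  have [b' hb'] := cover_chart_pt hu' tx' rq h dq'.
  exists (b' - b); rewrite eq.
  apply: filterS (near_pt_image rq h (filterI hb hb')) => _ [y' [e e'] ->].
  by rewrite e e'; ring.
have [//|[px eq]] := dom_cover_chart hu dq.
have [//|[px' eq']] := dom_cover_chart hu' dq'.
have xx : x' = x by rewrite -px -px'.
rewrite xx in hu' tx' dq' eq' *; exists 0.
have [j hj] := mk_rot hu hu' (etrans (esym eq) eq').
have := chart_dom_near (cover_chart_is_chart hu) dq.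
apply: filterS => q' /(sheet_chart_dom hu)[p [hp ->]].
by rewrite hj cover_chart_rot// addr0.
Qed.

Lemma cover_conical x u : rotations x u ->
  cone_chart cover_atlas [set q | cover_angle q = 2 * pi] (mk x u)
    (cover_angle (mk x u)) (rr x) (sheet_chart x u).
Proof.
move=> hu; have [dc c0] := sheet_chart_center hu.
rewrite /cover_angle proj_mk//; split.
- exact: sheet_chart_is_chart.
- by [].
- split; first exact: cone_radius_gt0 (hcc x).
  apply/seteqP; split=> z.
    move=> [q [w [hw ->]] <-]; have [_ e] := sheet_chartK hu hw.
    by rewrite e.
  move=> hz; have [dz ez] := sheet_chartK hu hz.
  by exists (sheetd x u z).
- move=> q [dq nq]; have [rq|[_ eq]] := dom_cover_chart hu dq.
    by rewrite /= /cover_angle regular_total_angle.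
  by case: nq.
move=> q phi rho t dq [x1 [u1 [hu1 tx1 ->]]] dphi rho0 cq.
have [hr eq] : 0 < rho < rr x /\ q = sheet x u (rho, t).
  have [p [hp eq]] := sheet_chart_dom hu dq; case/andP: (hp) => p0 pr.
  have ec : cone (Theta x) p = cone (Theta x) (rho, t).
    by rewrite -(proj2 (sheet_chart_cone hu hp)) -eq cq.
  have e1 : p.1 = rho.
    by apply: (@complexI R); rewrite -(normr_cone (Theta x) p0) ec normr_cone ?ltW.
  have hr : 0 < rho < rr x by rewrite rho0 -e1.
  split=> //; rewrite eq -(sheetd_cone hu hp) ec sheetd_cone//.
  by case/andP: hr => h1 h2; rewrite /= ltW.
have hr' : 0 <= (rho, t).1 < rr x by case/andP: hr => /ltW ->.
have [dp cp] := pointP hr'; have [hd hg] := @devgP x (rho, t) hr.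
set y := point x _ in dp cp hg; set g := devg x _ in hd hg.
have rho0' : 0 < (rho, t).1 by [].
have [ry hP es] := sheet_pt hu dp rho0' cp hd.
rewrite eq es in dphi; have [b hb] := cover_chart_pt hu1 tx1 ry hP dphi.
(* The preferred chart on this sheet is [u] times the developing map, whence the linear coefficient
   [u]. *)
exists u, b; split; first exact: rotations_norm hu.
have h1 := cone_point_near (hcc x) dp cp hb.
have h2 := near_sheet hu dp rho0' cp hd.
have h3 : \forall p \near (rho, t), 0 < p.1 < rr x.
  exact (@near_annulus R (rr x) (rho, t) hr).
apply: filterS2 (filterI h1 h2) (filterI h3 (dev_near hd)).
move=> p [hp1 hp2] [/andP[p0 pr] hdp] q' dq' cq'.
have hp : 0 <= p.1 < rr x by rewrite ltW.
have -> : q' = sheet x u p.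
  have [dq2 cq2] := sheet_chart_cone hu hp.
  by apply: (chart_inj (sheet_chart_is_chart hu) dq' dq2); rewrite cq2.
have [dpp cpp] := pointP hp.
by rewrite (hp2 _ dpp cpp) (hp1 _ dpp cpp) (dev_val hdp dpp cpp).
Qed.

(** Distinct points of one fibre have disjoint sheets, since sheets that meet have the same centre
    by [sheet_inj]. Points of different fibres are separated downstairs. *)
Lemma cover_hausdorff : hausdorff_space cover.
Proof.
rewrite open_hausdorff => q q' /eqP qq'.
have [pq|pq] := eqVneq (proj q) (proj q').
  have [u [hu eq]] := mk_surj q; have [v [hv eq']] := mk_surj q'.
  rewrite -pq in hv eq'; set x := proj q in hu hv eq eq'.
  have ho w (hw : rotations x w) := sheetd_open hw (@open_disc R (rr x)) (fun z h => h).
  exists (sheetd x u @` [set z : plane R | `|z| < (rr x)%:C],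
          sheetd x v @` [set z : plane R | `|z| < (rr x)%:C]).
    rewrite !inE /=; split; exists 0; rewrite ?sheetd0//= normr0 ltcR.
      exact: cone_radius_gt0 (hcc x).
    exact: cone_radius_gt0 (hcc x).
  split; [exact: ho|exact: ho|apply/eqP/seteqP; split=> // w].
  move=> [[z /disc_cone[p [hp ->]] <-] [z' /disc_cone[p' [hp' ->]]]].
  rewrite !sheetd_cone// => /(sheet_inj hv hu hp' hp)[_ [j [ej _]]].
  apply: qq'; rewrite eq eq' ej; apply/mk_eq => //; first by rewrite -ej.
  by rewrite exprMn rot_pow mul1r.
have := @flat_hausdorff _ S; rewrite open_hausdorff => /(_ _ _ pq).
move=> [[A B] /= [Aq Bq'] [oA oB AB]].
have /continuousP cp := proj_continuous.
exists (proj @^-1` A, proj @^-1` B) => /=.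
  by move: Aq Bq'; rewrite !inE.
split; [exact: cp|exact: cp|].
apply/eqP/seteqP; split=> // w [Aw Bw].
by have : (A `&` B) (proj w) by []; rewrite (eqP AB).
Qed.

Lemma proj_fiber_finite x : finite_set (proj @^-1` [set x]).
Proof.
apply: sub_finite_set (finite_image (mk x) (rotations_finite x)) => q /= <-.
by have [u [hu eq]] := mk_surj q; exists u.
Qed.

Lemma cover_singular_finite : finite_set [set q | cover_angle q <> 2 * pi].
Proof.
have : finite_set (\bigcup_(x in [set x | angle x <> 2 * pi]) (proj @^-1` [set x])).
  apply: bigcup_finite; first exact: singular_finite.
  by move=> x _; exact: proj_fiber_finite.
apply: sub_finite_set => q /= hq; exists (proj q) => //= rq; apply: hq.
exact: regular_total_angle.
Qed.

(** Comparing the preferred chart of [q] with a branch of the developing map yields a rotation [u],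
    and [q] lies on the sheet of [u]. So the sheets through the fibre of [x] fill the preimage of a
    disc. *)
Lemma cover_near_fiber x e (q : cover) : 0 < e <= rr x ->
  (exists2 p, 0 <= p.1 < e & dom (cc x) (proj q) /\ cc x (proj q) = cone (angle x) p) ->
  exists u, rotations x u /\ exists2 z : plane R, `|z| < e%:C & q = sheetd x u z.
Proof.
move=> /andP[e0 er] [p /andP[p0 pe] [dq cq]].
have hp : 0 <= p.1 < rr x by rewrite p0 (lt_le_trans pe).
move: p0; rewrite le_eqVlt => /orP[/eqP p0|p0].
  have px : proj q = x.
    apply: (chart_inj (cone_is_chart (hcc x)) dq (cone_center (hcc x))).
    by rewrite cq (cone_center0 (hcc x)) [p]surjective_pairing -p0 cone0.
  have [u [hu eq]] := mk_surj q; rewrite px in hu eq; exists u; split=> //.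
  by exists 0; rewrite ?normr0 ?ltcR// sheetd0.
have rq := cone_point_regular dq p0 cq.
have [g [hP eq]] := pt_surj rq.
have [g0 [hg0 hd0]] := dev_exists (hcc x) dq p0 cq.
have [u [b [u1 hub]]] := germ_transition hg0 (red_germ (hPhi rq) hP).
have hP' : Phi (proj q) (fun z => u * g0 z).
  apply: (red_translate (b := - b) (hPhi rq) hP).
  by apply: filterS hub => z ->; rewrite addrK.
have hu := rotationsP dq p0 cq hd0 hP'.
exists u; split=> //; exists (cone (Theta x) p); first by rewrite normr_cone ?ltcR// ltW.
have [_ _ es] := sheet_pt hu dq p0 cq hd0.
rewrite sheetd_cone// es [LHS]eq.
exact (pt_translate (red_germ (hPhi rq) hP') hub).
Qed.

(** The projected filter clusters at some [x]. If no point over [x] were a cluster point, the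
    finitely many excluding neighbourhoods could be intersected, leaving over a small disc a point
    that lies on no sheet, against [cover_near_fiber]. *)
Lemma cover_compact : compact [set: cover].
Proof.
move=> F FF _; apply: contrapT => ncl.
have [x [_ clx]] := @flat_compact _ S (proj @ F) _ (@filterT _ _ _).
have step u : exists AW : set cover * set S, rotations x u ->
    [/\ F AW.1, nbhs x AW.2 & forall (q : cover) z, AW.1 q -> AW.2 (proj q) ->
       `|z| < (rr x)%:C -> q = sheetd x u z -> False].
  have [hu|nhu] := pselect (rotations x u); last by exists (setT, setT) => /nhu.
  have [A [B [FA nB AB]]] : exists A B, [/\ F A, nbhs (mk x u : cover) B & A `&` B = set0].
    apply: contrapT => nex; apply: ncl; exists (mk x u); split=> // A B FA nB.
    apply: contrapT => AB; apply: nex; exists A, B; split=> //.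
    by apply/seteqP; split=> // w ABw; apply: AB; exists w.
  have [V [oV Vu] VB] : exists2 V : set cover, open V /\ V (mk x u) & V `<=` B.
    by move: nB; rewrite nbhsE => -[V oV VB]; exists V.
  have [e he heV] := oV x u hu Vu; case/andP: (he) => e0 er.
  exists (A, [set y | dom (cc x) y /\ `|cc x y| < e%:C]) => _ /=; split=> //.
    apply: filterI; first exact: chart_dom_near (cone_is_chart (hcc x)) (cone_center (hcc x)).
    apply: (chart_near (P := fun z => `|z| < e%:C) (cone_is_chart (hcc x)) (cone_center (hcc x))).
    rewrite (cone_center0 (hcc x)); apply/nbhs_planeP; exists e => // w.
    by rewrite subr0.
  move=> q z Aq [dq cq] /disc_cone[p [hp ->]]; rewrite sheetd_cone// => eq.
  have [_ cq2 _] := proj_sheetP hu hp.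
  case/andP: (hp) => p0 pr.
  rewrite eq cq2 normr_cone// ltcR in cq.
  have : (A `&` B) q.
    split=> //; apply: VB; rewrite eq.
    move: p0; rewrite le_eqVlt => /orP[/eqP p0|p0]; first by rewrite sheet0.
    by apply: heV; rewrite p0.
  by rewrite AB.
have [AW hAW] := choice step.
have hfin := rotations_finite x.
have FA : F [set q | forall u, rotations x u -> (AW u).1 q].
  by apply: (filter_finite hfin) => u /hAW[].
have nW : nbhs x [set y | forall u, rotations x u -> (AW u).2 y].
  by apply: (filter_finite hfin) => u /hAW[].
have nR : \forall y \near x, exists2 p, 0 <= p.1 < rr x &
    dom (cc x) y /\ cc x y = cone (angle x) p.
  apply: filterS (chart_dom_near (cone_is_chart (hcc x)) (cone_center (hcc x))) => y dy.
  by have [p [hp cp]] := cone_coord (hcc x) dy; exists p.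
pose A := [set q : cover | forall u, rotations x u -> (AW u).1 q].
have FpA : F (proj @^-1` (proj @` A)) by apply: filterS FA => q hq; exists q.
have [_ [[q Aq <-] [Wq nRq]]] := clx (proj @` A) _ FpA (filterI nW nR).
have rx : 0 < rr x <= rr x by rewrite lexx (cone_radius_gt0 (hcc x)).
have [u [hu [z hz eq]]] := cover_near_fiber rx nRq.
have [_ _ h] := hAW u hu.
exact: (h q z (Aq u hu) (Wq u hu) hz eq).
Qed.

(** * Connectedness from minimality *)

Hypothesis Phi_minimal : forall Psi : S -> (S -> plane R) -> Prop,
  (forall y g g' b, Psi y g -> (\forall y' \near y, g' y' = g y' + b) ->
    Psi y g') ->
  (forall y g, germ y g -> \forall y' \near y, Psi y' g <-> Psi y g) ->
  forall y g y' g', regular y -> regular y' -> Phi y g -> Phi y' g' ->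
    Psi y g -> Psi y' g'.

(** For a clopen [B], the condition that [pt y g] belongs to [B] is locally constant and invariant
    under translation, so minimality spreads it over the whole family. *)
Lemma cover_connected : connected [set: cover].
Proof.
move=> B [b0 Bb0] [C1 oC BC1] [C2 cC BC2].
have oB : open B by rewrite BC1 setTI.
have oB' : open (~` B) by rewrite BC2 setTI; exact: closed_openC.
(* Nonempty open sets contain points over the regular part, where minimality applies. *)
have pick (O : set cover) (q : cover) : open O -> O q ->
    exists y g, [/\ regular y, Phi y g & O (pt y g)].
  move=> oO Oq; have [u [hu eq]] := mk_surj q; rewrite eq in Oq.
  set x := proj q in hu Oq; have [e /andP[e0 er] he] := oO x u hu Oq.
  have hp : 0 < (e / 2, 0 : R).1 < e.
    by rewrite /= divr_gt0//= ltr_pdivrMr// ltr_pMr// ltr1n.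
  have hp' : 0 < (e / 2, 0 : R).1 < rr x.
    by case/andP: hp => -> /= h; rewrite (lt_le_trans h).
  have := he _ hp; have [hd hg] := devgP hp'.
  have [dp cp] := @pointP x (e / 2, 0) (ltac:(by case/andP: hp' => /ltW ->)).
  have [rp hP ->] := sheet_pt hu dp (proj1 (andP hp)) cp hd => Op.
  by exists (point x (e / 2, 0)), (fun z => u * devg x (e / 2, 0) z).
apply: contrapT => nB.
have [b1 nBb1] : exists w : cover, ~ B w.
  apply: contrapT => nex; apply: nB; apply/seteqP; split=> // w _.
  by apply: contrapT => nBw; apply: nex; exists w.
have [y [g [ry h By]]] := pick B b0 oB Bb0.
have [y' [g' [ry' h' nBy']]] := pick (~` B) b1 oB' nBb1.
pose Psi y g := [/\ regular y, Phi y g & B (pt y g)].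
suff : Psi y' g' by case.
apply: (@Phi_minimal Psi _ _ y g) => //.
- move=> z f f' b [rz hf Bf] e; split=> //; first exact (red_translate (hPhi rz) hf e).
  by rewrite (pt_translate (red_germ (hPhi rz) hf) e).
- move=> z f hf; have rz := germ_regular hf.
  have hl := red_local (hPhi rz) hf; have hn := germ_near hf.
  have [hz|nhz] := pselect (Phi z f); last first.
    by apply: filterS hl => z' hz'; split=> -[_ /hz']; [|move=> /hz'].
  have hz2 := near_Phi rz hz.
  have [Bz|nBz] := pselect (B (pt z f)).
    have hB := opens_pt oB rz hz Bz.
    apply: filterS2 hz2 hB => z' [rz' hz'] Bz'.
    by split=> _; split.
  have hB := opens_pt oB' rz hz nBz.
  apply: filterS hB => z' nBz'.
  by split=> -[_ _].
Qed.

Lemma cover_angle_gt0 (q : cover) : 0 < cover_angle q.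
Proof. exact: total_angle_gt0. Qed.

Lemma cover_nonempty : [set: cover] !=set0. Proof. by exists q0. Qed.

Lemma cover_atlas_chart c : cover_atlas c -> is_chart c.
Proof. by move=> [x [u [hu _ ->]]]; exact: cover_chart_is_chart. Qed.

Lemma cover_atlas_compatible c c' (q : cover) : cover_atlas c -> cover_atlas c' ->
  dom c q -> dom c' q ->
  exists a b : plane R, `|a| = 1 /\ transition c c' q a b.
Proof.
move=> ac ac' dq dq'; have [b hb] := cover_translations ac ac' dq dq'.
exists 1, b; split; first exact: normr1.
by apply: filterS hb => z ->; rewrite mul1r.
Qed.

Lemma cover_conical_ex (q : cover) : exists r c,
  cone_chart cover_atlas [set q | cover_angle q = 2 * pi] q (cover_angle q) r c.
Proof.
have [u [hu eq]] := mk_surj q; exists (rr (proj q)), (sheet_chart (proj q) u).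
by have h := cover_conical hu; rewrite -eq in h.
Qed.

Definition cover_surface : flat_surface R := FlatSurface
  cover_nonempty cover_hausdorff cover_compact cover_connected cover_angle_gt0
  cover_singular_finite cover_atlas_chart cover_atlas_cover
  cover_atlas_compatible cover_conical_ex.

(** * The projection as a flat covering *)

Lemma cover_very_flat : very_flat cover_surface.
Proof. by apply: translation_very_flat; exact: cover_translations. Qed.

Let psi : cover_surface -> S := proj.

(** In sheet and cone charts the projection keeps rho and multiplies the recorded angle by [kk],
    since the total angle is [kk] times the cone angle; [radial] corrects the modulus. *)
Lemma cover_local_degree (q : cover_surface) :
  local_degree R psi q (kk (psi q)).
Proof.
split; first exact: kk_gt0.
have [u [hu eq]] := mk_surj q; rewrite /psi; set x := proj q in hu eq *.
exists (sheet_chart x u), (chart_map (cc x) (radial (kk x))).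
have [dq cq] := sheet_chart_center hu.
split.
- split; first exact: sheet_chart_is_chart.
  apply: is_chart_map (cone_is_chart (hcc x)) _ _ _.
  + by apply: radial_inj; exact: kk_gt0.
  + exact: radial_continuous.
  + by move=> z P; apply: radial_open; exact: kk_gt0.
- by rewrite eq.
- split; first exact: cone_center (hcc x).
  rewrite /chart_map /= (cone_center0 (hcc x)) /radial mulr0.
  by [].
move=> w /(sheet_chart_dom hu)[p [hp ->]].
have [dw cw _] := proj_sheetP hu hp; split=> //.
rewrite (proj2 (sheet_chart_cone hu hp)) /chart_map /= cw.
rewrite radial_polar ?kk_gt0//; last by case/andP: hp.
rewrite polarX; congr polar.
rewrite -mulr_natr /total_angle.
by field; rewrite pnatr_eq0 -lt0n kk_gt0 gt_eqF ?angle_gt0.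
Qed.

Lemma cover_flat_covering : flat_covering psi.
Proof.
split.
  split.
  - exact: proj_continuous.
  - apply/seteqP; split=> // x _; have [u hu] := rotations_ex x.
    by exists (mk x u) => //; exact: proj_mk.
  - exact: proj_fiber_finite.
  - by move=> q; exists (kk (psi q)); exact: cover_local_degree.
move=> q nb.
(* The point [q] has local degree [kk (psi q)], so an image outside the branch set forces the value
   1 and hence equal cone angles. *)
have k1 : kk (psi q) = 1%N.
  apply/eqP; rewrite eqn_leq kk_gt0 andbT leqNgt; apply/negP => k1; apply: nb.
  by exists q, (kk (psi q)); split=> //; exact: cover_local_degree.
have ta : Theta (psi q) = angle (psi q) by rewrite /total_angle k1 mul1r.
split; first exact: esym ta.
have [u [hu eq]] := mk_surj q; rewrite /psi in k1 ta *.
set x := proj q in hu eq k1 ta *.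
exists (rr x), (sheet_chart x u), (cc x); split.
- by rewrite eq; exact: cover_conical.
- exact: hcc.
move=> w /(sheet_chart_dom hu)[p [hp ->]].
have [dw cw _] := proj_sheetP hu hp; split=> //.
by rewrite (proj2 (sheet_chart_cone hu hp)) cw ta.
Qed.

(** * Deck transformations *)

Definition symmetry a := forall y g, regular y -> Phi y g -> Phi y (fun z => a * g z).

(** Rotations commute with transport: the distinguished charts that stay distinguished after
    multiplication by [v / u] form a locally constant family, nonempty near [x], hence everything by
    minimality. *)
Lemma rotations_symmetry x u v : rotations x u -> rotations x v -> symmetry (v / u).
Proof.
move=> hu hv; have un := norm1_neq0 (rotations_norm hu).
have a1 : `|v / u| = 1.
  by rewrite normrM normfV (rotations_norm hu) (rotations_norm hv) invr1 mulr1.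
have [y [p [g [/andP[p0 _] dy cy hd hg]]]] := cone_sample x.
have ry := cone_point_regular dy p0 cy.
have hu' := hu y p g dy p0 cy hd; have hv' := hv y p g dy p0 cy hd.
pose Psi y g := [/\ regular y, Phi y g & Phi y (fun z => v / u * g z)].
move=> y' g' ry' h'; suff : Psi y' g' by case.
apply: (@Phi_minimal Psi _ _ y (fun z => u * g z)) => //.
- move=> z f f' b [rz hf hf'] e; split=> //; first exact (red_translate (hPhi rz) hf e).
  apply: (red_translate (b := v / u * b) (hPhi rz) hf').
  by apply: filterS e => w ->; rewrite mulrDr.
- move=> z f hf; have rz := germ_regular hf.
  have hl := red_local (hPhi rz) hf.
  have hl' := red_local (hPhi rz) (germ_scale hf a1).
  apply: filterS2 (filterI hl hl') (germ_near hf) => z' [e e'] hf'.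
  have rz' := germ_regular hf'.
  by split=> -[_ /e h1 /e' h2]; split.
- split=> //; apply: (red_translate (b := 0) (hPhi ry) hv').
  by apply: filterE => z; rewrite addr0 mulrA divfK.
Qed.

Lemma symmetry_rotations a x u : symmetry a -> rotations x u -> rotations x (a * u).
Proof.
move=> ha hu y p g dy p0 cy hd.
have ry := cone_point_regular dy p0 cy.
apply: (red_translate (b := 0) (hPhi ry) (ha _ _ ry (hu y p g dy p0 cy hd))).
by apply: filterE => z; rewrite addr0 mulrA.
Qed.

(** A representative of [q] is chosen and rotated. For a symmetry [a] the choice is immaterial,
    because the cover records only [kk]-th powers. *)
Definition deck a (q : cover) : cover :=
  mk (proj q) (a * xget 0 [set u | rotations (proj q) u /\ q = mk (proj q) u]).

Lemma deck_mk a x u : symmetry a -> rotations x u -> deck a (mk x u) = mk x (a * u).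
Proof.
move=> ha hu; rewrite /deck proj_mk//; case: xgetP => [v _ [hv e]|/(_ u)]; last by case.
apply/mk_eq; [exact: symmetry_rotations|exact: symmetry_rotations|].
by move/(mk_eq hu hv): e => e; rewrite !exprMn e.
Qed.

Lemma deck_sheet a x u p : symmetry a -> rotations x u -> 0 < p.1 < rr x ->
  deck a (sheet x u p) = sheet x (a * u) p.
Proof.
move=> ha hu hp; have [hd hg] := devgP hp; case/andP: (hp) => p0 pr.
have [dp cp] := @pointP x p (ltac:(by rewrite ltW)).
have [ry hP ->] := sheet_pt hu dp p0 cp hd.
have hu' := symmetry_rotations ha hu.
have [_ _ ->] := sheet_pt hu' dp p0 cp hd.
have hc := coef_rotations ry hP.
have hg' := red_germ (hPhi ry) hP.
have a1 : `|a| = 1.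
  apply: (mulIf (x := `|u|)); first by rewrite (rotations_norm hu) oner_eq0.
  by rewrite -normrM (rotations_norm hu) (rotations_norm hu') mul1r.
rewrite /pt deck_mk// -coef_scale//.
by congr (mk _ (coef _ _)); apply/funext => z; rewrite mulrA.
Qed.

(** A symmetry carries the sheet of [u] to the sheet of [a * u] with the same polar coordinates, so
    small sheet discs pull back to small sheet discs. *)
Lemma deck_continuous a : symmetry a -> continuous (deck a : cover -> cover).
Proof.
move=> ha; apply/continuousP => A oA.
change (opens (deck a @^-1` A)) => x u hu; rewrite /= deck_mk// => Au.
have [e he heA] := oA x (a * u) (symmetry_rotations ha hu) Au.
exists e => // p /andP[p0 pe]; rewrite /= deck_sheet//.
  by apply: heA; rewrite p0.
by rewrite p0 (lt_le_trans pe)//; case/andP: he.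
Qed.

Lemma deckK a : symmetry a -> symmetry a^-1 -> a != 0 -> cancel (deck a) (deck a^-1).
Proof.
move=> ha ha' an q; have [u [hu ->]] := mk_surj q.
by rewrite !deck_mk//; [rewrite mulKf|exact: symmetry_rotations].
Qed.

(** For two points of a fibre with representatives [u] and [v], the ratio [v / u] is a symmetry, and
    its deck transformation moves the first point to the second. *)
Lemma cover_galois : Defs.galois psi.
Proof.
move=> q q' e; rewrite /psi in e.
have [u [hu eq]] := mk_surj q; have [v [hv eq']] := mk_surj q'.
rewrite -e in hv eq'; set x := proj q in hu hv eq eq'.
have un := norm1_neq0 (rotations_norm hu); have vn := norm1_neq0 (rotations_norm hv).
have ha := rotations_symmetry hu hv.
have ha' : symmetry (v / u)^-1 by rewrite invf_div; exact: rotations_symmetry hv hu.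
have an : v / u != 0 by rewrite mulf_neq0 ?invr_eq0.
exists (deck (v / u)); split; last by rewrite eq deck_mk// divfK.
split.
- exact: deck_continuous.
- apply/funext => w /=; have [t [ht ew]] := mk_surj w.
  by rewrite /psi ew deck_mk// !proj_mk//; exact: symmetry_rotations.
exists (deck (v / u)^-1); split; first exact: deck_continuous.
- exact: deckK.
- move=> w; have := @deckK (v / u)^-1; rewrite invrK; apply=> //.
  by rewrite invr_eq0.
Qed.

End Cover.

Lemma really_flat_cover {R : realType} (S : flat_surface R) : really_flat S ->
  exists (S' : flat_surface R) (psi : S' -> S),
    [/\ very_flat S', flat_covering psi & Defs.galois psi].
Proof.
move=> /really_flat_reduction[Phi [hPhi hmin]].
have [rr hrr] := choice (@conical R S); have [cc hcc] := choice hrr.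
have [kk hkk] := choice (rot_order hPhi hcc).
have [x0 _] := flat_nonempty S; have [u hu] := rotations_ex hPhi hcc x0.
pose q0 : cover Phi cc kk := exist _ (x0, u ^+ kk x0) (ex_intro _ u (conj hu erefl)).
have hmin' Psi ht hl y g y' g' (_ : regular y) (_ : regular y') :=
  hmin Psi ht hl y g y' g'.
exists (cover_surface hPhi hcc hkk q0 hmin').
exists (@proj _ _ Phi cc kk); split.
- exact: cover_very_flat.
- exact: cover_flat_covering.
- exact: cover_galois.
Qed.

Theorem theorem1 (R : realType) :
  (forall S : flat_surface R, really_flat S ->
     exists (S' : flat_surface R) (psi : S' -> S),
       [/\ very_flat S', flat_covering psi & Defs.galois psi])
  /\
  (forall (S'' S' : flat_surface R) (alpha : S'' -> S'),
     flat_covering alpha -> (really_flat S'' <-> really_flat S')).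
Proof.
split=> [S|S'' S' alpha]; first exact: really_flat_cover.
exact: flat_covering_really_flat.
Qed.
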